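(* Let $\mathcal{O}$ be the ring of integers of a finite extension of $\mathbb{Q}_p$, $\Lambda=\mathcal{O}[[t]]$, $I=(t)$, and let $C$ be a bounded complex of finitely generated $\Lambda$-modules such that $C_I:=C\otimes^{\mathbf L}_\Lambda\Lambda_I$ is acyclic outside degrees one and two, $H^1(C_I)$ is $\Lambda_I$-free, and $\mathrm{rk}_\Lambda(H^1(C))\ge \mathrm{rk}_\Lambda(H^2(C))$. Put $C_0:=C\otimes^{\mathbf L}_\Lambda\mathcal{O}$. With the numbers $r,e,\sigma,\tau,\varrho,k_0$ and the maps $\pi,\pi_0,\mathcal{D},R^{(k_0)}$ defined in the context, the following diagram commutes: the composite $$\det{}_\Lambda^{-1}(C)\xrightarrow{\ \pi\ } I^{\varrho}\cdot\bigwedge\nolimits_{\Lambda_I}^{\sigma}H^1(C)_I\otimes_{\Lambda_I}\bigwedge\nolimits_{\Lambda_I}^{\tau}H^2(C)_I^\ast\xrightarrow{\ \mathcal{D}\ }\mathbb{Q}_p\otimes_{\mathbb{Z}_p}\Big(\bigwedge\nolimits_{\mathcal{O}}^{\sigma}H^1(C_0)\otimes_{\mathcal O}\bigwedge\nolimits_{\mathcal O}^{\tau}H^2(C_0)^\ast\otimes_{\mathcal O}Q^{\varrho}\Big)$$ is equal to the composite $$\det{}_\Lambda^{-1}(C)\twoheadrightarrow\det{}_{\mathcal O}^{-1}(C_0)\xrightarrow{\ \pi_0\ }\mathbb{Q}_p\otimes_{\mathbb{Z}_p}\Big(\bigwedge\nolimits_{\mathcal O}^{r+e}H^1(C_0)\otimes_{\mathcal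 O}\bigwedge\nolimits_{\mathcal O}^{e}H^2(C_0)^\ast\Big)\xrightarrow{R^{(k_0)}}\mathbb{Q}_p\otimes_{\mathbb{Z}_p}\Big(\bigwedge\nolimits_{\mathcal{O}}^{\sigma}H^1(C_0)\otimes_{\mathcal O}\bigwedge\nolimits_{\mathcal O}^{\tau}H^2(C_0)^\ast\otimes_{\mathcal O}Q^{\varrho}\Big),$$ where the first map of the second composite is the natural surjection induced by $\det_\Lambda^{-1}(C)\otimes_\Lambda\mathcal{O}\simeq\det_{\mathcal O}^{-1}(C_0)$.
   Context: $p$ is a prime. $X^\ast$ denotes the linear dual over the relevant ring. $M_I$ is the localization of a $\Lambda$-module $M$ at the prime $I$; $Q^k:=I^k/I^{k+1}$ (free of rank one over $\mathcal O$, generated by $t^k$; $Q^k\otimes Q^l=Q^{k+l}$). Ranks of kernels etc. are $\mathcal O$-ranks. $\det$ is the determinant functor on perfect complexes (graded invertible modules), $\det^{-1}(C)=\bigotimes_i\det^{(-1)^{i+1}}(C^i)$. Derived Bockstein maps. The exact sequences $0\to I^{k+1}C\to I^kC\to C_0\otimes_{\mathcal O}Q^k\to0$ give exact sequences $$H^1(C_0)\otimes Q^k\xrightarrow{\delta_k}H^2(I^{k+1}C)\xrightarrow{\iota_k}H^2(I^kC)\xrightarrow{\pi_k}H^2(C_0)\otimes Q^k.$$ Set $\beta^{(1)}:=\pi_1\circ\delta_0:H^1(C_0)\to H^2(C_0)\otimes_{\mathcal O}Q^1$. For $k\ge2$ define inductively $\beta^{(k)}:\ker\beta^{(k-1)}\to\mathrm{coker}\,\beta^{(k-1)}\otimes_{\mathcal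 O}Q^1$: for $a\in\ker\beta^{(k-1)}$ there is $\tilde a\in H^2(I^kC)$ with $\delta_0(a)=\iota_1\circ\cdots\circ\iota_{k-1}(\tilde a)$, and $\beta^{(k)}(a)$ is the image of $\pi_k(\tilde a)\in H^2(C_0)\otimes Q^k$ under the natural surjection onto $\mathrm{coker}\,\beta^{(k-1)}\otimes Q^1$ (this is well defined). Numbers. $r:=\mathrm{rk}_\Lambda H^1(C)-\mathrm{rk}_\Lambda H^2(C)=\mathrm{rk}_{\mathcal O}H^1(C_0)-\mathrm{rk}_{\mathcal O}H^2(C_0)$, $e:=\mathrm{rk}_{\mathcal O}H^2(C_0)$; for $k\ge1$, $\sigma_k:=\mathrm{rk}\ker\beta^{(k)}$, $\tau_k:=\mathrm{rk}\,\mathrm{coker}\,\beta^{(k)}$, $e_k:=\mathrm{rk}\,\mathrm{im}\,\beta^{(k)}$. $k_0\ge1$ is the minimal integer such that $e_k=0$ for all $k>k_0$. Put $\sigma:=\sigma_{k_0}$, $\tau:=\tau_{k_0}$, $\varrho:=\sum_{k=1}^{k_0}ke_k$. One has $\sigma=\mathrm{rk}_\Lambda H^1(C)$, $\tau=\mathrm{rk}_\Lambda H^2(C)$, $\mathrm{Fitt}_{\Lambda_I}(H^2(C)_{I,\mathrm{tors}})=I^\varrho\Lambda_I$, and $\mathbb{Q}_p\otimes\ker\beta^{(k_0)}\simeq H^1(C)_I/IH^1(C)_I$ naturally. The map $R^{(k_0)}$. The exact sequences $0\to\ker\beta^{(1)}\to H^1(C_0)\to H^2(C_0)\otimes Q^1\to\mathrm{coker}\,\beta^{(1)}\to0$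 and $0\to\ker\beta^{(l+1)}\to\ker\beta^{(l)}\to\mathrm{coker}\,\beta^{(l)}\otimes Q^1\to\mathrm{coker}\,\beta^{(l+1)}\to0$ ($1\le l<k_0$) give, by composing the induced canonical isomorphisms of determinants, $$\det{}_{\mathcal O}(H^1(C_0))\otimes\det{}_{\mathcal O}^{-1}(H^2(C_0))\simeq\det{}_{\mathcal O}(\ker\beta^{(k_0)})\otimes\det{}_{\mathcal O}^{-1}(\mathrm{coker}\,\beta^{(k_0)})\otimes Q^{\rho_{k_0}},\quad \rho_{k_0}=e+\sum_{l=1}^{k_0-1}\tau_l=\varrho+k_0\tau .$$ Tensoring with $\mathbb{Q}_p$ and using $\ker\beta^{(k_0)}\subset H^1(C_0)$ and the surjection $H^2(C_0)\otimes Q^{k_0}\twoheadrightarrow\mathrm{coker}\,\beta^{(k_0)}$ (which gives $\mathbb{Q}_p\otimes\bigwedge^\tau\mathrm{coker}\,\beta^{(k_0),\ast}\otimes Q^{\rho_{k_0}}\hookrightarrow\mathbb{Q}_p\otimes\bigwedge^\tau H^2(C_0)^\ast\otimes Q^\varrho$) one obtains $R^{(k_0)}$ with the source and target stated in the claim. The map $\pi$ is induced by $\det_\Lambda^{-1}(C)_I\simeq\det_{\Lambda_I}(H^1(C)_I)\otimes\det_{\Lambda_I}^{-1}(H^2(C)_I)=I^\varrho\cdot\bigwedge^\sigma_{\Lambda_I}H^1(C)_I\otimes\bigwedge^\tau_{\Lambda_I}H^2(C)_I^\ast$. The map $\pi_0$ is induced by $\mathbb{Q}_p\otimes\det_{\mathcal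 O}^{-1}(C_0)\simeq\mathbb{Q}_p\otimes(\det_{\mathcal O}H^1(C_0)\otimes\det_{\mathcal O}^{-1}H^2(C_0))$. The map $\mathcal D$ sends $a\cdot x\otimes y$ ($a\in I^\varrho$) to $\bar x\otimes\bar y\otimes\bar a$, where $\bar x$ is the image of $x$ in $\bigwedge^\sigma H^1(C)_I\otimes\Lambda_I/I\Lambda_I\simeq\mathbb{Q}_p\otimes\bigwedge^\sigma\ker\beta^{(k_0)}\subset\mathbb{Q}_p\otimes\bigwedge^\sigma H^1(C_0)$, $\bar y$ is the natural image of $y$ in $\mathbb{Q}_p\otimes\bigwedge^\tau H^2(C_0)^\ast$ (by reduction modulo $I$), and $\bar a$ is the class of $a$ in $Q^\varrho$. Normalization of canonical isomorphisms: for an exact sequence $0\to W\to U\xrightarrow{\varphi}V\to X\to0$ of finite-dimensional vector spaces over a field, of dimensions $c,a,b,b-a+c$, with bases $u_1,\dots,u_a$ of $U$ and $v_1,\dots,v_b$ of $V$ such that $\varphi(u_i)=\alpha_iv_i$ with $\alpha_i\neq0$ for $i\le a-c$ and $\varphi(u_i)=0$ for $i>a-c$, the canonical isomorphism $\bigwedge^aU\otimes\bigwedge^bV^\ast\simeq\bigwedge^cW\otimes\bigwedge^{b-a+c}X^\ast$ sends $u_1\wedge\cdots\wedge u_a\otimes v_1^\ast\wedge\cdots\wedge v_b^\ast$ to $\alpha_1\cdots\alpha_{a-c}\,u_{a-c+1}\wedge\cdots\wedge u_a\otimes v_{a-c+1}^\ast\wedge\cdots\wedge v_b^\ast$. *)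

(* Defs.v *)
From HB Require Import structures.
From mathcomp Require Import all_boot all_order all_algebra all_field.
From mathcomp Require Import finmap mathcomp_extra boolp classical_sets functions.
From mathcomp Require Import cardinality fsbigop.

Set Implicit Arguments.
Unset Strict Implicit.
Unset Printing Implicit Defensive.

Import Order.TTheory GRing.Theory Num.Theory.

Local Open Scope classical_set_scope.
Local Open Scope ring_scope.

(* Unit structures on commutative rings, inverses being found by choice. *)
Section ClassicalUnits.
Variable R : comNzRingType.

Definition cl_unit : {pred R} := fun x => `[< exists y, y * x = 1 >].
Definition cl_inv (x : R) : R := xget x [set y | y * x = 1].

Lemma cl_mulVx : {in cl_unit, left_inverse 1 cl_inv *%R}.
Proof.
move=> x /asboolP[y yx]; rewrite /cl_inv.
by case: xgetP => [z _ //|/(_ y)]; case.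
Qed.

Lemma cl_unitP (x y : R) : y * x = 1 -> cl_unit x.
Proof. by move=> yx; apply/asboolP; exists y. Qed.

Lemma cl_inv_out : {in [predC cl_unit], cl_inv =1 id}.
Proof.
move=> x /negP nx; rewrite /cl_inv; case: xgetP => [z _ zx|//].
by case: nx; apply/asboolP; exists z.
Qed.

End ClassicalUnits.

(* Z_p as the inverse limit of the Z/p^n: a coherent sequence is stored by its
   reduced representatives, x n being the residue in [0, p^n[. *)
Section PAdic.
Variable p : nat.

Definition coherent : pred (nat -> int) :=
  fun x => `[< forall n, (x n.+1 %% (p ^ n)%N)%Z = x n >].

Record padic_int (pr : prime p) :=
  PadicInt { Zp_val : nat -> int; Zp_valP : coherent Zp_val }.

Variable p_pr : prime p.
Local Notation Zp := (padic_int p_pr).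
Local Notation MkZp := (@PadicInt p_pr).

HB.instance Definition _ := [isSub for @Zp_val p_pr].
HB.instance Definition _ := [Choice of Zp by <:].

Lemma Zp_mod (x : Zp) n : (Zp_val x n %% (p ^ n)%N)%Z = Zp_val x n.
Proof.
by case: x => x /= /asboolP xP; rewrite -{1}xP modz_mod xP.
Qed.

Lemma Zp_coh (x : Zp) n : (Zp_val x n.+1 %% (p ^ n)%N)%Z = Zp_val x n.
Proof. by case: x => x /= /asboolP xP. Qed.

Lemma mod_expS (m : int) n :
  ((m %% (p ^ n.+1)%N)%Z %% (p ^ n)%N)%Z = (m %% (p ^ n)%N)%Z.
Proof.
rewrite {2}(divz_eq m (p ^ n.+1)%N) [X in (_ * X + _)](_ : _ = p%:Z * (p ^ n)%N).
  by rewrite mulrA modzMDl.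
by rewrite expnS PoszM.
Qed.

Lemma coh_reduce (f : nat -> int) :
  (forall n, f n.+1 = f n %[mod (p ^ n)%N])%Z ->
  coherent (fun n => (f n %% (p ^ n)%N)%Z).
Proof. by move=> fP; apply/asboolP => n; rewrite mod_expS fP. Qed.

Lemma Zp_cohm (x : Zp) n : (Zp_val x n.+1 = Zp_val x n %[mod (p ^ n)%N])%Z.
Proof. by rewrite Zp_coh Zp_mod. Qed.

Lemma Zp_natP (m : int) n : (m = m %[mod (p ^ n)%N])%Z. Proof. by []. Qed.

Definition Zp_const (m : int) : Zp := MkZp (coh_reduce (fun n => Zp_natP m n)).

Lemma Zp_addP (x y : Zp) n :
  (Zp_val x n.+1 + Zp_val y n.+1 = Zp_val x n + Zp_val y n %[mod (p ^ n)%N])%Z.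
Proof. by rewrite -modzDm !Zp_cohm modzDm. Qed.
Definition Zp_add x y : Zp := MkZp (coh_reduce (Zp_addP x y)).

Lemma Zp_oppP (x : Zp) n :
  (- Zp_val x n.+1 = - Zp_val x n %[mod (p ^ n)%N])%Z.
Proof. by rewrite -modzNm Zp_cohm modzNm. Qed.
Definition Zp_opp x : Zp := MkZp (coh_reduce (Zp_oppP x)).

Lemma Zp_mulP (x y : Zp) n :
  (Zp_val x n.+1 * Zp_val y n.+1 = Zp_val x n * Zp_val y n %[mod (p ^ n)%N])%Z.
Proof. by rewrite -modzMm !Zp_cohm modzMm. Qed.
Definition Zp_mul x y : Zp := MkZp (coh_reduce (Zp_mulP x y)).

Lemma Zp_eq (x y : Zp) : Zp_val x =1 Zp_val y -> x = y.
Proof. by move=> xy; apply/val_inj/funext. Qed.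

Lemma Zp_addA : associative Zp_add.
Proof. by move=> x y z; apply: Zp_eq => n /=; rewrite modzDml modzDmr addrA. Qed.
Lemma Zp_addC : commutative Zp_add.
Proof. by move=> x y; apply: Zp_eq => n /=; rewrite addrC. Qed.
Lemma Zp_add0 : left_id (Zp_const 0) Zp_add.
Proof. by move=> x; apply: Zp_eq => n /=; rewrite modzDml add0r Zp_mod. Qed.
Lemma Zp_addN : left_inverse (Zp_const 0) Zp_opp Zp_add.
Proof. by move=> x; apply: Zp_eq => n /=; rewrite modzDml addNr. Qed.

HB.instance Definition _ :=
  GRing.isZmodule.Build Zp Zp_addA Zp_addC Zp_add0 Zp_addN.

Lemma Zp_mulA : associative Zp_mul.
Proof. by move=> x y z; apply: Zp_eq => n /=; rewrite modzMml modzMmr mulrA. Qed.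
Lemma Zp_mulC : commutative Zp_mul.
Proof. by move=> x y; apply: Zp_eq => n /=; rewrite mulrC. Qed.
Lemma Zp_mul1 : left_id (Zp_const 1) Zp_mul.
Proof. by move=> x; apply: Zp_eq => n /=; rewrite modzMml mul1r Zp_mod. Qed.
Lemma Zp_mulD : left_distributive Zp_mul +%R.
Proof.
by move=> x y z; apply: Zp_eq => n /=; rewrite modzMml modzDml modzDmr mulrDl.
Qed.
Lemma Zp_1neq0 : Zp_const 1 != 0.
Proof.
apply/eqP => /(congr1 (fun x => Zp_val x 1%N)) /=.
rewrite expn1 mod0z modz_small //=.
by rewrite /= ltz_nat prime_gt1.
Qed.

HB.instance Definition _ := GRing.Zmodule_isComNzRing.Build Zp
  Zp_mulA Zp_mulC Zp_mul1 Zp_mulD Zp_1neq0.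

HB.instance Definition _ := GRing.ComNzRing_hasMulInverse.Build Zp
  (@cl_mulVx Zp) (@cl_unitP Zp) (@cl_inv_out Zp).

End PAdic.

Section PAdicDomain.
Variables (p : nat) (p_pr : prime p).
Local Notation Zp := (padic_int p_pr).

Lemma Zp_modle (x : Zp) m n :
  (Zp_val x (n + m)%N %% (p ^ n)%N)%Z = Zp_val x n.
Proof.
elim: m => [|m IH]; first by rewrite addn0 Zp_mod.
rewrite addnS -IH -[Zp_val x (n + m)%N]Zp_coh expnD PoszM.
set a := Zp_val x _.
rewrite [in LHS](divz_eq a ((p ^ n)%N%:Z * (p ^ m)%N%:Z)).
have E (q u v r : int) : q * (u * v) + r = q * v * u + r by rewrite (mulrC u) mulrA.
by rewrite E modzMDl.
Qed.

Lemma Zp_neq0 (x : Zp) : x != 0 -> exists n, Zp_val x n != 0.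
Proof.
move=> x0; apply: contrapT => h; move/eqP: x0; apply; apply: Zp_eq => n /=.
rewrite mod0z; apply/eqP/negPn/negP => xn; apply: h; by exists n.
Qed.

Lemma Zp_integral : GRing.integral_domain_axiom Zp.
Proof.
move=> x y xy0.
apply: contrapT => /negP; rewrite negb_or => /andP[/Zp_neq0[m xm] /Zp_neq0[n yn]].
move/(congr1 (fun z => Zp_val z (m + n)%N)): xy0 => /=; rewrite mod0z.
set a := Zp_val x _; set b := Zp_val y _ => /eqP.
have am : ~~ (p ^ m %| `|a|)%N.
  apply: contra xm => d; apply/eqP; rewrite -(Zp_modle x n m) -/a.
  by apply/dvdz_mod0P; rewrite dvdzE.
have bn : ~~ (p ^ n %| `|b|)%N.
  apply: contra yn => d; apply/eqP; rewrite -(Zp_modle y m n) addnC -/b.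
  by apply/dvdz_mod0P; rewrite dvdzE.
have a0 : (0 < `|a|)%N by case: (posnP `|a|%N) am => // ->; rewrite dvdn0.
have b0 : (0 < `|b|)%N by case: (posnP `|b|%N) bn => // ->; rewrite dvdn0.
move/eqP/dvdz_mod0P; rewrite dvdzE abszM /= pfactor_dvdn ?muln_gt0 ?a0 //.
rewrite lognM //; apply/negP; rewrite -ltnNge.
by rewrite !pfactor_dvdn // -!ltnNge in am bn; rewrite -addnS leq_add // ltnW.
Qed.

HB.instance Definition _ := GRing.ComUnitRing_isIntegral.Build Zp Zp_integral.

End PAdicDomain.

Notation Qp p_pr := {fraction (padic_int p_pr)}.

Section RingOfIntegers.
Variables (p : nat) (p_pr : prime p) (K : fieldExtType (Qp p_pr)).

Definition Zp_in (x : padic_int p_pr) : K := (tofrac x)%:A.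

Lemma Zp_in_zmod : zmod_morphism Zp_in.
Proof. by move=> x y; rewrite /Zp_in rmorphB scalerBl. Qed.
Lemma Zp_in_monoid : monoid_morphism Zp_in.
Proof.
by split=> [|x y]; rewrite /Zp_in ?rmorph1 ?scale1r // rmorphM -[in RHS]scalerAl mul1r scalerA.
Qed.
HB.instance Definition _ := GRing.isZmodMorphism.Build _ _ Zp_in Zp_in_zmod.
HB.instance Definition _ := GRing.isMonoidMorphism.Build _ _ Zp_in Zp_in_monoid.

Definition integral_pred : {pred K} := fun x => `[< integralOver Zp_in x >].

Fact integral_subring : subring_closed integral_pred.
Proof.
split=> [|x y /asboolP Ix /asboolP Iy|x y /asboolP Ix /asboolP Iy]; apply/asboolP.
- exact: integral1.
- exact: integral_sub.
- exact: integral_mul.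
Qed.
HB.instance Definition _ :=
  GRing.isSubringClosed.Build K integral_pred integral_subring.

Record Oring := MkO { O_val : K; O_valP : O_val \in integral_pred }.
HB.instance Definition _ := [isSub for O_val].
HB.instance Definition _ := [Choice of Oring by <:].
HB.instance Definition _ := [SubChoice_isSubComNzRing of Oring by <:].
HB.instance Definition _ := GRing.ComNzRing_hasMulInverse.Build Oring
  (@cl_mulVx Oring) (@cl_unitP Oring) (@cl_inv_out Oring).

Lemma O_integral : GRing.integral_domain_axiom Oring.
Proof.
move=> x y /(congr1 val); rewrite rmorphM rmorph0 => /eqP; rewrite mulf_eq0.
by rewrite -!(rmorph0 (val : Oring -> K)) !(inj_eq val_inj).
Qed.
HB.instance Definition _ := GRing.ComUnitRing_isIntegral.Build Oring O_integral.

Definition OtoK : Oring -> K := val.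
HB.instance Definition _ := GRing.RMorphism.on OtoK.

End RingOfIntegers.

Section PowerSeries.
Variable R : comNzRingType.

Definition series := nat -> R.
HB.instance Definition _ := GRing.Zmodule.on series.

Definition series_mul (a b : series) : series :=
  fun n => \sum_(i < n.+1) a i * b (n - i)%N.
Definition series_C (c : R) : series := fun n => if n == 0%N then c else 0.

(* the polynomial with the same first n coefficients *)
Definition trunc n (a : series) : {poly R} := \poly_(i < n) a i.

Lemma coef_trunc n a i : (trunc n a)`_i = if (i < n)%N then a i else 0.
Proof. by rewrite coef_poly. Qed.

Lemma series_mulE n (a b : series) i : (i < n)%N ->
  series_mul a b i = (trunc n a * trunc n b)`_i.
Proof.
move=> ni; rewrite coefM; apply: eq_bigr => j _.
rewrite !coef_trunc (leq_ltn_trans _ ni) ?leq_ord //.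
by rewrite (leq_ltn_trans _ ni) ?leq_subr.
Qed.

Lemma coefM_eq n (a b c d : {poly R}) :
  (forall i, (i < n)%N -> a`_i = c`_i) -> (forall i, (i < n)%N -> b`_i = d`_i) ->
  forall i, (i < n)%N -> (a * b)`_i = (c * d)`_i.
Proof.
move=> ac bd i ni; rewrite !coefM; apply: eq_bigr => j _.
by rewrite ac ?bd // ?(leq_ltn_trans _ ni) ?leq_subr // leq_ord.
Qed.

Lemma series_mulA : associative series_mul.
Proof.
move=> a b c; apply/funext => n; rewrite !(@series_mulE n.+1) //.
transitivity ((trunc n.+1 a * trunc n.+1 b * trunc n.+1 c)`_n).
  rewrite -mulrA; apply: (@coefM_eq n.+1) => // i ni.
  by rewrite coef_trunc ni (@series_mulE n.+1).
symmetry; apply: (@coefM_eq n.+1) => // i ni.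
by rewrite coef_trunc ni (@series_mulE n.+1).
Qed.

Lemma series_mulC : commutative series_mul.
Proof. by move=> a b; apply/funext => n; rewrite !(@series_mulE n.+1) // mulrC. Qed.

Lemma series_mul1 : left_id (series_C 1) series_mul.
Proof.
move=> a; apply/funext => n; rewrite /series_mul big_ord_recl /= subn0 mul1r.
by rewrite big1 ?addr0 // => i _; rewrite mul0r.
Qed.

Lemma series_mulDl : left_distributive series_mul +%R.
Proof.
move=> a b c; apply/funext => n; rewrite /series_mul [RHS]/GRing.add /=.
by rewrite -big_split /=; apply: eq_bigr => i _; rewrite -mulrDl.
Qed.

Lemma series_1neq0 : series_C 1 != 0 :> series.
Proof.
apply/eqP => /(congr1 (fun a : series => a 0%N)) /eqP; rewrite /= oner_eq0 //.
Qed.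

HB.instance Definition _ := GRing.Zmodule_isComNzRing.Build series
  series_mulA series_mulC series_mul1 series_mulDl series_1neq0.
HB.instance Definition _ := GRing.ComNzRing_hasMulInverse.Build series
  (@cl_mulVx series) (@cl_unitP series) (@cl_inv_out series).

Definition ev0 (a : series) : R := a 0%N.
Lemma ev0_zmod : zmod_morphism ev0. Proof. by []. Qed.
Lemma ev0_monoid : monoid_morphism ev0.
Proof.
split=> // a b; rewrite /ev0 [in LHS]/GRing.mul /= /series_mul.
by rewrite big_ord_recl big_ord0 addr0.
Qed.
HB.instance Definition _ := GRing.isZmodMorphism.Build _ _ ev0 ev0_zmod.
HB.instance Definition _ := GRing.isMonoidMorphism.Build _ _ ev0 ev0_monoid.

(* I^k = (t^k) *)
Definition Ipow (k : nat) : set series :=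
  [set a | forall i, (i < k)%N -> a i = 0].

End PowerSeries.

Section PowerSeriesDomain.
Variable R : idomainType.

Lemma series_integral : GRing.integral_domain_axiom (series R).
Proof.
move=> a b ab0; apply: contrapT => /negP; rewrite negb_or => /andP[a0 b0].
have low (c : series R) : c != 0 ->
    exists2 n, c n != 0 & forall i, (i < n)%N -> c i = 0.
  move=> c0; have ex : exists n, c n != 0.
    apply: contrapT => h; move/eqP: c0; apply; apply/funext => n.
    by apply/eqP/negPn/negP => cn; apply: h; exists n.
  exists (ex_minn ex); first by case: ex_minnP.
  case: ex_minnP => n _ nmin i ni; apply/eqP/negPn/negP => ci.
  by move: ni; rewrite ltnNge nmin.
have [m am ami] := low a a0; have [n bn bni] := low b b0.
move/(congr1 (fun c : series R => c (m + n)%N)): ab0.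
rewrite [in LHS]/GRing.mul /= /series_mul.
have mlt : (m < (m + n).+1)%N by rewrite ltnS leq_addr.
rewrite (bigD1 (Ordinal mlt)) //= addKn big1 ?addr0.
  by move=> /eqP; rewrite mulf_eq0 (negPf am) (negPf bn).
move=> i im; case: (ltngtP i m) => h; first by rewrite ami // mul0r.
  rewrite bni ?mulr0 // ltn_subLR ?leq_ord // ltn_add2r //.
by move: im; rewrite -val_eqE /= h eqxx.
Qed.
HB.instance Definition _ :=
  GRing.ComUnitRing_isIntegral.Build (series R) series_integral.

End PowerSeriesDomain.

Section Localization.
Variable R : idomainType.

(* series R localized at the prime I = (t), inside its field of fractions *)
Definition locI_pred : {pred {fraction (series R)}} := fun x =>
  `[< exists a b : series R, ~ Ipow 1 b /\ x = tofrac a / tofrac b >].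

Lemma notI (b : series R) : ~ Ipow 1 b <-> b 0%N != 0.
Proof.
split=> [h|b0 h]; last by rewrite h ?eqxx in b0.
by apply/negP => /eqP b0; apply: h => -[].
Qed.

Lemma notI1 : ~ Ipow 1 (1 : series R).
Proof. by apply/notI; rewrite -[X in X != _]/(ev0 1) rmorph1 oner_neq0. Qed.

Lemma notI_neq0 (b : series R) : ~ Ipow 1 b -> tofrac b != 0.
Proof.
by move=> /notI b0; rewrite tofrac_eq0; apply: contra b0 => /eqP ->.
Qed.

Lemma notIM (b c : series R) : ~ Ipow 1 b -> ~ Ipow 1 c -> ~ Ipow 1 (b * c).
Proof.
move=> /notI b0 /notI c0; apply/notI.
by rewrite -[(b * c) 0%N]/(ev0 (b * c)) rmorphM mulf_neq0.
Qed.

Fact locI_subring : subring_closed locI_pred.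
Proof.
split=> [|x y /asboolP[a [b [Ib ->]]] /asboolP[c [d [Id ->]]]
         |x y /asboolP[a [b [Ib ->]]] /asboolP[c [d [Id ->]]]]; apply/asboolP.
- exists 1, 1; split; first exact: notI1.
  by rewrite tofrac1 divr1.
- exists (a * d - c * b), (b * d); split; first exact: notIM.
  by rewrite -mulNr addf_div ?notI_neq0 // tofracB !tofracM mulNr.
- exists (a * c), (b * d); split; first exact: notIM.
  by rewrite !tofracM invfM mulrACA.
Qed.
HB.instance Definition _ :=
  GRing.isSubringClosed.Build {fraction (series R)} locI_pred locI_subring.

Record locI := LocI { locI_val : {fraction (series R)};
                      locI_valP : locI_val \in locI_pred }.
HB.instance Definition _ := [isSub for locI_val].
HB.instance Definition _ := [Choice of locI by <:].
HB.instance Definition _ := [SubChoice_isSubComNzRing of locI by <:].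

Fact to_locI_subproof (a : series R) : tofrac a \in locI_pred.
Proof.
apply/asboolP; exists a, 1; rewrite tofrac1 divr1; split => //.
exact: notI1.
Qed.
Definition to_locI (a : series R) : locI := LocI (to_locI_subproof a).

Lemma to_locI_zmod : zmod_morphism to_locI.
Proof. by move=> a b; apply: val_inj; rewrite raddfB /= tofracB. Qed.
Lemma to_locI_monoid : monoid_morphism to_locI.
Proof.
by split=> [|a b]; apply: val_inj; rewrite ?rmorph1 ?rmorphM /= ?tofrac1 ?tofracM.
Qed.
HB.instance Definition _ := GRing.isZmodMorphism.Build _ _ to_locI to_locI_zmod.
HB.instance Definition _ := GRing.isMonoidMorphism.Build _ _ to_locI to_locI_monoid.

(* Lambda_I -> Lambda_I / I Lambda_I = Frac R, a/b |-> a(0)/b(0), for F a field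
   into which R embeds *)
Variables (F : fieldType) (iota : {rmorphism R -> F}).

Definition evI (x : locI) : F :=
  xget 0 [set c | exists a b : series R, [/\ ~ Ipow 1 b,
    val x = tofrac a / tofrac b & c = iota (a 0%N) / iota (b 0%N)]].

Hypothesis iota_inj : injective iota.

Lemma evIE (x : locI) (a b : series R) : ~ Ipow 1 b ->
  val x = tofrac a / tofrac b -> evI x = iota (a 0%N) / iota (b 0%N).
Proof.
move=> Ib xab; rewrite /evI; case: xgetP => [e _ [a' [b' [Ib' xab' ->]]]|]; last first.
  by move=> /(_ (iota (a 0%N) / iota (b 0%N))); case; exists a, b.
have h (c : series R) : ~ Ipow 1 c -> iota (c 0%N) != 0.
  by move=> /notI; rewrite -(inj_eq iota_inj) rmorph0.
apply/eqP; rewrite eqr_div ?h // -!rmorphM; apply/eqP; congr (iota _).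
move: xab'; rewrite xab => /eqP; rewrite eqr_div ?notI_neq0 // -!tofracM tofrac_eq.
move=> /eqP /(congr1 (@ev0 R)); rewrite !rmorphM /ev0 => <-; by [].
Qed.

End Localization.

Section Submodules.
Variables (A : comNzRingType) (M : lmodType A).

Definition submodule (N : set M) :=
  N 0 /\ forall (a : A) x y, N x -> N y -> N (a *: x + y).

(* the submodule generated by S *)
Definition mspan (S : set M) : set M :=
  [set x | forall N, submodule N -> S `<=` N -> N x].

Lemma mspan_submodule S : submodule (mspan S).
Proof.
split=> [N [N0 _] _ //|a x y Sx Sy N Nsub SN].
by apply: Nsub.2; [exact: Sx|exact: Sy].
Qed.

Lemma sub_mspan S : S `<=` mspan S.
Proof. by move=> x Sx N _; apply. Qed.

Lemma mspan_id S : submodule S -> mspan S = S.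
Proof. by move=> Ssub; apply/seteqP; split=> [x|]; [apply|exact: sub_mspan]. Qed.

Lemma mspanD S x y : mspan S x -> mspan S y -> mspan S (x + y).
Proof. by move=> Sx Sy; rewrite -[x]scale1r; apply: (mspan_submodule S).2. Qed.

Lemma mspanZ S a x : mspan S x -> mspan S (a *: x).
Proof.
move=> Sx; rewrite -[_ *: _]addr0; apply: (mspan_submodule S).2 => //.
exact: (mspan_submodule S).1.
Qed.

Lemma mspanN S x : mspan S x -> mspan S (- x).
Proof. by move=> Sx; rewrite -scaleN1r; apply: mspanZ. Qed.

Lemma mspanB S x y : mspan S x -> mspan S y -> mspan S (x - y).
Proof. by move=> Sx Sy; apply: mspanD => //; apply: mspanN. Qed.

Definition mspan_pred (S : set M) : {pred M} := fun x => `[< mspan S x >].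

Fact mspan_pred_submod S : submod_closed (mspan_pred S).
Proof.
split=> [|a x y /asboolP Sx /asboolP Sy]; apply/asboolP.
  exact: (mspan_submodule S).1.
exact: (mspan_submodule S).2.
Qed.
HB.instance Definition _ S :=
  GRing.isSubmodClosed.Build A M (mspan_pred S) (mspan_pred_submod S).

(* The submodule generated by S, as a module; this is just {x | S x} whenever
   S is a submodule, as in all the kernels below. *)
Record submod (S : set M) := SubMod { mval : M; mvalP : mval \in mspan_pred S }.
HB.instance Definition _ S := [isSub for @mval S].
HB.instance Definition _ S := [Choice of submod S by <:].
HB.instance Definition _ S := [SubChoice_isSubLmodule of submod S by <:].

Definition insub0 S (x : M) : submod S := insubd (0 : submod S) x.

Lemma insub0K S x : mspan S x -> mval (insub0 S x) = x.
Proof. by move=> Sx; rewrite /insub0 -[mval _]/(val _) insubdK //; apply/asboolP. Qed.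

Lemma mspan_mval S (x : submod S) : mspan S (mval x).
Proof. by case: x => x /= /asboolP. Qed.

(* M modulo the submodule generated by S: a coset is stored by a chosen
   representative. *)
Definition canon (S : set M) (x : M) : M := xget 0 [set y | mspan S (x - y)].

Lemma canonP S x : mspan S (x - canon S x).
Proof.
rewrite /canon; case: xgetP => [//|/(_ x)]; rewrite /= subrr.
by case; apply: (mspan_submodule S).1.
Qed.

Lemma canon_eq S x y : mspan S (x - y) -> canon S x = canon S y.
Proof.
move=> xy; rewrite /canon; congr (xget 0 _); apply/seteqP; split=> z /= h.
  by rewrite -(subrK x y) -addrA -opprB; apply: mspanD => //; apply: mspanN.
by rewrite -(subrK y x) -addrA; apply: mspanD.
Qed.

Lemma canonK S x : canon S (canon S x) == canon S x.
Proof.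
by apply/eqP/canon_eq; rewrite -opprB; apply: mspanN; apply: canonP.
Qed.

Record quotmod (S : set M) := QuotMod { qrep : M; qrepP : canon S qrep == qrep }.
HB.instance Definition _ S := [isSub for @qrep S].
HB.instance Definition _ S := [Choice of quotmod S by <:].

Definition qpi S (x : M) : quotmod S := QuotMod (canonK S x).

Lemma qpi_eq S x y : qpi S x = qpi S y <-> mspan S (x - y).
Proof.
split=> [/(congr1 (@qrep S)) /= xy|xy]; last first.
  by apply/val_inj; rewrite /= (canon_eq xy).
rewrite -(subrK (canon S x) x) -addrA; apply: mspanD; first exact: canonP.
by rewrite xy -opprB; apply: mspanN; apply: canonP.
Qed.

Lemma qrepK S (q : quotmod S) : qpi S (qrep q) = q.
Proof. by case: q => x xP; apply/val_inj; apply/eqP. Qed.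

Lemma qrep_qpi S x : mspan S (x - qrep (qpi S x)).
Proof. exact: canonP. Qed.

Definition qadd S (q r : quotmod S) := qpi S (qrep q + qrep r).
Definition qopp S (q : quotmod S) := qpi S (- qrep q).
Definition qscale S (a : A) (q : quotmod S) := qpi S (a *: qrep q).

Lemma qpiD S x y : qadd (qpi S x) (qpi S y) = qpi S (x + y).
Proof.
apply/qpi_eq; rewrite -opprB; apply: mspanN; rewrite opprD addrACA.
by apply: mspanD; apply: qrep_qpi.
Qed.
Lemma qpiN S x : qopp (qpi S x) = qpi S (- x).
Proof. by apply/qpi_eq; rewrite opprK addrC; apply: qrep_qpi. Qed.
Lemma qpiZ S a x : qscale a (qpi S x) = qpi S (a *: x).
Proof.
apply/qpi_eq; rewrite -scalerBr -opprB scalerN; apply: mspanN.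
by apply: mspanZ; apply: qrep_qpi.
Qed.

Lemma qaddA S : associative (@qadd S).
Proof.
by move=> q r s; rewrite -(qrepK q) -(qrepK r) -(qrepK s) !qpiD addrA.
Qed.
Lemma qaddC S : commutative (@qadd S).
Proof. by move=> q r; rewrite /qadd addrC. Qed.
Lemma qadd0 S : left_id (qpi S 0) (@qadd S).
Proof. by move=> q; rewrite -(qrepK q) qpiD add0r. Qed.
Lemma qaddN S : left_inverse (qpi S 0) (@qopp S) (@qadd S).
Proof. by move=> q; rewrite -(qrepK q) qpiN qpiD addNr. Qed.
HB.instance Definition _ S := GRing.isZmodule.Build (quotmod S)
  (@qaddA S) (@qaddC S) (@qadd0 S) (@qaddN S).

Lemma qscaleA S a b (q : quotmod S) : qscale a (qscale b q) = qscale (a * b) q.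
Proof. by rewrite -(qrepK q) !qpiZ scalerA. Qed.
Lemma qscale1 S : left_id 1 (@qscale S).
Proof. by move=> q; rewrite -(qrepK q) qpiZ scale1r. Qed.
Lemma qscaleDr S : right_distributive (@qscale S) +%R.
Proof.
move=> a q r; rewrite -(qrepK q) -(qrepK r) [_ + _]qpiD !qpiZ scalerDr.
by rewrite -qpiD.
Qed.
Lemma qscaleDl S (q : quotmod S) : {morph (@qscale S)^~ q : a b / a + b}.
Proof. by move=> a b; rewrite -(qrepK q) !qpiZ scalerDl -qpiD. Qed.
HB.instance Definition _ S := GRing.Zmodule_isLmodule.Build A (quotmod S)
  (@qscaleA S) (@qscale1 S) (@qscaleDr S) (@qscaleDl S).

Lemma qpi_linear S : linear (qpi S).
Proof. by move=> a x y; rewrite -qpiD -qpiZ. Qed.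
HB.instance Definition _ S := GRing.isLinear.Build A M (quotmod S) _ (qpi S)
  (@qpi_linear S).

Lemma qpi_add S x y : qpi S (x + y) = qpi S x + qpi S y.
Proof. by rewrite -qpiD. Qed.
Lemma qpi_opp S x : qpi S (- x) = - qpi S x.
Proof. by rewrite -qpiN. Qed.
Lemma qpi_scale S a x : qpi S (a *: x) = a *: qpi S x.
Proof. by rewrite -qpiZ. Qed.

End Submodules.

Arguments submod {A M} S.
Arguments quotmod {A M} S.
Arguments qpi {A M} S x.
Arguments insub0 {A M} S x.

(* N is a B-module and phi : A -> B a ring morphism *)
Definition semilin (A B : comNzRingType) (M : lmodType A)
    (N : lmodType B) (phi : A -> B) (h : M -> N) :=
  forall a x y, h (a *: x + y) = phi a *: h x + h y.

Lemma quot_liftE (A B : comNzRingType) (M : lmodType A) (N : lmodType B)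
    (phi : A -> B) (h : M -> N) (S : set M) (x : M) :
  semilin phi h -> (forall y, S y -> h y = 0) ->
  phi 1 = 1 -> h (qrep (qpi S x)) = h x.
Proof.
move=> hlin hS phi1.
have h0 : h 0 = 0.
  have := hlin 1 0 0; rewrite scale1r addr0 phi1 scale1r.
  by move=> /eqP; rewrite -subr_eq0 opprD addrA subrr sub0r oppr_eq0 => /eqP.
have hB y z : h (y + z) = h y + h z by rewrite -[y]scale1r hlin phi1 !scale1r.
have sbm : submodule [set y | h y = 0].
  by split=> //= a y z hy hz; rewrite hlin hy hz scaler0 addr0.
have /= := @qrep_qpi _ _ S x _ sbm hS.
by move=> e; rewrite -[in RHS](subrK (qrep (qpi S x)) x) hB e add0r.
Qed.

Section FreeModule.
Variables (A : comNzRingType) (X : choiceType).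

(* the free module on X: finitely supported functions *)
Definition freemod : lmodType A :=
  submod [set f : X -> A^o | finite_set [set x | f x != 0]].

Lemma finsupp_submodule :
  submodule [set f : X -> A^o | finite_set [set x | f x != 0]].
Proof.
split=> [|a f g ff fg] /=.
  by rewrite (_ : mkset _ = set0) // -subset0 => x /= /negP; apply; apply/eqP.
have := ff; have := fg => /= fg' ff'.
apply: (@sub_finite_set _ _ ([set x | f x != 0] `|` [set x | g x != 0])).
  move=> x /=; apply: contraPP => /not_orP[/negP/negPn/eqP fx /negP/negPn/eqP gx].
  by apply/negP; rewrite negbK; apply/eqP; rewrite /GRing.add /GRing.scale /= fx gx scaler0 addr0.
by rewrite finite_setU.
Qed.

Lemma finsupp (f : freemod) : finite_set [set x | mval f x != 0].
Proof. by have := mspan_mval f; rewrite (mspan_id finsupp_submodule). Qed.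

Definition fgen (x : X) : freemod := insub0 _ (fun y => (y == x)%:R : A^o).

Lemma genE x y : mval (fgen x) y = (y == x)%:R.
Proof.
rewrite insub0K //; apply: sub_mspan => /=.
apply: (@sub_finite_set _ _ [set x]) => // z /=.
by apply: contraPP => /eqP/negPf -> /negP; apply; apply/eqP.
Qed.

Lemma fgen_span (f : freemod) : mspan (range fgen) f.
Proof.
pose D := fset_set [set x | mval f x != 0].
have inD x : x \notin D -> mval f x = 0.
  rewrite in_fset_set; last exact: finsupp.
  by move=> /negP nx; apply/eqP/negPn/negP => k; apply: nx; rewrite inE.
suff -> : f = \sum_(x <- D) mval f x *: fgen x.
  elim/big_ind: _ => [|x y|x _]; first exact: (mspan_submodule _).1.
    exact: mspanD.
  by apply: mspanZ; apply: sub_mspan; exists x.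
have mval_sum (s : seq X) (c : X -> A) y :
    mval (\sum_(x <- s) c x *: fgen x) y = \sum_(x <- s) c x * (y == x)%:R.
  elim: s => [|x s IH]; first by rewrite !big_nil.
  by rewrite !big_cons -IH -genE.
apply/val_inj/funext => y; rewrite [RHS]mval_sum.
have [yD|yD] := boolP (y \in D); last first.
  rewrite [LHS](inD y yD) big_seq big1 // => x xD.
  by rewrite (_ : y == x = false) ?mulr0 //; apply: contraNF yD => /eqP ->.
rewrite (bigD1_seq y) //= eqxx mulr1 big1 ?addr0 // => x /negPf.
by rewrite eq_sym => ->; rewrite mulr0.
Qed.

Variables (B : comNzRingType) (N : lmodType B).

(* the map freemod -> N, semilinear along psi, with prescribed values g *)
Definition flift (psi : A -> B) (g : X -> N) (f : freemod) : N :=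
  \sum_(x \in setT) psi (mval f x) *: g x.

Variables (psi : {rmorphism A -> B}) (g : X -> N).

Lemma fliftE (f : freemod) (D : {fset X}) :
  (forall x, x \notin D -> mval f x = 0) ->
  flift psi g f = \sum_(x <- D) psi (mval f x) *: g x.
Proof.
by move=> fD; rewrite /flift (fsbigTE D) // => x /fD ->; rewrite rmorph0 scale0r.
Qed.

Lemma flift_semilinear : semilin psi (flift psi g).
Proof.
move=> a f h.
pose D := fset_set ([set x | mval f x != 0] `|` [set x | mval h x != 0]).
have inD x : x \notin D -> mval f x = 0 /\ mval h x = 0.
  rewrite in_fset_set ?finite_setU; last by split; apply: finsupp.
  move=> /negP nx; split; apply/eqP/negPn/negP => k; apply: nx; rewrite inE /=; [by left|by right].
have fh x : mval (a *: f + h) x = a * mval f x + mval h x by [].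
rewrite (@fliftE (a *: f + h) D); last first.
  by move=> x /inD[fx hx]; rewrite fh fx hx mulr0 addr0.
rewrite (@fliftE f D); last by move=> x /inD[].
rewrite (@fliftE h D); last by move=> x /inD[].
rewrite scaler_sumr -big_split /=; apply: eq_bigr => x _.
by rewrite -[X in psi X]/(a * mval f x + mval h x) rmorphD rmorphM scalerDl scalerA.
Qed.

Lemma flift_gen x : flift psi g (fgen x) = g x.
Proof.
rewrite (@fliftE _ [fset x]%fset); last first.
  by move=> y; rewrite inE genE => /negPf ->.
by rewrite big_seq_fset1 genE eqxx rmorph1 scale1r.
Qed.

End FreeModule.

Arguments fgen {A X} x.

Section QuotientLift.
Variables (A B : comNzRingType) (X : choiceType) (N : lmodType B).
Variable S : set (freemod A X).

Definition qflift (psi : A -> B) (g : X -> N) (q : quotmod S) : N :=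
  flift psi g (qrep q).

Variables (psi : {rmorphism A -> B}) (g : X -> N).
Hypothesis gS : forall r, S r -> flift psi g r = 0.

Lemma qflift_semilinear : semilin psi (qflift psi g).
Proof.
move=> a q r; rewrite -(qrepK q) -(qrepK r) -linearP /qflift.
by rewrite !(quot_liftE _ (@flift_semilinear _ _ _ _ psi g) gS (rmorph1 psi))
  flift_semilinear.
Qed.

Lemma qflift_gen x : qflift psi g (qpi S (fgen x)) = g x.
Proof.
rewrite /qflift (quot_liftE _ (@flift_semilinear _ _ _ _ psi g) gS (rmorph1 psi)).
exact: flift_gen.
Qed.

End QuotientLift.

Lemma semilinearB (A B : comNzRingType) (M : lmodType A) (N : lmodType B)
  (phi : {rmorphism A -> B}) (h : M -> N) : semilin phi h ->
  [/\ h 0 = 0, (forall x y, h (x + y) = h x + h y),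
      (forall x, h (- x) = - h x) & forall a x, h (a *: x) = phi a *: h x].
Proof.
move=> hl; have hD x y : h (x + y) = h x + h y.
  by rewrite -[x]scale1r hl rmorph1 !scale1r.
have h0 : h 0 = 0 by apply: (addrI (h 0)); rewrite -hD !addr0.
have hZ a x : h (a *: x) = phi a *: h x by rewrite -[_ *: x]addr0 hl h0 addr0.
by split=> // x; apply: (addrI (h x)); rewrite -hD !subrr.
Qed.

(* B (x)_A M *)
Section BaseChange.
Variables (A B : comNzRingType) (phi : {rmorphism A -> B}) (M : lmodType A).

Definition bc_rel : set (freemod B M) := [set r |
  (exists x y, r = fgen (x + y) - fgen x - fgen y) \/
  (exists a x, r = fgen (a *: x) - phi a *: fgen x)].

Definition bc : lmodType B := quotmod bc_rel.

Definition bc1 (x : M) : bc := qpi bc_rel (fgen x).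

Lemma bc1_semilinear : semilin phi bc1.
Proof.
move=> a x y; rewrite /bc1 -linearP; apply/qpi_eq.
have E (V : zmodType) (b c d e : V) : b - (c + d) = (b - e - d) + (e - c).
  by rewrite [b - e - d]addrAC addrA subrK opprD addrA addrAC.
rewrite (E _ _ _ _ (fgen (a *: x))).
by apply: mspanD; apply: sub_mspan; [left; exists (a *: x), y|right; exists a, x].
Qed.

Lemma bc_ext (N : lmodType B) (h : {linear bc -> N}) :
  (forall x, h (bc1 x) = 0) -> forall q, h q = 0.
Proof.
move=> h0 q; rewrite -(qrepK q).
pose T := [set f : freemod B M | h (qpi bc_rel f) = 0].
have sbm : submodule T.
  split=> [|a x y xT yT]; rewrite /T /=; first by rewrite !linear0.
  by rewrite qpi_add qpi_scale linearP xT yT scaler0 addr0.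
by apply: (fgen_span (qrep q) sbm) => _ [x _ <-]; apply: h0.
Qed.

Variables (B' : comNzRingType) (N : lmodType B').

(* b (x) x |-> psi b *: g x *)
Definition bc_lift (psi : B -> B') (g : M -> N) : bc -> N := qflift psi g.

Variables (psi : {rmorphism B -> B'}) (g : M -> N).
Hypothesis g_lin : semilin (psi \o phi) g.

Lemma bc_lift_rel r : bc_rel r -> flift psi g r = 0.
Proof.
have [g0 gD gN gZ] := @semilinearB _ _ _ _ (psi \o phi) _ g_lin.
have [_ fD fN fZ] := semilinearB (@flift_semilinear _ _ _ _ psi g).
case=> [[x [y ->]]|[a [x ->]]].
  by rewrite !fD !fN !flift_gen gD addrAC addrK subrr.
by rewrite fD fN fZ !flift_gen gZ subrr.
Qed.

Lemma bc_lift_semilinear : semilin psi (bc_lift psi g).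
Proof. exact: qflift_semilinear bc_lift_rel. Qed.

Lemma bc_liftE x : bc_lift psi g (bc1 x) = g x.
Proof. exact: qflift_gen bc_lift_rel x. Qed.

End BaseChange.

Definition bc_map (A B A' B' : comNzRingType) (phi : {rmorphism A -> B})
    (phi' : {rmorphism A' -> B'}) (M : lmodType A) (M' : lmodType A')
    (psi : B -> B') (g : M -> M') : bc phi M -> bc phi' M' :=
  bc_lift psi (fun x => bc1 phi' (g x)).

Section TensorProduct.
Variables (A : comNzRingType) (M N : lmodType A).

Definition tens_rel : set (freemod A (M * N)%type) := [set r |
  (exists a x x' y, r = fgen (a *: x + x', y) - a *: fgen (x, y) - fgen (x', y)) \/
  (exists a x y y', r = fgen (x, a *: y + y') - a *: fgen (x, y) - fgen (x, y'))].

Definition tens : lmodType A := quotmod tens_rel.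

Definition tpure (x : M) (y : N) : tens := qpi tens_rel (fgen (x, y)).

Variables (B : comNzRingType) (L : lmodType B).

Definition tens_lift (psi : A -> B) (g : M -> N -> L) : tens -> L :=
  qflift psi (fun z => g z.1 z.2).

Lemma tens_liftE (psi : {rmorphism A -> B}) (g : M -> N -> L) x y :
  (forall z, semilin psi (g^~ z)) -> (forall z, semilin psi (g z)) ->
  tens_lift psi g (tpure x y) = g x y.
Proof.
move=> gl gr; rewrite /tens_lift; apply: (@qflift_gen _ _ _ _ _ psi) => r.
have [_ fD fN fZ] :=
  semilinearB (@flift_semilinear _ _ _ _ psi (fun z : M * N => g z.1 z.2)).
case=> [[a [z [z' [w ->]]]]|[a [z [w [w' ->]]]]];
  rewrite !(fD, fN) fZ !flift_gen /=.
  by have /= -> := gl w a z z'; rewrite addrAC addrK subrr.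
by have /= -> := gr z a w w'; rewrite addrAC addrK subrr.
Qed.

End TensorProduct.

Definition tens_map (A B : comNzRingType) (M N : lmodType A) (M' N' : lmodType B)
    (psi : A -> B) (g : M -> M') (h : N -> N') : tens M N -> tens M' N' :=
  tens_lift psi (fun x y => tpure (g x) (h y)).

Section ExteriorPower.
Variables (A : comNzRingType) (n : nat) (M : lmodType A).

Definition ext_rel : set (freemod A ('I_n -> M)) := [set r |
  (exists i a (u v w : 'I_n -> M), [/\ forall j, j != i -> u j = w j,
     forall j, j != i -> v j = w j, w i = a *: u i + v i &
     r = fgen w - a *: fgen u - fgen v]) \/
  (exists i j (u : 'I_n -> M), [/\ i != j, u i = u j & r = fgen u])].

Definition extp : lmodType A := quotmod ext_rel.

(* u 0 /\ ... /\ u (n - 1); families are indexed by nat and truncated *)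
Definition wedge (u : nat -> M) : extp := qpi ext_rel (fgen (fun i => u (val i))).

End ExteriorPower.

Arguments wedge {A} n {M} u.

Definition extp_map (A B : comNzRingType) (n : nat) (M : lmodType A)
    (M' : lmodType B) (psi : A -> B) (g : M -> M') : extp n M -> extp n M' :=
  qflift psi (fun u => qpi (@ext_rel B n M') (fgen (g \o u))).

Lemma extp_mapE (A B : comNzRingType) (n : nat) (M : lmodType A)
    (M' : lmodType B) (psi : {rmorphism A -> B}) (g : M -> M') u :
  semilin psi g -> extp_map psi g (wedge n u) = wedge n (g \o u).
Proof.
move=> gl; rewrite /extp_map /wedge; apply: (@qflift_gen _ _ _ _ _ psi) => r.
pose G := fun v : 'I_n -> M => qpi (@ext_rel B n M') (fgen (g \o v)).
have [_ gD _ gZ] := semilinearB gl.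
have [_ fD fN fZ] := semilinearB (@flift_semilinear _ _ _ _ psi G).
have q0 s : @ext_rel B n M' s -> qpi (@ext_rel B n M') s = 0.
  move=> es; rewrite -(linear0 (qpi (@ext_rel B n M'))); apply/qpi_eq.
  by rewrite subr0; apply: sub_mspan.
case=> [[i [a [x [y [w [xw yw wi ->]]]]]]|[i [j [x [ij xij ->]]]]].
  rewrite !fD !fN fZ !flift_gen /G.
  rewrite (_ : _ - _ = qpi (@ext_rel B n M') (fgen (g \o w) -
    psi a *: fgen (g \o x) - fgen (g \o y))); last first.
    by rewrite 2!qpi_add 2!qpi_opp qpi_scale.
  apply: q0; left.
  exists i, (psi a), (g \o x), (g \o y), (g \o w); split=> // [k ki|k ki|] /=.
  - by rewrite xw.
  - by rewrite yw.
  - by rewrite wi gD gZ.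
by rewrite flift_gen; apply: q0; right; exists i, j, (g \o x); split=> //=; rewrite xij.
Qed.

Definition mdual (A : comNzRingType) (M : lmodType A) : lmodType A :=
  submod [set y : M -> A^o | linear y].

Definition dpair (A : comNzRingType) (M : lmodType A) (y : mdual M) (x : M) : A :=
  mval y x.

Definition mkdual (A : comNzRingType) (M : lmodType A) (y : M -> A) : mdual M :=
  insub0 [set y : M -> A^o | linear y] y.

Definition dual_map (A : comNzRingType) (M N : lmodType A) (g : M -> N)
  (y : mdual N) : mdual M := mkdual (fun x => dpair y (g x)).

(* Hom_A(M, A) -> Hom_B(B (x) M, B) *)
Definition dual_bc (A B : comNzRingType) (phi : {rmorphism A -> B})
    (M : lmodType A) (y : mdual M) : mdual (bc phi M) :=
  mkdual (bc_lift id (fun x => phi (dpair y x) : B^o)).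

Section Families.
Variables (A : comNzRingType) (M : lmodType A).

Definition indep (n : nat) (u : nat -> M) := forall c : nat -> A,
  \sum_(i < n) c i *: u i = 0 -> forall i, (i < n)%N -> c i = 0.
Definition generates (n : nat) (u : nat -> M) := forall x : M,
  exists c : nat -> A, x = \sum_(i < n) c i *: u i.
Definition is_basis n u := indep n u /\ generates n u.
Definition dual_families n (u : nat -> M) (y : nat -> mdual M) :=
  forall i j, (i < n)%N -> (j < n)%N -> dpair (y i) (u j) = (i == j)%:R.

Definition fin_gen := exists n u, generates n u.

(* maximal number of linearly independent elements, i.e. the dimension of
   Frac(A) (x) M when A is a domain *)
Definition rk : nat := xget 0%N [set n |
  (exists u, indep n u) /\ ~ (exists u, indep n.+1 u)].

End Families.

(* Cochain complexes, with a differential cd i j for every pair of degrees that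
   vanishes unless j = i + 1; this avoids transports along equalities of
   degrees. *)
Record cpx (A : comNzRingType) := Cpx {
  cobj :> int -> lmodType A;
  cd : forall i j : int, {linear cobj i -> cobj j};
  cd_shape : forall (i j : int) x, j != i + 1 -> cd i j x = 0;
  cd_comp : forall (i j k : int) x, cd j k (cd i j x) = 0 }.

Section Cohomology.
Variables (A : comNzRingType) (V : cpx A) (i : int).

Definition cocycles : lmodType A := submod [set x : V i | cd V i (i + 1) x = 0].
Definition coh : lmodType A :=
  quotmod [set z : cocycles | exists y : V (i - 1), mval z = cd V (i - 1) i y].
(* class of a cocycle, and a chosen cocycle in a class *)
Definition coh_cls (x : V i) : coh := qpi _ (insub0 _ x).
Definition coh_rep (c : coh) : V i := mval (qrep c).

End Cohomology.

Definition coh_map (A B : comNzRingType) (V : cpx A) (W : cpx B) (i : int)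
  (f : V i -> W i) (c : coh V i) : coh W i := coh_cls (f (coh_rep c)).

Definition chain_map (A : comNzRingType) (V W : cpx A)
    (f : forall i, {linear V i -> W i}) :=
  forall (i j : int) x, f j (cd V i j x) = cd W i j (f i x).

Definition quasi_iso (A : comNzRingType) (V W : cpx A)
    (f : forall i, {linear V i -> W i}) :=
  chain_map f /\ forall i, bijective (@coh_map A A V W i (f i)).

Definition acyclic_at (A : comNzRingType) (V : cpx A) (i : int) :=
  forall c : coh V i, c = 0.

Section BaseChangeComplex.
Variables (A B : comNzRingType) (phi : {rmorphism A -> B}) (V : cpx A).

Definition bc_d (i j : int) : bc phi (V i) -> bc phi (V j) :=
  bc_map phi idfun (cd V i j).

Arguments bc_d : clear implicits.

Lemma bc_d_g i j : semilin (idfun \o phi) (fun x => bc1 phi (cd V i j x)).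
Proof. by move=> a x y; rewrite linearP bc1_semilinear. Qed.

Lemma bc_d_linear i j : linear (bc_d i j).
Proof.
by move=> a x y; apply: (@bc_lift_semilinear _ _ _ _ _ _ idfun _ (@bc_d_g i j)).
Qed.
HB.instance Definition _ i j :=
  GRing.isLinear.Build B _ _ _ (bc_d i j) (@bc_d_linear i j).

Lemma bc_d1 i j x : bc_d i j (bc1 phi x) = bc1 phi (cd V i j x).
Proof. exact: (@bc_liftE _ _ _ _ _ _ idfun _ (@bc_d_g i j)). Qed.

Lemma bc_d_shape i j x : j != i + 1 -> bc_d i j x = 0.
Proof.
move=> ij; apply: (@bc_ext _ _ _ _ _ (bc_d i j)) => {}x.
rewrite [LHS]bc_d1 cd_shape //.
by have [-> //] := semilinearB (@bc1_semilinear _ _ phi (V j)).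
Qed.

Lemma bc_d_comp i j k x : bc_d j k (bc_d i j x) = 0.
Proof.
apply: (@bc_ext _ _ _ _ _ (bc_d j k \o bc_d i j)) => {}x.
rewrite /= [bc_d i j _]bc_d1 [LHS]bc_d1 cd_comp.
by have [-> //] := semilinearB (@bc1_semilinear _ _ phi (V k)).
Qed.

Definition bcC : cpx B := Cpx bc_d_shape bc_d_comp.

End BaseChangeComplex.

Section BigTensor.
Variables (A : comNzRingType) (L : int -> lmodType A).

Fixpoint btens (s : seq int) : lmodType A :=
  if s is i :: s' then tens (L i) (btens s') else A^o.

Fixpoint btpure (x : forall i, L i) (s : seq int) : btens s :=
  if s is i :: s' then tpure (x i) (btpure x s') else (1 : A^o).

End BigTensor.

Fixpoint btmap (A B : comNzRingType) (L : int -> lmodType A)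
    (L' : int -> lmodType B) (psi : A -> B) (g : forall i, L i -> L' i)
    (s : seq int) : btens L s -> btens L' s :=
  if s is i :: s' then tens_map psi (g i) (btmap psi g (s := s')) else psi.

Section DetInv.
Variable A : comNzRingType.

(* M in odd degrees, M^* in even degrees: det^{-1} involves det(C^i)^{(-1)^{i+1}} *)
Definition sgn_mod (i : int) (M : lmodType A) : lmodType A :=
  if odd `|i|%N then M else mdual M.

Definition sgn_fam (i : int) (M : lmodType A) (u : nat -> M) (y : nat -> mdual M) :
    nat -> sgn_mod i M :=
  if odd `|i|%N as b return nat -> (if b then M else mdual M) then u else y.

(* det^{-1}(V) for a complex V of free modules of ranks n i, the tensor product
   being taken over the degrees in s; det(V^i)^{-1} is the top exterior power of
   the dual of V^i. *)
Definition detinv (V : cpx A) (n : int -> nat) (s : seq int) : lmodType A :=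
  btens (fun i => extp (n i) (sgn_mod i (V i))) s.

Definition detinv_gen (V : cpx A) (n : int -> nat) (s : seq int)
    (u : forall i, nat -> V i) (y : forall i, nat -> mdual (V i)) : detinv V n s :=
  btpure (fun i => wedge (n i) (sgn_fam i (u i) (y i))) s.

End DetInv.

Section DetBaseChange.
Variables (A B : comNzRingType) (phi : {rmorphism A -> B}).

Definition sgn_bc (i : int) (M : lmodType A) :
    sgn_mod i M -> sgn_mod i (bc phi M) :=
  if odd `|i|%N as b
  return (if b then M else mdual M) -> (if b then bc phi M else mdual (bc phi M))
  then @bc1 _ _ phi M else @dual_bc _ _ phi M.

(* det^{-1}(V) -> det^{-1}(B (x) V), through which
   B (x) det^{-1}(V) = det^{-1}(B (x) V) *)
Definition detinv_bc (V : cpx A) (n : int -> nat) (s : seq int) :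
    detinv V n s -> detinv (bcC phi V) n s :=
  btmap phi (fun i => extp_map phi (@sgn_bc i (V i))) (s := s).

End DetBaseChange.

(* Normalization of the isomorphism attached to
     0 -> W --j--> U --f--> V --q--> X -> 0
   with dim W = c, dim U = a, dim V = b, dim X = t:
     u_1 /\ ... /\ u_a (x) v_1^* /\ ... /\ v_b^* |->
       alpha_1 ... alpha_(a-c) u_(a-c+1) /\ ... /\ u_a (x) v_(a-c+1)^* /\ ... /\ v_b^*.
   The primed families are the elements of W and X^* that u_(a-c+1), ..., u_a
   and v_(a-c+1)^*, ..., v_b^* come from. *)
Section FourTerm.
Variables (F : fieldType) (W U V X : lmodType F).
Variables (j : W -> U) (f : U -> V) (q : V -> X).
Variables (a b c t : nat).

Definition is_fourterm_iso
  (Phi : tens (extp a U) (extp b (mdual V)) -> tens (extp c W) (extp t (mdual X))) :=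
  linear Phi /\
  forall (u : nat -> U) (v : nat -> V) (v' : nat -> mdual V) (alpha : nat -> F)
         (w : nat -> W) (x' : nat -> mdual X),
    is_basis a u -> is_basis b v -> dual_families b v v' ->
    (forall i, (i < a - c)%N -> alpha i != 0 /\ f (u i) = alpha i *: v i) ->
    (forall i, (a - c <= i < a)%N -> f (u i) = 0) ->
    (forall i, (i < c)%N -> j (w i) = u (a - c + i)%N) ->
    (forall i y, (i < t)%N -> dpair (x' i) (q y) = dpair (v' (a - c + i)%N) y) ->
    Phi (tpure (wedge a u) (wedge b v')) =
      (\prod_(i < a - c) alpha i) *: tpure (wedge c w) (wedge t x').

(* The source is one-dimensional, so the normalization determines the map. *)
Definition fourterm_iso := xget (fun=> 0) is_fourterm_iso.

End FourTerm.

(* det^{-1}(V) -> det H^1 (x) det^{-1} H^2 after a flat base change phi : A -> R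
   that makes V acyclic outside degrees 1 and 2.

   The isomorphism is normalized by bases u i of the R (x) V^i adapted to the
   differentials. With m i the rank of d^i, the basis u i consists of
     odd i  : (m (i-1) coboundaries) (m i elements lifting coboundaries) (cohomology)
     even i : (m i elements lifting coboundaries) (m (i-1) coboundaries) (cohomology)
   and d maps the lifts in degree i to the coboundaries in degree i + 1, up to
   nonzero factors alpha in degree 1, where H^2 may have torsion. For a complex
   concentrated in degrees 1 and 2 over a field this is the normalization of
   is_fourterm_iso for 0 -> H^1 -> V^1 -> V^2 -> H^2 -> 0. *)
Section DetCohomology.
Variables (A R : comNzRingType) (phi : {rmorphism A -> R}) (V : cpx A).
Variables (n : int -> nat) (s : seq int) (h1 h2 : nat).

Definition bc_coh (i : int) : bc phi (coh V i) -> coh (bcC phi V) i :=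
  bc_lift idfun (fun c => coh_cls (V := bcC phi V) (bc1 phi (coh_rep c))).

Definition coh_dim (i : int) : nat :=
  if i == 1 then h1 else if i == 2 then h2 else 0%N.
Definition lift_start (m : int -> nat) (i : int) : nat :=
  if odd `|i|%N then m (i - 1) else 0%N.
Definition cobound_start (m : int -> nat) (i : int) : nat :=
  if odd `|i|%N then 0%N else m i.

Record adapted (m : int -> nat) (u : forall i, nat -> bcC phi V i)
    (alpha : nat -> R) : Prop := Adapted {
  adapted_basis : forall i, is_basis (n i) (u i);
  adapted_rank : forall i, n i = (m (i - 1)%R + m i + coh_dim i)%N;
  adapted_alpha : forall k, (k < m 1)%N -> alpha k != 0;
  adapted_lift : forall i k, (k < m i)%N ->
    cd (bcC phi V) i (i + 1) (u i (lift_start m i + k)%N) =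
    (if i == 1 then alpha k else 1) *: u (i + 1) (cobound_start m (i + 1) + k)%N;
  adapted_cocycle : forall i k, (k < n i)%N ->
    ~~ (lift_start m i <= k < lift_start m i + m i)%N ->
    cd (bcC phi V) i (i + 1) (u i k) = 0 }.

Definition is_det_coh (Phi : detinv (bcC phi V) n s ->
    tens (extp h1 (bc phi (coh V 1))) (extp h2 (mdual (bc phi (coh V 2))))) :=
  linear Phi /\
  forall m (u : forall i, nat -> bcC phi V i) u' alpha
         (x : nat -> bc phi (coh V 1)) (y' : nat -> mdual (bc phi (coh V 2))),
    adapted m u alpha -> (forall i, dual_families (n i) (u i) (u' i)) ->
    (forall k, (k < h1)%N -> bc_coh (x k) = coh_cls (u 1 (m 0 + m 1 + k)%N)) ->
    (forall k l z, (k < h2)%N -> (l < h2)%N ->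
       bc_coh z = coh_cls (u 2 (m 1 + m 2 + l)%N) ->
       dpair (y' k) z = (k == l)%:R) ->
    Phi (detinv_gen n s u u') =
      (\prod_(k < m 1) alpha k) *: tpure (wedge h1 x) (wedge h2 y').

Definition det_coh := xget (fun=> 0) is_det_coh.

End DetCohomology.

(* M (x) Q^k for Q^k = I^k / I^(k+1), which is free of rank one on the class of
   t^k: the element m (x) (class of t^k) is stored as m. In particular
   (M (x) Q^k) (x) Q^l = M (x) Q^(k+l), M^* (x) Q^k = (M (x) Q^l)^* (x) Q^(k+l)
   and so on are identities, as they should be for the chosen generators. *)
Definition twist (A : comNzRingType) (k : nat) (M : lmodType A) : lmodType A := M.

Section IAdicFiltration.
Variables (O : comNzRingType) (P : cpx (series O)).
Local Notation Lambda := (series O).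

(* coefficient, on the generator t^k of Q^k, of the class of a in I^k *)
Definition Qclass (k : nat) (a : Lambda) : O := a k.

(* m (x) (class of a), for a in I^k *)
Definition twist_pure (M : lmodType O) (k : nat) (m : M) (a : Lambda) : twist k M :=
  Qclass k a *: m.

Definition IM (k : nat) (M : lmodType Lambda) : set M :=
  [set y | exists a x, Ipow k a /\ y = a *: x].

Definition Iobj (k : nat) (i : int) : lmodType Lambda := submod (@IM k (P i)).
Definition Id (k : nat) (i j : int) (x : Iobj k i) : Iobj k j :=
  insub0 _ (cd P i j (mval x)).
Arguments Id : clear implicits.

Lemma Id_span k i j (x : Iobj k i) : mspan (@IM k (P j)) (cd P i j (mval x)).
Proof.
have sbm : submodule [set y | mspan (@IM k (P j)) (cd P i j y)].
  split=> [|a y z yS zS] /=; first by rewrite linear0; exact: (mspan_submodule _).1.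
  by rewrite linearP; apply: (mspan_submodule _).2.
apply: (mspan_mval x sbm) => y [a [z [Ia ->]]] /=.
by rewrite linearZ; apply: sub_mspan; exists a, (cd P i j z).
Qed.

Lemma IdE k i j x : mval (Id k i j x) = cd P i j (mval x).
Proof. by rewrite /Id insub0K //; apply: Id_span. Qed.

Lemma Id_linear k i j : linear (Id k i j).
Proof.
by move=> a x y; apply/val_inj; rewrite [LHS]IdE !linearP /= -!IdE.
Qed.
HB.instance Definition _ k i j :=
  GRing.isLinear.Build Lambda (Iobj k i) (Iobj k j) _ (Id k i j) (@Id_linear k i j).

Lemma Id_shape k i j x : j != i + 1 -> Id k i j x = 0.
Proof. by move=> ij; apply/val_inj; rewrite [LHS]IdE cd_shape. Qed.
Lemma Id_comp k i j l x : Id k j l (Id k i j x) = 0.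
Proof. by apply/val_inj; rewrite [LHS]IdE IdE cd_comp. Qed.

(* I^k C *)
Definition IC (k : nat) : cpx Lambda := Cpx (@Id_shape k) (@Id_comp k).

(* C_0 = C (x)_Lambda O *)
Definition C0 : cpx O := bcC (@ev0 O) P.

(* I^k C -> C_0 (x) Q^k, a x |-> (1 (x) x) (x) (class of a) for a in I^k *)
Definition Iproj (k : nat) (i : int) (y : IC k i) : twist k (C0 i) :=
  xget 0 [set z | exists a x, [/\ Ipow k a, mval y = a *: x &
                                  z = twist_pure k (bc1 (@ev0 O) x : C0 i) a]].

(* I^(k+1) C -> I^k C *)
Definition Iincl (k : nat) (i : int) (y : IC k.+1 i) : IC k i := insub0 _ (mval y).

Local Notation H1 := (coh C0 1).
Local Notation H2 := (coh C0 2).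

(* connecting map H^1(C_0) (x) Q^k -> H^2(I^(k+1) C) *)
Definition delta (k : nat) (c : twist k H1) : coh (IC k.+1) 2 :=
  xget 0 [set z | exists x : IC k 1, Iproj x = coh_rep (c : H1) /\
    z = coh_cls (V := IC k.+1) (insub0 _ (cd P 1 2 (mval x)))].

Definition iota_coh (k : nat) : coh (IC k.+1) 2 -> coh (IC k) 2 :=
  coh_map (V := IC k.+1) (W := IC k) (@Iincl k 2).

Definition bpi (k : nat) : coh (IC k) 2 -> twist k H2 :=
  coh_map (V := IC k) (W := C0) (@Iproj k 2).

(* iota_1 o ... o iota_k : H^2(I^(k+1) C) -> H^2(I C) *)
Fixpoint iotas (k : nat) : coh (IC k.+1) 2 -> coh (IC 1) 2 :=
  if k is k'.+1 then fun z => iotas (iota_coh z) else id.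

(* The k-th stage of the construction of the derived Bockstein maps:
   ker beta^(k) with its map to H^1(C_0), and coker beta^(k) with the map
   from H^2(C_0) (x) Q^k; stage 0 is H^1(C_0), H^2(C_0). *)
Record stage (k : nat) := Stage {
  kerB : lmodType O;
  cokB : lmodType O;
  kerB_in : kerB -> H1;
  cokB_pr : twist k H2 -> cokB }.

(* beta^(k+1) : ker beta^(k) -> coker beta^(k) (x) Q^1 *)
Definition betaS (k : nat) (S : stage k) (c : kerB S) : twist 1 (cokB S) :=
  xget 0 [set z | exists ct : coh (IC k.+1) 2,
    delta (k := 0) (kerB_in c) = iotas ct /\ z = cokB_pr S (bpi ct : twist k H2)].

Definition ker_of (k : nat) (S : stage k) : lmodType O :=
  submod [set c : kerB S | betaS c = 0].
Definition cok_of (k : nat) (S : stage k) : lmodType O :=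
  quotmod (range (@betaS k S)).

Definition next_stage (k : nat) (S : stage k) : stage k.+1 :=
  @Stage k.+1 (ker_of S) (cok_of S) (fun c => kerB_in (mval c))
    (fun h => qpi _ (cokB_pr S (h : twist k H2) : twist 1 (cokB S))).

Fixpoint bstage (k : nat) : stage k :=
  if k is k'.+1 then next_stage (bstage k') else @Stage 0 H1 H2 id id.

Definition ker_beta (k : nat) : lmodType O := kerB (bstage k).
Definition coker_beta (k : nat) : lmodType O := cokB (bstage k).
(* beta k is beta^(k+1) *)
Definition beta (k : nat) : ker_beta k -> twist 1 (coker_beta k) := @betaS k (bstage k).

Definition e_num : nat := rk H2.
Definition sigma_num (k : nat) : nat := rk (ker_beta k).
Definition tau_num (k : nat) : nat := rk (coker_beta k).
Definition im_rank (k : nat) : nat := rk (submod (range (@beta k.-1))).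

Definition is_k0 (k0 : nat) :=
  [/\ (0 < k0)%N, forall k, (k0 < k)%N -> im_rank k = 0%N &
      forall k1, (0 < k1)%N -> (forall k, (k1 < k)%N -> im_rank k = 0%N) ->
        (k0 <= k1)%N].
Definition k0 : nat := (xget 0%N [set k | is_k0 k.+1]).+1.

Definition sigma : nat := sigma_num k0.
Definition tau : nat := tau_num k0.
Definition varrho : nat := (\sum_(1 <= k < k0.+1) k * im_rank k)%N.

End IAdicFiltration.

(* P is a bounded complex of finitely generated free modules representing C, so
   that C_I, C_0, I^k C and det^{-1}(C) are computed termwise on P. *)
Section Maps.
Variables (O : idomainType) (K : fieldType) (io : {rmorphism O -> K}).
Local Notation Lambda := (series O).
Local Notation LambdaI := (locI O).
Local Notation evI := (evI io).
Variables (P : cpx Lambda) (n : int -> nat) (s : seq int) (r : nat).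

Local Notation H1 := (coh (C0 P) 1).
Local Notation H2 := (coh (C0 P) 2).
Local Notation e := (e_num P).
Local Notation sigma := (sigma P).
Local Notation tau := (tau P).
Local Notation varrho := (varrho P).
Local Notation k0 := (k0 P).

(* Q_p (x)_{Z_p} M = K (x)_O M for O-modules M, K being the fraction field of O *)
Definition Qt (M : lmodType O) : lmodType K := bc io M.
Definition Qt_map (M N : lmodType O) (g : M -> N) : Qt M -> Qt N :=
  @bc_map _ _ _ _ io io _ _ idfun g.

(* dimensions of Q_p (x) ker beta^(l) and Q_p (x) coker beta^(l), where
   ker beta^(0) = H^1(C_0) and coker beta^(0) = H^2(C_0) *)
Definition dim_ker (l : nat) : nat := if l is 0%N then (r + e)%N else sigma_num P l.
Definition dim_coker (l : nat) : nat := if l is 0%N then e else tau_num P l.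
Definition rho (l : nat) : nat := (\sum_(i < l) dim_coker i)%N.

Definition det_stage (l : nat) : lmodType K :=
  tens (extp (dim_ker l) (Qt (ker_beta P l)))
       (extp (dim_coker l) (mdual (Qt (coker_beta P l)))).

(* from 0 -> ker beta^(l+1) -> ker beta^(l) -> coker beta^(l) (x) Q^1
          -> coker beta^(l+1) -> 0 *)
Definition det_step (l : nat) :
    tens (extp (dim_ker l) (Qt (ker_beta P l)))
         (extp (dim_coker l) (mdual (Qt (twist 1 (coker_beta P l))))) ->
    det_stage l.+1 :=
  @fourterm_iso K (Qt (ker_beta P l.+1)) (Qt (ker_beta P l))
    (Qt (twist 1 (coker_beta P l))) (Qt (coker_beta P l.+1))
    (Qt_map (fun c : ker_of (bstage P l) => mval c))
    (Qt_map (@beta O P l))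
    (Qt_map (fun h => qpi (range (@beta O P l)) h))
    (dim_ker l) (dim_coker l) (dim_ker l.+1) (dim_coker l.+1).

(* One factor Q^1 for each of the dim_coker l dual vectors of coker beta^(l)
   that are read as dual vectors of coker beta^(l) (x) Q^1. *)
Fixpoint det_comp (l : nat) : det_stage 0 -> twist (rho l) (det_stage l) :=
  if l is l'.+1 then fun z => (@det_step l' (det_comp l' z : det_stage l') :
    twist (rho l'.+1) (det_stage l'.+1)) else id.

Definition det_source : lmodType K :=
  tens (extp (r + e) (Qt H1)) (extp e (mdual (Qt H2))).
Definition det_target : lmodType K :=
  twist varrho (tens (extp sigma (Qt H1)) (extp tau (mdual (Qt H2)))).

(* R^(k0); the last step uses ker beta^(k0) -> H^1(C_0) and
   H^2(C_0) (x) Q^k0 -> coker beta^(k0), with rho k0 = varrho + k0 * tau *)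
Definition Rmap (z : det_source) : det_target :=
  tens_map idfun
    (extp_map (n := sigma) idfun (Qt_map (@kerB_in O P k0 (bstage P k0))))
    (extp_map (n := tau) idfun
       (dual_map (Qt_map (fun h : twist k0 H2 => cokB_pr (bstage P k0) h))))
    (det_comp k0 z : tens (extp sigma (Qt (ker_beta P k0)))
                          (extp tau (mdual (Qt (coker_beta P k0))))).

Definition pi0_map (z : detinv (C0 P) n s) : det_source :=
  @det_coh O K io (C0 P) n s (r + e) e (detinv_bc io z).

(* H^i(C)_I *)
Definition HI (i : int) : lmodType LambdaI := bc (@to_locI O) (coh P i).

Definition pi_target : lmodType LambdaI :=
  tens (extp sigma (HI 1)) (extp tau (mdual (HI 2))).

Definition pi_map (z : detinv P n s) : pi_target :=
  @det_coh Lambda LambdaI (@to_locI O) P n s sigma tau (detinv_bc (@to_locI O) z).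

(* I^varrho . pi_target *)
Definition pi_lattice : set pi_target :=
  [set w | exists a w', Ipow varrho a /\ w = to_locI a *: w'].

(* reduction modulo I : H^i(C)_I -> Q_p (x) H^i(C_0), and on linear forms on
   H^2 *)
Definition redH (i : int) : HI i -> Qt (coh (C0 P) i) :=
  @bc_map _ _ _ _ (@to_locI O) io _ _ evI
    (coh_map (V := P) (W := C0 P) (fun x => bc1 (@ev0 O) x)).

Definition red_dual (y : mdual (HI 2)) : mdual (Qt H2) :=
  xget 0 [set y' | forall g, dpair y' (redH g) = evI (dpair y g)].

Definition Dmap (w : pi_target) : det_target :=
  xget 0 [set v | exists a x y, [/\ Ipow varrho a, w = to_locI a *: tpure x y &
    v = io (Qclass varrho a) *:
        tpure (extp_map evI (@redH 1) x) (extp_map evI red_dual y)]].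

End Maps.

(* lo, lo + 1, ..., lo + len - 1 *)
Definition degrees (lo : int) (len : nat) : seq int :=
  [seq lo + k%:Z | k <- iota 0 len].

Definition bounded (A : comNzRingType) (V : cpx A) :=
  exists a b : int, forall i, ~~ (a <= i <= b) -> forall x : V i, x = 0.

(* bounded complex of finitely generated free modules, V i of rank n i *)
Definition perfect_cpx (A : comNzRingType) (V : cpx A) (n : int -> nat)
    (lo : int) (len : nat) :=
  (forall i, exists u : nat -> V i, is_basis (n i) u) /\
  (forall i, i \notin degrees lo len -> n i = 0%N).

(* Main.v *)
(* Over the discrete valuation ring Lambda_I, bases of the P^i adapted to the
   differentials exist: d matches lifts with coboundaries up to powers of t, and
   since H^1(C_I) is free and C_I is acyclic outside degrees 1 and 2, nontrivial
   powers t^(a_k) occur only in degree 1. Clearing denominators, which are units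
   modulo I, such bases u can be taken in P itself. Reducing modulo t gives
   adapted bases for C_0, in which the k with a_k > 0 become cohomology classes,
   and beta^(l) maps the class of the k-th lift to that of the k-th coboundary
   when a_k = l and kills those with a_k > l: hence sum_k a_k = varrho, and each
   det_step discards the basis vectors with a_k = l + 1, with coefficient 1. On
   the generator of det^{-1}(P) attached to u, both composites therefore give the
   wedge of the surviving cohomology classes, the product of the t^(a_k) on the
   Lambda_I side being the chosen generator of I^varrho. *)
From mathcomp Require Import fingroup perm.
From HB Require Import structures.
Require Import Defs.
From mathcomp Require Import all_boot all_order all_algebra all_field.
From mathcomp Require Import boolp classical_sets functions.
From mathcomp Require Import zify ring.

Set Implicit Arguments.
Unset Strict Implicit.
Unset Printing Implicit Defensive.

Import Order.TTheory GRing.Theory Num.Theory.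

Local Open Scope classical_set_scope.
Local Open Scope ring_scope.

(** * Linear algebra over a commutative ring *)

(** The determinant isomorphisms, the Bockstein maps, D and the reduction of forms are all encoded
    by choice with default value 0, so none can be computed before an object with the required
    property is shown to exist. For the determinant isomorphisms the source is cyclic, which forces
    the candidate; the content is that every other adapted basis gives it the same value. This rests
    on block triangular transition matrices, whose lift and coboundary blocks cancel between
    neighbouring degrees. The adapted vectors in P need not form a Lambda-basis, so the generator
    attached to them is one only over Lambda_I. An element of det^{-1}(P) is therefore written
    through arbitrary bases w of the P^i, and the ratio x in Lambda_I to the adapted generator is
    compared with the corresponding ratio over C_0, which is the reduction of x. In ker beta and
    coker beta the vectors are bases only up to nonzero denominators in O, which suffices as the
    targets are K-spaces. Keeping the Smith exponents sorted makes every Bockstein stage a final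
    segment of one fixed list of vectors. *)

Lemma semilin_id (A : comNzRingType) (M N : lmodType A) (h : M -> N) :
  linear h -> semilin idfun h.
Proof. by move=> hl a x y; rewrite hl. Qed.

Lemma semilin_sum (A B : comNzRingType) (M : lmodType A) (N : lmodType B)
    (phi : {rmorphism A -> B}) (h : M -> N) : semilin phi h ->
  forall n (c : nat -> A) (x : nat -> M),
  h (\sum_(i < n) c i *: x i) = \sum_(i < n) phi (c i) *: h (x i).
Proof.
move=> /semilinearB[h0 hD _ hZ] n c x.
by rewrite (big_morph h hD h0); apply: eq_bigr => i _; rewrite hZ.
Qed.

Section Submodule.
Variables (A : comNzRingType) (M : lmodType A).

Lemma submoduleD (T : set M) x y : submodule T -> T x -> T y -> T (x + y).
Proof. by move=> sT Tx Ty; rewrite -[x]scale1r; apply: sT.2. Qed.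

Lemma submoduleZ (T : set M) a x : submodule T -> T x -> T (a *: x).
Proof. by move=> sT Tx; rewrite -[_ *: _]addr0; apply: sT.2 => //; apply: sT.1. Qed.

Lemma submodule_comb (T : set M) n (c : nat -> A) (x : nat -> M) : submodule T ->
  (forall i, (i < n)%N -> T (x i)) -> T (\sum_(i < n) c i *: x i).
Proof.
move=> sT Tx; elim/big_ind: _ => [|y z|i _]; first exact: sT.1.
- exact: submoduleD.
- by apply: submoduleZ => //; exact: Tx.
Qed.

Lemma submodule_eq (B : comNzRingType) (N : lmodType B) (psi : {rmorphism A -> B})
    (h h' : M -> N) :
  semilin psi h -> semilin psi h' -> submodule [set x | h x = h' x].
Proof.
move=> hl h'l; have [h0 _ _ _] := semilinearB hl; have [h'0 _ _ _] := semilinearB h'l.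
by split=> [|a x y /= ex ey] /=; rewrite ?h0 ?h'0 // hl h'l ex ey.
Qed.

Lemma submodule_span n (u : nat -> M) :
  submodule [set x | exists c : nat -> A, x = \sum_(i < n) c i *: u i].
Proof.
split=> [|a x y [c ->] [c' ->]].
  by exists (fun=> 0); rewrite big1 // => i _; rewrite scale0r.
exists (fun i => a * c i + c' i); rewrite scaler_sumr -big_split /=.
by apply: eq_bigr => i _; rewrite scalerDl scalerA.
Qed.

Lemma submodule_qpi (S : set M) (T : set (quotmod S)) : submodule T ->
  submodule [set x | T (qpi S x)].
Proof.
move=> [T0 TP]; split=> [|a x y Tx Ty] /=; first by rewrite linear0.
by rewrite linearP; apply: TP.
Qed.

Lemma qpi_eq0 (S : set M) x : submodule S -> qpi S x = 0 <-> S x.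
Proof. by move=> sS; rewrite -(linear0 (qpi S)) qpi_eq subr0 mspan_id. Qed.

Lemma insub0_val (S : set M) x : submodule S -> S x -> mval (insub0 S x) = x.
Proof. by move=> sS Sx; rewrite insub0K // mspan_id. Qed.

Lemma mval_in (S : set M) (x : submod S) : submodule S -> S (mval x).
Proof. by move=> sS; have := mspan_mval x; rewrite mspan_id. Qed.

End Submodule.

Section QuotientInduction.
Variables (A : comNzRingType).

(** Base changes, tensor products and exterior powers are all quotients of free modules, so one
    induction over generators serves the three. *)
Lemma quotfree_ind (X : choiceType) (S : set (freemod A X))
    (T : set (quotmod S)) : submodule T ->
  (forall x, T (qpi S (fgen x))) -> forall q, T q.
Proof.
move=> sT Tg q; rewrite -(qrepK q).
by apply: (fgen_span (qrep q) (submodule_qpi sT)) => _ [x _ <-]; apply: Tg.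
Qed.

Lemma bc_ind (B : comNzRingType) (phi : {rmorphism B -> A}) (M : lmodType B)
    (T : set (bc phi M)) :
  submodule T -> (forall x, T (bc1 phi x)) -> forall q, T q.
Proof. exact: quotfree_ind. Qed.

Lemma tens_ind (M N : lmodType A) (T : set (tens M N)) :
  submodule T -> (forall x y, T (tpure x y)) -> forall q, T q.
Proof. by move=> sT Tp; apply: quotfree_ind => // -[x y]; apply: Tp. Qed.

Lemma extp_ind n (M : lmodType A) (T : set (extp n M)) :
  submodule T -> (forall u : nat -> M, T (wedge n u)) -> forall q, T q.
Proof.
move=> sT Tw; apply: quotfree_ind => // u.
(* [wedge] truncates families indexed by [nat]; a family on ['I_n] is extended by 0 beyond n. *)
have := Tw (fun i => if insub i is Some j then u j else 0); rewrite /wedge.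
suff -> : (fun i : 'I_n => if insub (val i) is Some j then u j else 0) = u by [].
by apply/funext => i; rewrite valK.
Qed.

End QuotientInduction.

Section BaseChangeMaps.
Variables (A B A' B' : comNzRingType) (phi : {rmorphism A -> B}).
Variables (phi' : {rmorphism A' -> B'}).

Lemma bc1_sum (M : lmodType A) n (c : nat -> A) (x : nat -> M) :
  bc1 phi (\sum_(i < n) c i *: x i) = \sum_(i < n) phi (c i) *: bc1 phi (x i).
Proof. exact: semilin_sum (@bc1_semilinear _ _ phi M) _ _ _. Qed.

Lemma bc1Z (M : lmodType A) a (x : M) : bc1 phi (a *: x) = phi a *: bc1 phi x.
Proof. by have [_ _ _ ->] := semilinearB (@bc1_semilinear _ _ phi M). Qed.

Lemma bc1_0 (M : lmodType A) : bc1 phi (0 : M) = 0.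
Proof. by have [->] := semilinearB (@bc1_semilinear _ _ phi M). Qed.

Lemma bc1D (M : lmodType A) (x y : M) : bc1 phi (x + y) = bc1 phi x + bc1 phi y.
Proof. by have [_ ->] := semilinearB (@bc1_semilinear _ _ phi M). Qed.

Lemma bc1B (M : lmodType A) (x y : M) : bc1 phi (x - y) = bc1 phi x - bc1 phi y.
Proof. by have [_ D N _] := semilinearB (@bc1_semilinear _ _ phi M); rewrite D N. Qed.

Variables (M : lmodType A) (M' : lmodType A') (th : {rmorphism A -> A'}).
Variables (psi : {rmorphism B -> B'}) (g : M -> M').
Hypothesis psi_th : forall a, psi (phi a) = phi' (th a).
Hypothesis gl : semilin th g.

Lemma bc_map_subproof : semilin (psi \o phi) (fun x => bc1 phi' (g x)).
Proof. by move=> a x y; rewrite gl bc1_semilinear /= psi_th. Qed.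

Lemma bc_map_semilin : semilin psi (@bc_map _ _ _ _ phi phi' M M' psi g).
Proof. exact: bc_lift_semilinear bc_map_subproof. Qed.

Lemma bc_mapE x : bc_map phi' psi g (bc1 phi x) = bc1 phi' (g x).
Proof. exact: bc_liftE bc_map_subproof x. Qed.

End BaseChangeMaps.

Lemma semilin_bc_ext (A B B' : comNzRingType) (phi : {rmorphism A -> B})
    (psi : {rmorphism B -> B'}) (M : lmodType A) (N : lmodType B')
    (h h' : bc phi M -> N) : semilin psi h -> semilin psi h' ->
  (forall x, h (bc1 phi x) = h' (bc1 phi x)) -> h =1 h'.
Proof.
by move=> hl h'l hh' q; apply: (bc_ind (T := [set q | h q = h' q])) => //;
  apply: submodule_eq hl h'l.
Qed.

Section Dual.
Variables (A : comNzRingType) (M : lmodType A).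

Lemma submodule_linear : submodule [set y : M -> A^o | linear y].
Proof.
split=> [|a y z yl zl] /=; first by move=> b u v; rewrite scaler0 addr0.
move=> b u v; rewrite !fctE yl zl !scalerDr !scalerA [a * b]mulrC -!addrA.
by congr (_ + _); rewrite addrCA.
Qed.

Lemma dpair_linear (y : mdual M) : linear (dpair y : M -> A^o).
Proof. exact: mval_in submodule_linear. Qed.

Lemma dpair_semilin (y : mdual M) : semilin idfun (dpair y : M -> A^o).
Proof. exact/semilin_id/dpair_linear. Qed.

Lemma dpair_sum (y : mdual M) n (c : nat -> A) (x : nat -> M) :
  dpair y (\sum_(i < n) c i *: x i) = \sum_(i < n) c i * dpair y (x i).
Proof. exact: (semilin_sum (phi := idfun) (dpair_semilin y)). Qed.

Lemma dpairZr (y : mdual M) a x : dpair y (a *: x) = a * dpair y x.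
Proof. by have [_ _ _ ->] := semilinearB (phi := idfun) (dpair_semilin y). Qed.

Lemma dpairDr (y : mdual M) x x' : dpair y (x + x') = dpair y x + dpair y x'.
Proof. by have [_ ->] := semilinearB (phi := idfun) (dpair_semilin y). Qed.

Lemma dpair0r (y : mdual M) : dpair y 0 = 0.
Proof. by have [->] := semilinearB (phi := idfun) (dpair_semilin y). Qed.

Lemma mkdualE (y : M -> A) x : linear (y : M -> A^o) -> dpair (mkdual y) x = y x.
Proof. by move=> yl; rewrite /dpair insub0_val //; apply: submodule_linear. Qed.

Lemma dpair_ext (y z : mdual M) : dpair y =1 dpair z -> y = z.
Proof. by move=> yz; apply/val_inj/funext. Qed.

Lemma dpairZl a (y : mdual M) x : dpair (a *: y) x = a * dpair y x.
Proof. by []. Qed.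

Lemma dpairDl (y z : mdual M) x : dpair (y + z) x = dpair y x + dpair z x.
Proof. by []. Qed.

Lemma dpair_suml n (c : nat -> A) (y : nat -> mdual M) x :
  dpair (\sum_(i < n) c i *: y i) x = \sum_(i < n) c i * dpair (y i) x.
Proof.
elim: n => [|n IH]; first by rewrite !big_ord0.
by rewrite !big_ord_recr -IH.
Qed.

End Dual.

Lemma dual_mapE (A : comNzRingType) (M N : lmodType A) (g : M -> N) y x :
  linear g -> dpair (dual_map g y) x = dpair y (g x).
Proof. by move=> gl; rewrite mkdualE // => a u v; rewrite gl dpair_linear. Qed.

Lemma dual_map_linear (A : comNzRingType) (M N : lmodType A) (g : M -> N) :
  linear g -> linear (dual_map g).
Proof.
move=> gl a y z; apply: dpair_ext => x.
by rewrite -[RHS]/(a * dpair (dual_map g y) x + dpair (dual_map g z) x) !dual_mapE.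
Qed.

Lemma dual_bcE (A B : comNzRingType) (phi : {rmorphism A -> B})
    (M : lmodType A) (y : mdual M) x : dpair (dual_bc phi y) (bc1 phi x) = phi (dpair y x).
Proof.
have yl : semilin (idfun \o phi) (fun x => phi (dpair y x) : B^o).
  by move=> a u v; rewrite dpairDr dpairZr rmorphD rmorphM.
rewrite mkdualE; first exact: (bc_liftE (psi := idfun) yl).
exact: (bc_lift_semilinear (psi := idfun) yl).
Qed.

Lemma dual_bc_semilin (A B : comNzRingType) (phi : {rmorphism A -> B}) (M : lmodType A) :
  semilin phi (@dual_bc _ _ phi M).
Proof.
move=> a y z; apply: dpair_ext.
apply: (@semilin_bc_ext A B B phi idfun M B^o); try exact: dpair_semilin.
by move=> x; rewrite dpairDl dpairZl !dual_bcE dpairDl dpairZl rmorphD rmorphM.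
Qed.

Section Bases.
Variables (A : comNzRingType) (M : lmodType A).

Lemma sum_delta n (f : nat -> M) i : (i < n)%N ->
  \sum_(j < n) (i == j)%:R *: f j = f i.
Proof.
move=> ilt; rewrite (bigD1 (Ordinal ilt)) //= eqxx scale1r.
rewrite big1 ?addr0 // => j ji; have /negPf ji' : (j != i :> nat)%N := ji.
by rewrite eq_sym ji' scale0r.
Qed.

Lemma indep_eq n (u : nat -> M) (c c' : nat -> A) : indep n u ->
  \sum_(i < n) c i *: u i = \sum_(i < n) c' i *: u i ->
  forall i, (i < n)%N -> c i = c' i.
Proof.
move=> iu cc' i ilt; apply/eqP; rewrite -subr_eq0; apply/eqP.
apply: (iu (fun i => c i - c' i)) => //.
under eq_bigr do rewrite scalerBl; by rewrite sumrB cc' subrr.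
Qed.

Lemma dual_exists n (u : nat -> M) : is_basis n u ->
  exists y : nat -> mdual M, dual_families n u y.
Proof.
move=> [iu gu]; have [c cP] := choice gu.
(* The coordinates come from a choice; independence makes them unique, hence linear. *)
have cl i : (i < n)%N -> linear (fun x => c x i : A^o).
  move=> ilt a x z.
  apply: (indep_eq (c := c (a *: x + z)) (c' := fun i => a * c x i + c z i) iu _ ilt).
  rewrite -cP [in LHS](cP x) [in LHS](cP z) scaler_sumr -big_split /=.
  by apply: eq_bigr => j _; rewrite scalerDl scalerA.
exists (fun i => mkdual (fun x => c x i)) => i j ilt jlt; rewrite mkdualE; last exact: cl.
apply: (indep_eq (c := c (u j)) (c' := fun i => (i == j)%:R) iu _ ilt).
rewrite -cP; under eq_bigr do rewrite eq_sym; by rewrite sum_delta.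
Qed.

Lemma dual_coord n (u : nat -> M) y x : generates n u -> dual_families n u y ->
  x = \sum_(i < n) dpair (y i) x *: u i.
Proof.
move=> gu yu; have [c ->] := gu x; apply: eq_bigr => i _.
rewrite dpair_sum (bigD1 i) //= yu // eqxx mulr1 big1 ?addr0 // => j ji.
have /negPf ji' : (j != i :> nat)%N := ji.
by rewrite yu // eq_sym ji' mulr0.
Qed.

Lemma dual_coord_form n (u : nat -> M) y (f : mdual M) :
  generates n u -> dual_families n u y ->
  f = \sum_(i < n) dpair f (u i) *: y i.
Proof.
move=> gu yu; apply: dpair_ext => x.
rewrite (dpair_suml n (fun i => dpair f (u i))) [in LHS](dual_coord x gu yu) (dpair_sum f n (fun i => dpair (y i) x)); apply: eq_bigr => i _.
by rewrite mulrC.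
Qed.

End Bases.

(** * Determinants, exterior powers and tensor products *)

(** Entries are indexed by [nat] so that blocks are reached by shifting indices, without casts
    between ordinals of equal sizes. *)
Definition ndet (A : comNzRingType) (n : nat) (f : nat -> nat -> A) : A :=
  \det (\matrix_(i < n, j < n) f i j).

Section NatDet.
Variable A : comNzRingType.
Implicit Types f g : nat -> nat -> A.

Lemma eq_ndet n f g :
  (forall i j, (i < n)%N -> (j < n)%N -> f i j = g i j) -> ndet n f = ndet n g.
Proof. by move=> fg; congr (\det _); apply/matrixP => i j; rewrite !mxE fg. Qed.

Lemma ndet0 f : ndet 0 f = 1. Proof. exact: det_mx00. Qed.

Lemma ndet_delta n : ndet n (fun i j => (i == j)%:R : A) = 1.
Proof.
by rewrite -[RHS](@det1 _ n); congr (\det _); apply/matrixP => i j; rewrite !mxE.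
Qed.

Lemma ndet_tr n f : ndet n (fun i j => f j i) = ndet n f.
Proof. by rewrite -[RHS]det_tr; congr (\det _); apply/matrixP => i j; rewrite !mxE. Qed.

Lemma ndetM n f g :
  ndet n (fun i j => \sum_(l < n) f i l * g l j) = ndet n f * ndet n g.
Proof.
rewrite -det_mulmx; congr (\det _); apply/matrixP => i j.
by rewrite !mxE; apply: eq_bigr => l _; rewrite !mxE.
Qed.

Lemma ndet_scale_rows n (c : nat -> A) f :
  ndet n (fun i j => c i * f i j) = (\prod_(i < n) c i) * ndet n f.
Proof.
rewrite -[\prod_(i < n) c i]/(\prod_(i < n) c (val i)).
have -> : \prod_(i < n) c (val i) = \det (diag_mx (\row_(i < n) c i)).
  by rewrite det_diag; apply: eq_bigr => i _; rewrite mxE.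
rewrite -det_mulmx; congr (\det _); apply/matrixP => i j.
by rewrite mul_diag_mx !mxE.
Qed.

Lemma ndet_scale_cols n (c : nat -> A) f :
  ndet n (fun i j => f i j * c j) = ndet n f * \prod_(i < n) c i.
Proof.
rewrite -ndet_tr mulrC -[in RHS](ndet_tr n f) -ndet_scale_rows.
by apply: eq_ndet => i j _ _; rewrite mulrC.
Qed.

Lemma ndet_lblock a b f :
  (forall i j, (i < a)%N -> (a <= j < a + b)%N -> f i j = 0) ->
  ndet (a + b) f = ndet a f * ndet b (fun i j => f (a + i)%N (a + j)%N).
Proof.
move=> f0; rewrite -(det_lblock _ (\matrix_(i < b, j < a) f (a + i)%N j)).
congr (\det _); apply/matrixP => i j; rewrite !mxE.
case: splitP => k ik; rewrite mxE; case: splitP => l jl; rewrite !mxE ?ik ?jl //.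
by apply: f0 => //; rewrite leq_addr ltn_add2l ltn_ord.
Qed.

Lemma ndet_ublock a b f :
  (forall i j, (a <= i < a + b)%N -> (j < a)%N -> f i j = 0) ->
  ndet (a + b) f = ndet a f * ndet b (fun i j => f (a + i)%N (a + j)%N).
Proof.
move=> f0; rewrite -ndet_tr ndet_lblock; last by move=> i j ia jab; apply: f0.
by rewrite ndet_tr (ndet_tr b (fun i j => f (a + i)%N (a + j)%N)).
Qed.

End NatDet.

Lemma rmorph_ndet (A B : comNzRingType) (phi : {rmorphism A -> B}) n f :
  phi (ndet n f) = ndet n (fun i j => phi (f i j)).
Proof. by rewrite -det_map_mx; congr (\det _); apply/matrixP => i j; rewrite !mxE. Qed.

Section Wedge.
Variables (A : comNzRingType) (n : nat) (M : lmodType A).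

Let wI (u : 'I_n -> M) : extp n M := qpi (@ext_rel A n M) (fgen u).
Let upd (u : 'I_n -> M) k x : 'I_n -> M := fun i => if i == k then x else u i.

Local Lemma wI_alt u i j : i != j -> u i = u j -> wI u = 0.
Proof.
move=> ij uij; rewrite /wI -(linear0 (qpi (@ext_rel A n M))); apply/qpi_eq.
by rewrite subr0; apply: sub_mspan; right; exists i, j, u.
Qed.

Local Lemma wI_lin u k : semilin idfun (fun x => wI (upd u k x)).
Proof.
move=> a x y; rewrite /wI -linearP; apply/qpi_eq; rewrite opprD addrA.
apply: sub_mspan; left.
exists k, a, (upd u k x), (upd u k y), (upd u k (a *: x + y)).
by split=> // [j /negPf jk|j /negPf jk|]; rewrite /upd ?jk ?eqxx.
Qed.

(** Polarisation: the wedge with u_i + u_j in both places vanishes, as do its terms with a repeated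
    entry, so the two mixed terms are opposite. *)
Local Lemma wI_swap u (i j : 'I_n) : i != j -> wI (fun k => u (tperm i j k)) = - wI u.
Proof.
move=> ij; have ji : j == i = false by apply/negbTE; rewrite eq_sym.
have D (v : 'I_n -> M) k x y : wI (upd v k (x + y)) = wI (upd v k x) + wI (upd v k y).
  by have [_ ->] := semilinearB (phi := idfun) (@wI_lin v k).
have e0 : wI (upd (upd u i (u i + u j)) j (u i + u j)) = 0.
  by apply: (@wI_alt _ i j) => //; rewrite /upd eqxx (negPf ij) eqxx.
have sw (v : 'I_n -> M) x y : upd (upd v i x) j y = upd (upd v j y) i x.
  by apply/funext => k; rewrite /upd; case: eqP => // ->; rewrite ji.
move: e0; rewrite D !(sw u) 2!D -!(sw u).
rewrite (_ : wI (upd (upd u i (u i)) j (u i)) = 0); last first.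
  by apply: (@wI_alt _ i j) => //; rewrite /upd eqxx (negPf ij) eqxx.
rewrite (_ : wI (upd (upd u i (u j)) j (u j)) = 0); last first.
  by apply: (@wI_alt _ i j) => //; rewrite /upd eqxx (negPf ij) eqxx.
rewrite add0r addr0 => /eqP; rewrite addr_eq0 => /eqP e.
rewrite -(_ : upd (upd u i (u j)) j (u i) = fun k => u (tperm i j k)); last first.
  apply/funext => k; rewrite /upd; case: tpermP => [->|->|/eqP/negPf -> /eqP/negPf -> //].
    by rewrite (negPf ij) eqxx.
  by rewrite eqxx.
rewrite e; congr (- wI _); apply/funext => k; rewrite /upd.
by case: eqP => [->//|_]; case: eqP => [->|].
Qed.

Local Lemma wI_perm (s : 'S_n) u : wI (fun k => u (s k)) = (-1) ^+ s *: wI u.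
Proof.
have [ts -> tsP] := prod_tpermP s.
elim: ts tsP u => [_ u|t ts IH /= /andP[t1 tsP] u].
  rewrite big_nil odd_perm1 scale1r; congr wI; apply/funext => k.
  by rewrite perm1.
rewrite big_cons odd_permM odd_tperm t1 signr_addb expr1 mulN1r scaleNr -(IH tsP).
rewrite -(@wI_swap _ t.1 t.2) //; congr wI; apply/funext => k.
by rewrite permM.
Qed.

Local Lemma det_upd_sum (g : 'M[A]_n) k :
  \det g = \sum_l g k l * \det (\matrix_(i, j) (if i == k then (l == j)%:R else g i j)).
Proof.
rewrite (expand_det_row _ k); apply: eq_bigr => l _; congr (_ * _).
rewrite (expand_det_row _ k) (bigD1 l) //= mxE !eqxx mul1r big1 ?addr0.
  congr (_ * \det _); apply/matrixP => i j; rewrite !mxE.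
  by rewrite eq_sym (negPf (neq_lift _ _)).
by move=> j jl; rewrite mxE eqxx eq_sym (negPf jl) mul0r.
Qed.

(** Induction on the number k of rows that may be arbitrary, the others being unit vectors. For k =
    0 the family is a reindexing of u, settled by the sign of a permutation or by a repeated entry.
    In the step both sides are linear in row [K], which may thus be replaced by unit vectors. *)
Local Lemma wI_det (u v : 'I_n -> M) (g : 'M[A]_n) :
  (forall i, v i = \sum_l g i l *: u l) -> wI v = \det g *: wI u.
Proof.
suff C k : (k <= n)%N -> forall v (g : 'M[A]_n),
    (forall i, v i = \sum_l g i l *: u l) ->
    (forall i : 'I_n, (k <= i)%N -> exists j, forall l, g i l = (j == l)%:R) ->
    wI v = \det g *: wI u.
  by move=> vg; apply: (C n (leqnn n) v g vg) => i; rewrite leqNgt ltn_ord.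
elim: k => [_|k IH kn] {}v {}g vg gd.
  have /choice[s sP] : forall i : 'I_n, exists j, forall l, g i l = (j == l)%:R.
    by move=> i; apply: gd.
  have vu i : v i = u (s i).
    rewrite vg (bigD1 (s i)) //= sP eqxx scale1r big1 ?addr0 // => l ls.
    by rewrite sP eq_sym (negPf ls) scale0r.
  have [/injectiveP sI|/injectivePn[i [j ij sij]]] := boolP (injectiveb s); last first.
    rewrite (@determinant_alternate _ _ g i j) ?scale0r //.
      by apply: (@wI_alt _ i j) => //; rewrite !vu sij.
    by move=> l; rewrite !sP sij.
  rewrite (_ : g = perm_mx (perm sI)); last first.
    by apply/matrixP => i l; rewrite !mxE sP permE.
  rewrite det_perm -wI_perm; congr wI; apply/funext => i; by rewrite vu permE.
pose K := Ordinal kn.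
have -> : wI v = wI (upd v K (\sum_l g K l *: u l)).
  congr wI; apply/funext => i; rewrite /upd; by case: eqP => [->|//].
have [h0 hD _ hZ] := semilinearB (phi := idfun) (@wI_lin v K).
rewrite (big_morph _ hD h0) (det_upd_sum g K) scaler_suml.
apply: eq_bigr => l _; rewrite hZ -scalerA; congr (_ *: _).
apply: (IH (ltnW kn)) => [i|i ki].
  rewrite /upd; under eq_bigr do rewrite mxE; case: eqP => [_|_]; last exact: vg.
  rewrite (bigD1 l) //= eqxx scale1r big1 ?addr0 // => j jl.
  by rewrite eq_sym (negPf jl) scale0r.
have [->|iK] := eqVneq i K; first by exists l => j; rewrite mxE eqxx.
have [j jP] : exists j, forall l, g i l = (j == l)%:R.
  by apply: gd; rewrite ltn_neqAle ki andbT eq_sym.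
by exists j => l'; rewrite mxE (negPf iK) jP.
Qed.

Lemma eq_wedge (u v : nat -> M) :
  (forall i, (i < n)%N -> u i = v i) -> wedge n u = wedge n v.
Proof. move=> uv; rewrite /wedge (_ : (fun i : 'I_n => u i) = (fun i : 'I_n => v i)) //.
by apply/funext => i; apply: uv. Qed.

Lemma wedge_ndet (u v : nat -> M) (g : nat -> nat -> A) :
  (forall i, (i < n)%N -> v i = \sum_(l < n) g i l *: u l) ->
  wedge n v = ndet n g *: wedge n u.
Proof.
move=> vg; apply: (@wI_det (fun i : 'I_n => u i) (fun i => v i)) => i; rewrite vg //.
by apply: eq_bigr => l _; rewrite mxE.
Qed.

Lemma extp_cyclic (u : nat -> M) (x : extp n M) :
  generates n u -> exists c, x = c *: wedge n u.
Proof.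
move=> gu; have [c cP] := choice gu.
apply: (extp_ind (T := [set x | exists c, x = c *: wedge n u])) => [|v].
  split=> [|a _ _ [b ->] [d ->]]; first by exists 0; rewrite scale0r.
  by exists (a * b + d); rewrite scalerDl scalerA.
by exists (ndet n (fun i => c (v i))); apply: wedge_ndet => i _; apply: cP.
Qed.

(** The determinant pairing with n linear forms. When these are dual to a basis, it reads off the
    coefficient on the generator of the top exterior power. *)
Lemma extp_form (y : nat -> mdual M) : exists L : extp n M -> A^o,
  semilin idfun L /\ forall u, L (wedge n u) = ndet n (fun i j => dpair (y j) (u i)).
Proof.
pose g (u : 'I_n -> M) : A^o := \det (\matrix_(i, j) dpair (y j) (u i)).
have gS r : @ext_rel A n M r -> flift idfun g r = 0.
  have [_ fD fN fZ] := semilinearB (@flift_semilinear _ _ _ _ idfun g).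
  case=> [[i [a [x [z [w [xw zw wi ->]]]]]]|[i [j [x [ij xij ->]]]]].
    rewrite !fD !fN fZ !flift_gen /g.
    rewrite (@determinant_multilinear _ _ (\matrix_(k, j) dpair (y j) (w k))
      (\matrix_(k, j) dpair (y j) (x k)) (\matrix_(k, j) dpair (y j) (z k)) i a 1).
    - by rewrite mul1r -addrA -opprD subrr.
    - by apply/rowP => j; rewrite !mxE wi dpairDr dpairZr mul1r.
    - by apply/matrixP => k j; rewrite !mxE xw // eq_sym neq_lift.
    - by apply/matrixP => k j; rewrite !mxE zw // eq_sym neq_lift.
  rewrite flift_gen; apply: (determinant_alternate ij) => k.
  by rewrite !mxE xij.
exists (qflift idfun g); split; first exact: (qflift_semilinear gS).
by move=> u; apply: (qflift_gen gS).
Qed.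

End Wedge.

Lemma extp_dual_form (A : comNzRingType) n (M : lmodType A) (v : nat -> M) :
  exists L : extp n (mdual M) -> A^o,
  semilin idfun L /\ forall y, L (wedge n y) = ndet n (fun i j => dpair (y i) (v j)).
Proof.
have el j : linear (fun y : mdual M => dpair y (v j) : A^o) by [].
have [L [Ll LE]] := extp_form n (fun j => mkdual (fun y : mdual M => dpair y (v j))).
exists L; split=> // y; rewrite LE; apply: eq_ndet => i j _ _.
by rewrite mkdualE.
Qed.

Section ExtMap.
Variables (A B : comNzRingType) (psi : {rmorphism A -> B}) (n : nat).
Variables (M : lmodType A) (M' : lmodType B) (g : M -> M').
Hypothesis gl : semilin psi g.

Lemma extp_map_semilin : semilin psi (@extp_map _ _ n _ _ psi g).
Proof.
move=> a x y.
apply: (qflift_semilinear (psi := psi)) => r.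
pose G := fun v : 'I_n -> M => qpi (@ext_rel B n M') (fgen (g \o v)).
have [_ gD _ gZ] := semilinearB gl.
have [_ fD fN fZ] := semilinearB (@flift_semilinear _ _ _ _ psi G).
have q0 s : @ext_rel B n M' s -> qpi (@ext_rel B n M') s = 0.
  move=> es; rewrite -(linear0 (qpi (@ext_rel B n M'))); apply/qpi_eq.
  by rewrite subr0; apply: sub_mspan.
case=> [[i [b [u [v [w [uw vw wi ->]]]]]]|[i [j [u [ij uij ->]]]]]; last first.
  by rewrite flift_gen; apply: q0; right; exists i, j, (g \o u); split=> //=; rewrite uij.
rewrite !fD !fN fZ !flift_gen /G.
rewrite (_ : _ - _ = qpi (@ext_rel B n M') (fgen (g \o w) -
  psi b *: fgen (g \o u) - fgen (g \o v))); last first.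
  by rewrite 2!qpi_add 2!qpi_opp qpi_scale.
apply: q0; left; exists i, (psi b), (g \o u), (g \o v), (g \o w).
split=> [k ki|k ki||//] /=; first by rewrite uw.
  by rewrite vw.
by rewrite wi gD gZ.
Qed.

End ExtMap.

Section TensMap.
Variables (A B : comNzRingType) (psi : {rmorphism A -> B}).
Variables (M N : lmodType A).

Lemma tens_lift_semilin (L : lmodType B) (g : M -> N -> L) :
  (forall z, semilin psi (g^~ z)) -> (forall z, semilin psi (g z)) ->
  semilin psi (tens_lift psi g).
Proof.
move=> gl gr; apply: qflift_semilinear => r.
have [_ fD fN fZ] :=
  semilinearB (@flift_semilinear _ _ _ _ psi (fun z : M * N => g z.1 z.2)).
case=> [[a [z [z' [w ->]]]]|[a [z [w [w' ->]]]]];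
  rewrite !(fD, fN) fZ !flift_gen /=.
  by have /= -> := gl w a z z'; rewrite addrAC addrK subrr.
by have /= -> := gr z a w w'; rewrite addrAC addrK subrr.
Qed.

End TensMap.

Section TensPure.
Variables (A : comNzRingType) (M N : lmodType A).

Lemma tpure_l (y : N) : semilin idfun (fun x : M => tpure x y).
Proof.
move=> a x x'; rewrite /tpure -linearP; apply/qpi_eq; rewrite opprD addrA.
by apply: sub_mspan; left; exists a, x, x', y.
Qed.

Lemma tpure_r (x : M) : semilin idfun (fun y : N => tpure x y).
Proof.
move=> a y y'; rewrite /tpure -linearP; apply/qpi_eq; rewrite opprD addrA.
by apply: sub_mspan; right; exists a, x, y, y'.
Qed.

Lemma tpureZl a x y : tpure (a *: x : M) (y : N) = a *: tpure x y.
Proof. by have [_ _ _ ->] := semilinearB (phi := idfun) (tpure_l y). Qed.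

Lemma tpureZr a x y : tpure (x : M) (a *: y : N) = a *: tpure x y.
Proof. by have [_ _ _ ->] := semilinearB (phi := idfun) (tpure_r x). Qed.

Lemma tens_cyclic (g : M) (h : N) : (forall x, exists c, x = c *: g) ->
  (forall y, exists c, y = c *: h) -> forall q, exists c, q = c *: tpure g h.
Proof.
move=> cg ch; apply: (tens_ind (T := [set q | exists c, q = c *: tpure g h])).
  split=> [|a _ _ [b ->] [d ->]]; first by exists 0; rewrite scale0r.
  by exists (a * b + d); rewrite scalerDl scalerA.
move=> x y; have [b ->] := cg x; have [d ->] := ch y.
by exists (b * d); rewrite tpureZl tpureZr scalerA.
Qed.

Lemma tens_form (f : M -> A^o) (g : N -> A^o) :
  semilin idfun f -> semilin idfun g -> exists L : tens M N -> A^o,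
  semilin idfun L /\ forall x y, L (tpure x y) = f x * g y.
Proof.
move=> fl gl; exists (tens_lift idfun (fun x y => f x * g y : A^o)).
have l1 z : semilin idfun (fun x => f x * g z : A^o).
  by move=> a x y /=; rewrite fl mulrDl -scalerAl.
have l2 z : semilin idfun (fun y => f z * g y : A^o).
  by move=> a x y /=; rewrite gl mulrDr -scalerAr.
split; first exact: (tens_lift_semilin (psi := idfun)).
by move=> x y; rewrite (tens_liftE (psi := idfun) (g := fun x y => f x * g y : A^o)).
Qed.

End TensPure.

Section TensMap2.
Variables (A B : comNzRingType) (psi : {rmorphism A -> B}).
Variables (M N : lmodType A) (M' N' : lmodType B) (g : M -> M') (h : N -> N').
Hypotheses (gl : semilin psi g) (hl : semilin psi h).

Lemma tens_map_l z : semilin psi (fun x => tpure (g x) (h z)).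
Proof. by move=> a x y /=; rewrite gl tpure_l. Qed.
Lemma tens_map_r z : semilin psi (fun y => tpure (g z) (h y)).
Proof. by move=> a x y /=; rewrite hl tpure_r. Qed.

Lemma tens_map_semilin : semilin psi (tens_map psi g h).
Proof. exact: tens_lift_semilin tens_map_l tens_map_r. Qed.

Lemma tens_mapE x y : tens_map psi g h (tpure x y) = tpure (g x) (h y).
Proof. exact: (tens_liftE x y tens_map_l tens_map_r). Qed.

End TensMap2.

Section BigTens.
Variables (A : comNzRingType) (L : int -> lmodType A).

Lemma btens_cyclic (g : forall i, L i) s :
  (forall i x, exists c, x = c *: g i) -> forall q : btens L s, exists c, q = c *: btpure g s.
Proof.
move=> cg; elim: s => [q|i s IH] /=; first by exists q; rewrite [_ *: _]mulr1.
exact: tens_cyclic.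
Qed.

Lemma btens_form (f : forall i, L i -> A^o) s : (forall i, semilin idfun (f i)) ->
  exists F : btens L s -> A^o, semilin idfun F /\
  forall x, F (btpure x s) = \prod_(i <- s) f i (x i).
Proof.
move=> fl; elim: s => [|i s [F [Fl FE]]] /=.
  by exists idfun; split=> // x; rewrite big_nil.
have [G [Gl GE]] := tens_form (fl i) Fl.
by exists G; split=> // x; rewrite GE FE big_cons.
Qed.

Lemma eq_btpure (x y : forall i, L i) s : (forall i, i \in s -> x i = y i) ->
  btpure x s = btpure y s.
Proof.
elim: s => //= i s IH xy; rewrite xy ?mem_head // IH // => j js.
by apply: xy; rewrite inE js orbT.
Qed.

End BigTens.

Section BigTensMap.
Variables (A B : comNzRingType) (psi : {rmorphism A -> B}).
Variables (L : int -> lmodType A) (L' : int -> lmodType B).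
Variable g : forall i, L i -> L' i.
Hypothesis gl : forall i, semilin psi (@g i).

Lemma btmap_semilin s : semilin psi (btmap psi g (s := s)).
Proof.
elim: s => [|i s IH] /=; last exact: tens_map_semilin.
by move=> a x y; rewrite rmorphD rmorphM.
Qed.

Lemma btmapE x s : btmap psi g (btpure x s) = btpure (fun i => g (x i)) s.
Proof.
elim: s => [|i s IH] /=; first exact: rmorph1.
by rewrite tens_mapE ?IH //; apply: btmap_semilin.
Qed.

End BigTensMap.

(** * Adapted bases and the determinant of cohomology *)

Section CohomologyClasses.
Variables (A : comNzRingType) (V : cpx A).
Implicit Types (i : int).

Lemma submodule_cocycle i : submodule [set x : V i | cd V i (i + 1) x = 0].
Proof.
split=> [|a x y /= dx dy] /=; first by rewrite linear0.
by rewrite linearP dx dy scaler0 addr0.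
Qed.

Lemma submodule_coboundary i :
  submodule [set z : cocycles V i | exists y : V (i - 1), mval z = cd V (i - 1) i y].
Proof.
split=> [|a x y [w xw] [w' yw]] /=; first by exists 0; rewrite linear0.
by exists (a *: w + w'); rewrite linearP -xw -yw.
Qed.

Lemma coh_cls_eq0 i (x : V i) : cd V i (i + 1) x = 0 ->
  coh_cls x = 0 <-> exists w, x = cd V (i - 1) i w.
Proof.
move=> dx; rewrite /coh_cls qpi_eq0; last exact: submodule_coboundary.
by rewrite /= insub0_val //; apply: submodule_cocycle.
Qed.

Lemma coh_cls_lin i a (x y : V i) : cd V i (i + 1) x = 0 -> cd V i (i + 1) y = 0 ->
  coh_cls (a *: x + y) = a *: coh_cls x + coh_cls y.
Proof.
move=> dx dy; rewrite /coh_cls -linearP; congr (qpi _ _); apply/val_inj.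
have sub := submodule_cocycle i.
rewrite [LHS](insub0_val (x := a *: x + y) sub); last exact: sub.2.
rewrite -[RHS]/(a *: mval (insub0 _ x) + mval (insub0 _ y)).
by rewrite !(insub0_val sub).
Qed.

Lemma coh_cls0 i : coh_cls (0 : V i) = 0.
Proof. by apply/coh_cls_eq0; [rewrite linear0|exists 0; rewrite linear0]. Qed.

Lemma coh_clsZ i a (x : V i) : cd V i (i + 1) x = 0 ->
  coh_cls (a *: x) = a *: coh_cls x.
Proof.
by move=> dx; rewrite -[a *: x]addr0 coh_cls_lin ?linear0 // coh_cls0 addr0.
Qed.

Lemma coh_clsD i (x y : V i) : cd V i (i + 1) x = 0 -> cd V i (i + 1) y = 0 ->
  coh_cls (x + y) = coh_cls x + coh_cls y.
Proof. by move=> dx dy; have := coh_cls_lin 1 dx dy; rewrite (scale1r x) (scale1r (coh_cls x)). Qed.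

Lemma coh_clsB i (x y : V i) : cd V i (i + 1) x = 0 -> cd V i (i + 1) y = 0 ->
  coh_cls (x - y) = coh_cls x - coh_cls y.
Proof.
move=> dx dy; have := coh_cls_lin (-1) dy dx.
by rewrite (scaleN1r y) (scaleN1r (coh_cls y)) addrC [in RHS]addrC.
Qed.

Lemma coh_cls_eq i (x y : V i) : cd V i (i + 1) x = 0 -> cd V i (i + 1) y = 0 ->
  coh_cls x = coh_cls y <-> exists w, x - y = cd V (i - 1) i w.
Proof.
move=> dx dy; rewrite -coh_cls_eq0 ?linearB ?dx ?dy ?subrr //.
rewrite coh_clsB //.
by split=> [->|/eqP]; [rewrite subrr|rewrite subr_eq0 => /eqP].
Qed.

Lemma coh_cls_sum i n (c : nat -> A) (x : nat -> V i) :
  (forall k, (k < n)%N -> cd V i (i + 1) (x k) = 0) ->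
  coh_cls (\sum_(k < n) c k *: x k) = \sum_(k < n) c k *: coh_cls (x k).
Proof.
elim: n => [|n IH] dx; first by rewrite !big_ord0 coh_cls0.
have dx' k : (k < n)%N -> cd V i (i + 1) (x k) = 0 by move=> kn; apply/dx/ltnW.
have dS := submodule_comb (n := n) c (submodule_cocycle i) dx'.
have dn := submoduleZ (c n) (submodule_cocycle i) (dx n (ltnSn n)).
rewrite [in LHS]big_ord_recr [in RHS]big_ord_recr -(IH dx').
by rewrite -[X in _ = _ + X](coh_clsZ (c n) (dx n (ltnSn n))); apply: coh_clsD.
Qed.

Lemma coh_rep_cocycle i (c : coh V i) : cd V i (i + 1) (coh_rep c) = 0.
Proof. exact: mval_in (qrep c) (submodule_cocycle i). Qed.

Lemma coh_repK i (c : coh V i) : coh_cls (coh_rep c) = c.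
Proof.
rewrite /coh_cls /coh_rep (_ : insub0 _ (mval (qrep c)) = qrep c) ?qrepK //.
apply/val_inj; rewrite [LHS]insub0_val //; first exact: submodule_cocycle.
exact: coh_rep_cocycle.
Qed.

Lemma coh_rep_cls i (x : V i) : cd V i (i + 1) x = 0 ->
  exists w, coh_rep (coh_cls x) = x + cd V (i - 1) i w.
Proof.
move=> dx; have /coh_cls_eq[] := coh_repK (coh_cls x); rewrite ?coh_rep_cocycle //.
by move=> w e; exists w; rewrite -e addrC subrK.
Qed.

Lemma coboundary_cocycle i w : cd V i (i + 1) (cd V (i - 1) i w) = 0.
Proof. exact: cd_comp. Qed.

Lemma coh_cls_coboundary i (x : V i) w : cd V i (i + 1) x = 0 ->
  coh_cls (x + cd V (i - 1) i w) = coh_cls x.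
Proof.
move=> dx; apply/coh_cls_eq; rewrite ?linearD ?dx ?coboundary_cocycle ?addr0 //.
by exists w; rewrite addrC addKr.
Qed.

End CohomologyClasses.

Section CohomologyMap.
Variables (A B : comNzRingType) (psi : {rmorphism A -> B}).
Variables (V : cpx A) (W : cpx B) (i : int) (f : V i -> W i).
Hypothesis fl : semilin psi f.
Hypothesis fZ : forall x, cd V i (i + 1) x = 0 -> cd W i (i + 1) (f x) = 0.
Hypothesis fB : forall w, exists w', f (cd V (i - 1) i w) = cd W (i - 1) i w'.

Lemma coh_map_cls x : cd V i (i + 1) x = 0 -> coh_map f (coh_cls x) = coh_cls (f x).
Proof.
move=> dx; rewrite /coh_map; have [w ->] := coh_rep_cls dx.
have [w' e] := fB w; have [_ fD _ _] := semilinearB fl.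
by rewrite fD e coh_cls_coboundary // fZ.
Qed.

Lemma coh_map_semilin : semilin psi (coh_map f).
Proof.
move=> a x y; rewrite -(coh_repK x) -(coh_repK y) -coh_cls_lin ?coh_rep_cocycle //.
rewrite !coh_map_cls ?coh_rep_cocycle // ?fl ?coh_cls_lin ?fZ ?coh_rep_cocycle //.
by rewrite linearP /= !coh_rep_cocycle scaler0 addr0.
Qed.

End CohomologyMap.

Section BaseChangeCohomology.
Variables (A R : comNzRingType) (phi : {rmorphism A -> R}) (V : cpx A) (i : int).

Lemma bcC_d1 j x : cd (bcC phi V) i j (bc1 phi x) = bc1 phi (cd V i j x).
Proof. exact: bc_d1. Qed.

Lemma bcC_cocycle x : cd V i (i + 1) x = 0 -> cd (bcC phi V) i (i + 1) (bc1 phi x) = 0.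
Proof. by move=> dx; rewrite bcC_d1 dx bc1_0. Qed.

Let g (c : coh V i) : coh (bcC phi V) i := coh_cls (V := bcC phi V) (bc1 phi (coh_rep c)).

Local Lemma bc_coh_cls x : cd V i (i + 1) x = 0 ->
  g (coh_cls x) = coh_cls (V := bcC phi V) (bc1 phi x).
Proof.
move=> dx; apply: (@coh_map_cls _ _ phi V (bcC phi V)) => //.
- exact: bc1_semilinear.
- exact: bcC_cocycle.
- by move=> w; exists (bc1 phi w); rewrite [RHS]bc_d1.
Qed.

Local Lemma bc_coh_sub : semilin (idfun \o phi) g.
Proof.
apply: (@coh_map_semilin _ _ phi V (bcC phi V)).
- exact: bc1_semilinear.
- exact: bcC_cocycle.
- by move=> w; exists (bc1 phi w); rewrite [RHS]bc_d1.
Qed.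

Lemma bc_cohE x : cd V i (i + 1) x = 0 ->
  bc_coh (phi := phi) (bc1 phi (coh_cls x)) = coh_cls (V := bcC phi V) (bc1 phi x).
Proof.
by move=> dx; rewrite -bc_coh_cls //; apply: (bc_liftE (psi := idfun) bc_coh_sub).
Qed.

Lemma bc_coh_semilin : semilin idfun (@bc_coh _ _ phi V i).
Proof. exact: bc_lift_semilinear bc_coh_sub. Qed.

End BaseChangeCohomology.

(* A form on a base-changed complex induces one on the base-changed cohomology;
   this is meaningful when the form vanishes on coboundaries. *)
Definition coh_form (A R : comNzRingType) (phi : {rmorphism A -> R}) (V : cpx A)
    (i : int) (f : mdual (bcC phi V i)) : mdual (bc phi (coh V i)) :=
  mkdual (fun z => dpair f (coh_rep (bc_coh z))).

Lemma coh_formE (A R : comNzRingType) (phi : {rmorphism A -> R}) (V : cpx A)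
    (i : int) (f : mdual (bcC phi V i)) z w :
  (forall x, dpair f (cd (bcC phi V) (i - 1) i x) = 0) ->
  cd (bcC phi V) i (i + 1) w = 0 -> bc_coh z = coh_cls w ->
  dpair (coh_form f) z = dpair f w.
Proof.
move=> f0 dw zw.
have key c v : cd (bcC phi V) i (i + 1) v = 0 -> c = coh_cls v ->
    dpair f (coh_rep c) = dpair f v.
  by move=> dv ->; have [x ->] := coh_rep_cls dv; rewrite dpairDr f0 addr0.
rewrite mkdualE; first exact: key.
move=> a x y; rewrite -dpair_linear; apply: key.
  by apply: (submodule_cocycle (bcC phi V) i).2; apply: coh_rep_cocycle.
by rewrite bc_coh_semilin coh_cls_lin ?coh_rep_cocycle // !coh_repK.
Qed.

Lemma sum_window (M : nmodType) n a m (F : nat -> M) : (a + m <= n)%N ->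
  (forall l, (l < n)%N -> ~~ (a <= l < a + m)%N -> F l = 0) ->
  \sum_(l < n) F l = \sum_(j < m) F (a + j)%N.
Proof.
move=> amn F0; rewrite -(big_mkord xpredT F) -(big_mkord xpredT (fun j => F (a + j)%N)).
rewrite (@big_cat_nat _ _ _ (a + m)) //= (@big_cat_nat _ _ _ a) ?leq_addr //=.
rewrite big_nat big1 ?add0r; last first.
  move=> l /andP[_ la]; rewrite F0 // -?ltnNge ?negb_and -?ltnNge ?la //.
  by apply: leq_trans amn; apply: ltn_addr.
rewrite [X in _ + X]big_nat [X in _ + X]big1 ?addr0; last first.
  by move=> l /andP[la ln]; rewrite F0 // negb_and -!leqNgt la orbT.
rewrite -{1}[a]add0n big_addn addKn.
by apply: eq_bigr => j _; rewrite addnC.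
Qed.

Lemma odd_absS (i : int) : odd `|(i + 1)%R|%N = ~~ odd `|i|%N.
Proof.
case: i => n; first by rewrite -PoszD !absz_nat addn1.
case: n => [//|n]; have -> : Negz n.+1 + 1 = - n.+1%:Z.
  by rewrite NegzE -(addn1 n.+1) PoszD opprD subrK.
by rewrite NegzE !abszN !absz_nat /= !negbK.
Qed.

(** * Complexes split into lifts, coboundaries and cohomology *)

Section SplitComplex.
Variables (A : comNzRingType) (V : cpx A) (n : int -> nat) (h1 h2 : nat).

(** The part of [adapted] that consists of identities between vectors: it passes to any base change,
    whereas the basis property and the nonvanishing of [alpha] have to be checked again there. *)
Record split_cpx (m : int -> nat) (u : forall i, nat -> V i) (alpha : nat -> A) : Prop :=
  SplitCpx {
  split_rank : forall i, n i = (m (i - 1)%R + m i + coh_dim h1 h2 i)%N;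
  split_lift : forall i k, (k < m i)%N ->
    cd V i (i + 1) (u i (lift_start m i + k)%N) =
    (if i == 1 then alpha k else 1) *: u (i + 1) (cobound_start m (i + 1) + k)%N;
  split_cocycle : forall i k, (k < n i)%N ->
    ~~ (lift_start m i <= k < lift_start m i + m i)%N ->
    cd V i (i + 1) (u i k) = 0 }.

Variables (m : int -> nat) (u : forall i, nat -> V i) (alpha : nat -> A).
Hypothesis sp : split_cpx m u alpha.

Definition coh_start (i : int) : nat := (m (i - 1) + m i)%N.

Lemma lift_bound i : (lift_start m i + m i <= n i)%N.
Proof.
rewrite (split_rank sp) /lift_start; case: odd; rewrite ?add0n ?leq_addr //.
by rewrite addnAC leq_addl.
Qed.

Lemma cobound_bound i : (cobound_start m (i + 1) + m i <= n (i + 1))%N.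
Proof.
rewrite (split_rank sp) addrK /cobound_start; case: odd; last by rewrite addnC leq_addr.
by rewrite add0n -addnA leq_addr.
Qed.

Lemma coh_bound i k : (k < coh_dim h1 h2 i)%N -> (coh_start i + k < n i)%N.
Proof. by move=> kh; rewrite (split_rank sp) ltn_add2l. Qed.

Lemma coh_notin_lift i k : ~~ (lift_start m i <= coh_start i + k < lift_start m i + m i)%N.
Proof.
rewrite negb_and -leqNgt orbC /lift_start /coh_start; case: odd.
  by rewrite leq_addr.
by rewrite add0n addnAC leq_addl.
Qed.

Lemma coh_notin_cobound i k :
  ~~ (cobound_start m (i + 1) <= coh_start (i + 1) + k < cobound_start m (i + 1) + m i)%N.
Proof.
rewrite negb_and -leqNgt orbC /cobound_start /coh_start addrK; case: odd.
  by rewrite add0n -addnA leq_addr.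
by rewrite [X in (X <= _)%N]addnC leq_addr.
Qed.

Lemma cobound_notin_lift i k : (k < m i)%N ->
  ~~ (lift_start m (i + 1) <= cobound_start m (i + 1) + k
        < lift_start m (i + 1) + m (i + 1))%N.
Proof.
move=> km; rewrite /cobound_start /lift_start addrK negb_and -leqNgt -ltnNge; case: odd.
  by rewrite add0n km.
by rewrite add0n leq_addr orbT.
Qed.

Lemma split_coh_cocycle i k : (k < coh_dim h1 h2 i)%N ->
  cd V i (i + 1) (u i (coh_start i + k)%N) = 0.
Proof. by move=> kh; apply: (split_cocycle sp); [apply: coh_bound|apply: coh_notin_lift]. Qed.

Lemma split_cobound_cocycle i k : (k < m i)%N ->
  cd V (i + 1) (i + 1 + 1) (u (i + 1) (cobound_start m (i + 1) + k)%N) = 0.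
Proof.
move=> km; apply: (split_cocycle sp); last exact: cobound_notin_lift.
by apply: leq_trans (cobound_bound i); rewrite ltn_add2l.
Qed.

Lemma split_d_comb i (c : nat -> A) :
  cd V i (i + 1) (\sum_(l < n i) c l *: u i l) =
  \sum_(j < m i) (c (lift_start m i + j)%N * (if i == 1 then alpha j else 1)) *:
    u (i + 1) (cobound_start m (i + 1) + j)%N.
Proof.
rewrite linear_sum (@sum_window _ _ (lift_start m i) (m i)
  (fun l => cd V i (i + 1) (c l *: u i l))) ?lift_bound //.
  by apply: eq_bigr => j _; rewrite linearZ /= (split_lift sp) // scalerA.
by move=> l ln nl; rewrite linearZ /= (split_cocycle sp) ?scaler0.
Qed.

End SplitComplex.

(** The normalization of [det_coh] quantifies over the ranks m as well. In a degree where n vanishes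
    both rank functions vanish, and the recurrence propagates equality from there in both
    directions. *)
Lemma ranks_unique (n m m' c : int -> nat) (i0 : int) : n i0 = 0%N ->
  (forall i, n i = (m (i - 1)%R + m i + c i)%N) ->
  (forall i, n i = (m' (i - 1)%R + m' i + c i)%N) -> m =1 m'.
Proof.
move=> n0 mn mn'.
have z i : n i = 0%N -> m i = m' i.
  move=> ni; move: (mn i) (mn' i); rewrite ni => /esym/eqP + /esym/eqP.
  by rewrite !addn_eq0 => /andP[/andP[_ /eqP ->] _] /andP[/andP[_ /eqP ->] _].
have sum i : (m (i - 1)%R + m i = m' (i - 1)%R + m' i)%N.
  by apply: (@addIn (c i)); rewrite -mn -mn'.
have up (k : nat) : m (i0 + k%:Z) = m' (i0 + k%:Z).
  elim: k => [|k IH]; first by rewrite addr0; apply: z.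
  have := sum (i0 + k.+1%:Z); rewrite -addn1 PoszD addrA addrK IH.
  exact: addnI.
have down (k : nat) : m (i0 - k%:Z) = m' (i0 - k%:Z).
  elim: k => [|k IH]; first by rewrite subr0; apply: z.
  have := sum (i0 - k%:Z); rewrite IH -addn1 PoszD opprD addrA.
  exact: addIn.
move=> i; have -> : i = i0 + (i - i0) by rewrite addrC subrK.
by case: (i - i0) => k; [apply: up|rewrite NegzE; apply: down].
Qed.

Section DualCoordinates.
Variables (R : comNzRingType) (E : cpx R) (n : int -> nat) (h1 h2 : nat).
Variables (m : int -> nat) (u : forall i, nat -> E i) (alpha : nat -> R).
Hypothesis sp : split_cpx n h1 h2 m u alpha.
Hypothesis ub : forall i, is_basis (n i) (u i).
Variable u' : forall i, nat -> mdual (E i).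
Hypothesis uu' : forall i, dual_families (n i) (u i) (u' i).

Let al (i : int) (j : nat) : R := if i == 1 then alpha j else 1.

Lemma d_dual_coord i x : cd E i (i + 1) x =
  \sum_(j < m i) (dpair (u' i (lift_start m i + j)%N) x * al i j) *:
    u (i + 1) (cobound_start m (i + 1) + j)%N.
Proof.
rewrite [in LHS](dual_coord x (ub i).2 (@uu' i)).
exact: (@split_d_comb _ _ _ _ _ _ _ _ sp i (fun l => dpair (u' i l) x)).
Qed.

Lemma dual_coord_d i l x : (l < n (i + 1))%N ->
  dpair (u' (i + 1) l) (cd E i (i + 1) x) =
  if (cobound_start m (i + 1) <= l < cobound_start m (i + 1) + m i)%N
  then dpair (u' i (lift_start m i + (l - cobound_start m (i + 1)))%N) x *
       al i (l - cobound_start m (i + 1)) else 0.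
Proof.
have cb := cobound_bound sp i; set cs := cobound_start m (i + 1) in cb *.
have csn j : (j < m i)%N -> (cs + j < n (i + 1)%R)%N.
  by move=> jm; apply: leq_trans cb; rewrite ltn_add2l.
move=> ln; rewrite d_dual_coord -/cs.
rewrite (dpair_sum (u' (i + 1) l) (m i) (fun j => dpair (u' i (lift_start m i + j)%N) x *
  al i j) (fun j => u (i + 1) (cs + j)%N)).
case: ifP => [/andP[csl lcs]|/negbT nl].
  have lm : (l - cs < m i)%N by rewrite ltn_subLR.
  rewrite (bigD1 (Ordinal lm)) //= uu' ?csn // subnKC // eqxx mulr1 big1 ?addr0 //.
  move=> j jl; rewrite uu' ?csn //; have /negPf jl' : (j != (l - cs)%N :> nat) := jl.
  by rewrite -(subnKC csl) eqn_add2l eq_sym jl' mulr0.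
rewrite big1 // => j _; rewrite uu' ?csn //; case: eqP => [e|_]; last by rewrite mulr0.
by move: nl; rewrite e leq_addr ltn_add2l ltn_ord.
Qed.

Lemma dual_coord_coboundary i l x : (l < n i)%N ->
  ~~ (cobound_start m i <= l < cobound_start m i + m (i - 1)%R)%N ->
  dpair (u' i l) (cd E (i - 1) i x) = 0.
Proof.
(* [i - 1 + 1] equals [i] only propositionally, so the lower degree is generalised before the
   equality is eliminated. *)
suff gen j (e : j + 1 = i) (y : E j) : (l < n i)%N ->
    ~~ (cobound_start m i <= l < cobound_start m i + m j)%N ->
    dpair (u' i l) (cd E j i y) = 0 by exact: gen (subrK 1 i) x.
by case: i / e {x} => ln nl; rewrite dual_coord_d // (negPf nl).
Qed.

Hypothesis R_dom : GRing.integral_domain_axiom R.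
Hypothesis alpha0 : forall k, (k < m 1)%N -> alpha k != 0.

Lemma al_neq0 i k : (k < m i)%N -> al i k != 0.
Proof. by rewrite /al; case: (i =P 1) => [->|_ _]; [apply: alpha0|apply: oner_neq0]. Qed.

(** The differential multiplies the j-th lift coordinate by [al i j], which is nonzero in a domain;
    hence a cocycle has no lift coordinates. *)
Lemma cocycle_dual_coord i x j : cd E i (i + 1) x = 0 -> (j < m i)%N ->
  dpair (u' i (lift_start m i + j)%N) x = 0.
Proof.
move=> dx jm; have cb := cobound_bound sp i.
have ln : (cobound_start m (i + 1) + j < n (i + 1)%R)%N.
  by apply: leq_trans cb; rewrite ltn_add2l.
have := dual_coord_d x ln; rewrite dx dpair0r leq_addr ltn_add2l jm addKn /=.
by move=> /esym/R_dom/orP[/eqP//|]; rewrite (negPf (al_neq0 jm)).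
Qed.

End DualCoordinates.

(** * Transition matrices between two adapted families *)

Section Comparison.
Variables (R : comNzRingType) (E : cpx R) (n : int -> nat) (h1 h2 : nat).
Variables (m : int -> nat) (u v : forall i, nat -> E i) (alpha beta : nat -> R).
Hypotheses (spu : split_cpx n h1 h2 m u alpha) (spv : split_cpx n h1 h2 m v beta).
Hypothesis ub : forall i, is_basis (n i) (u i).
Variable u' : forall i, nat -> mdual (E i).
Hypothesis uu' : forall i, dual_families (n i) (u i) (u' i).
Hypothesis R_dom : GRing.integral_domain_axiom R.
Hypothesis alpha0 : forall k, (k < m 1)%N -> alpha k != 0.
Hypothesis beta0 : forall k, (k < m 1)%N -> beta k != 0.

Let al (i : int) (j : nat) : R := if i == 1 then alpha j else 1.
Let be (i : int) (j : nat) : R := if i == 1 then beta j else 1.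

Definition transition (i : int) (k l : nat) : R := dpair (u' i l) (v i k).
Definition det_cobound (i : int) : R := ndet (m (i - 1)) (fun k l =>
  transition i (cobound_start m i + k) (cobound_start m i + l)).
Definition det_lift (i : int) : R := ndet (m i) (fun k l =>
  transition i (lift_start m i + k) (lift_start m i + l)).
Definition det_coh_part (i : int) : R := ndet (coh_dim h1 h2 i) (fun k l =>
  transition i (coh_start m i + k) (coh_start m i + l)).

(** Both sides are a u-coordinate of the differential of the k-th lift of v: on the left it is
    [be i k] times a vector of v, on the right only the lift coordinates of that vector
    contribute. *)
Lemma transition_cobound i k l : (k < m i)%N -> (l < n (i + 1)%R)%N ->
  be i k * transition (i + 1) (cobound_start m (i + 1) + k) l =
  if (cobound_start m (i + 1) <= l < cobound_start m (i + 1) + m i)%N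
  then transition i (lift_start m i + k) (lift_start m i + (l - cobound_start m (i + 1)))%N
       * al i (l - cobound_start m (i + 1)) else 0.
Proof.
by move=> km ln; rewrite -(dual_coord_d spu ub uu') // (split_lift spv) // dpairZr.
Qed.

Lemma transition_cobound0 i k l : (k < m (i - 1)%R)%N -> (l < n i)%N ->
  ~~ (cobound_start m i <= l < cobound_start m i + m (i - 1)%R)%N ->
  transition i (cobound_start m i + k) l = 0.
Proof.
suff gen j (e : j + 1 = i) : (k < m j)%N -> (l < n i)%N ->
    ~~ (cobound_start m i <= l < cobound_start m i + m j)%N ->
    transition i (cobound_start m i + k) l = 0 by exact: gen (subrK 1 i).
case: i / e => km ln nl; have := transition_cobound km ln; rewrite (negPf nl).
by move=> /R_dom/orP[|/eqP//]; rewrite (negPf (al_neq0 beta0 km)).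
Qed.

Lemma transition_lift0 i k j : (k < n i)%N -> (j < m i)%N ->
  ~~ (lift_start m i <= k < lift_start m i + m i)%N ->
  transition i k (lift_start m i + j)%N = 0.
Proof.
move=> kn jm nk; apply: (cocycle_dual_coord spu ub uu') => //.
exact: (split_cocycle spv).
Qed.

(** The lift block in degree i and the coboundary block in degree i + 1 are intertwined by the
    diagonal matrices of the coefficients. This is the relation that makes the alternating product
    of determinants telescope. *)
Lemma det_cobound_lift i : (\prod_(k < m i) be i k) * det_cobound (i + 1) =
  det_lift i * \prod_(k < m i) al i k.
Proof.
rewrite /det_cobound addrK -ndet_scale_rows -ndet_scale_cols; apply: eq_ndet => k l km lm.
rewrite transition_cobound ?leq_addr ?ltn_add2l ?lm ?addKn //.
by apply: leq_trans (cobound_bound spu i); rewrite ltn_add2l.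
Qed.

(** Coboundaries have only coboundary coordinates and cocycles have no lift coordinates, so the
    matrix is block triangular. The order of the blocks depends on the parity of i, hence two
    cases. *)
Lemma ndet_transition i :
  ndet (n i) (transition i) = det_cobound i * det_lift i * det_coh_part i.
Proof.
have cob0 k l : (k < m (i - 1)%R)%N -> (l < n i)%N -> _ :=
  @transition_cobound0 i k l.
have lif0 k j := @transition_lift0 i k j.
move: cob0 lif0; rewrite (split_rank spu) /det_cobound /det_lift /det_coh_part.
rewrite /cobound_start /lift_start /coh_start.
set b := m (i - 1)%R; set l := m i; set h := coh_dim h1 h2 i.
case: odd => cob0 lif0.
  rewrite -addnA ndet_lblock => [|k j kb /andP[bj jn]]; last first.
    by rewrite -[k]add0n; apply: cob0; lia.
  rewrite -mulrA; congr (_ * _); rewrite ndet_ublock => [|k j /andP[lk klh] jl].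
    by congr (_ * _); apply: eq_ndet => k j _ _; rewrite !addnA.
  by apply: lif0; lia.
rewrite (addnC b) -addnA ndet_ublock => [|k j /andP[lk kn] jl]; last first.
  by rewrite -[j]add0n; apply: lif0; lia.
rewrite ndet_lblock => [|k j kb /andP[bj jn]]; last by apply: cob0; lia.
rewrite mulrA; congr (_ * _); first by rewrite mulrC.
by apply: eq_ndet => k j _ _; rewrite !addnA.
Qed.

End Comparison.

Lemma sgn_form (R : comNzRingType) (M : lmodType R) (i : int) n (u : nat -> M)
    (u' : nat -> mdual M) : exists L : extp n (sgn_mod i M) -> R^o,
  semilin idfun L /\ forall v v', L (wedge n (sgn_fam i v v')) =
    if odd `|i|%N then ndet n (fun k l => dpair (u' l) (v k))
    else ndet n (fun k l => dpair (v' k) (u l)).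
Proof.
rewrite /sgn_mod /sgn_fam; case: odd.
  by have [L [Ll LE]] := extp_form n u'; exists L.
by have [L [Ll LE]] := extp_dual_form n u; exists L.
Qed.

(** When u' is dual to u this form takes the value 1 on the generator attached to u, so it computes
    the ratio of any other generator to that one. *)
Lemma detinv_form (R : comNzRingType) (V : cpx R) (n : int -> nat) (s : seq int)
    (u : forall i, nat -> V i) (u' : forall i, nat -> mdual (V i)) :
  exists L : detinv V n s -> R^o, semilin idfun L /\
  forall v v', L (detinv_gen n s v v') = \prod_(i <- s)
    if odd `|i|%N then ndet (n i) (fun k l => dpair (u' i l) (v i k))
    else ndet (n i) (fun k l => dpair (v' i k) (u i l)).
Proof.
pose f i := sval (cid (sgn_form i (n i) (u i) (u' i))).
have fP i := svalP (cid (sgn_form i (n i) (u i) (u' i))).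
have [L [Ll LE]] := btens_form (f := f) s (fun i => (fP i).1).
by exists L; split=> // v v'; rewrite LE; apply: eq_bigr => i _; apply: (fP i).2.
Qed.

Lemma degreesS lo len : degrees lo len.+1 = rcons (degrees lo len) (lo + len%:Z).
Proof. by rewrite /degrees -addn1 iotaD map_cat cats1 add0n. Qed.

Lemma prod_telescope (F : fieldType) (b : int -> F) lo len : (forall i, b i != 0) ->
  \prod_(i <- degrees lo len) (b i / b (i + 1)) = b lo / b (lo + len%:Z).
Proof.
move=> b0; elim: len => [|len IH]; first by rewrite big_nil addr0 divff.
rewrite degreesS -cats1 big_cat big_seq1 IH /= mulrA divfK //.
by rewrite -addrA -PoszD addn1.
Qed.

Lemma degrees_uniq lo len : uniq (degrees lo len).
Proof. by rewrite map_inj_uniq ?iota_uniq // => i j /addrI[]. Qed.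

Lemma degreesP lo len i : (i \in degrees lo len) = (lo <= i < lo + len%:Z).
Proof.
apply/mapP/idP => [[k]|/andP[l1 l2]]; first by rewrite mem_iota => ? ->; lia.
exists `|i - lo|%N; first by rewrite mem_iota; lia.
by lia.
Qed.

Lemma prod_two (F : comNzRingType) (s : seq int) (f : int -> F) (a b : int) :
  uniq s -> a != b -> (forall i, i != a -> i != b -> f i = 1) ->
  (a \notin s -> f a = 1) -> (b \notin s -> f b = 1) ->
  \prod_(i <- s) f i = f a * f b.
Proof.
move=> us ab f1 fa fb.
have rem (g : int -> F) c : (c \notin s -> g c = 1) -> (forall i, i != c -> g i = 1) ->
    \prod_(i <- s) g i = g c.
  move=> gc g1; have [cs|cs] := boolP (c \in s); last first.
    rewrite gc // big_seq big1 // => i is_; apply: g1; by apply: contraNneq cs => <-.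
  by rewrite (bigD1_seq c) //= big1 ?mulr1.
have -> : \prod_(i <- s) f i = \prod_(i <- s) ((if i == a then f a else 1) *
    (if i == b then f b else 1)).
  apply: eq_bigr => i _; case: eqP => [->|/eqP ia]; first by rewrite (negPf ab) mulr1.
  by case: eqP => [->|/eqP ib]; rewrite mul1r // f1.
rewrite big_split /= (rem _ a) ?(rem _ b) ?eqxx // => i /negPf -> //.
Qed.

(** * The alternating product of the transition determinants *)

Section DetRatio.
Variables (R : comNzRingType) (F : fieldType) (psi : {rmorphism R -> F}).
Hypothesis psi_inj : injective psi.

Lemma domain_of_inj : GRing.integral_domain_axiom R.
Proof.
move=> x y /(congr1 psi); rewrite rmorphM rmorph0 => /eqP; rewrite mulf_eq0.
by rewrite -!(rmorph0 psi) !(inj_eq psi_inj).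
Qed.

Lemma psi_neq0 x : x != 0 -> psi x != 0.
Proof. by apply: contra => /eqP; rewrite -(rmorph0 psi) => /psi_inj ->. Qed.

Variables (E : cpx R) (n : int -> nat) (h1 h2 : nat).
Variables (m : int -> nat) (u v : forall i, nat -> E i) (alpha beta : nat -> R).
Hypotheses (spu : split_cpx n h1 h2 m u alpha) (spv : split_cpx n h1 h2 m v beta).
Hypothesis ub : forall i, is_basis (n i) (u i).
Variables u' v' : forall i, nat -> mdual (E i).
Hypothesis uu' : forall i, dual_families (n i) (u i) (u' i).
Hypothesis vv' : forall i, dual_families (n i) (v i) (v' i).
Hypothesis alpha0 : forall k, (k < m 1)%N -> alpha k != 0.
Hypothesis beta0 : forall k, (k < m 1)%N -> beta k != 0.
Variables (lo : int) (len : nat).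
Hypothesis n0 : forall i, i \notin degrees lo len -> n i = 0%N.

Let g := transition v u'.
(** The exponent (-1)^(i+1) of degree i in det^{-1}. B, L and H are the coboundary, lift and
    cohomology blocks in the field F, and c records the coefficients of degree 1, by which B in
    degree i + 1 differs from L in degree i. *)
Let e (i : int) (x : F) : F := if odd `|i|%N then x else x^-1.
Let B i := psi (det_cobound m v u' i).
Let L i := psi (det_lift m v u' i).
Let H i := psi (det_coh_part h1 h2 m v u' i).
Let c (i : int) : F := if i == 1 then psi (\prod_(k < m 1) alpha k) / psi (\prod_(k < m 1) beta k)
  else 1.

Lemma ndet_transition_dual i :
  ndet (n i) (fun k l => dpair (v' i k) (u i l)) * ndet (n i) (g i) = 1.
Proof.
rewrite -[ndet (n i) (g i)]ndet_tr -ndetM -[RHS](ndet_delta _ (n i)).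
apply: eq_ndet => k l kn ln; rewrite -(@vv' i) // [in RHS](dual_coord (v i l) (ub i).2 (@uu' i)).
rewrite (dpair_sum (v' i k) (n i) (fun j => dpair (u' i j) (v i l)) (u i)).
by apply: eq_bigr => j _; rewrite mulrC.
Qed.

Lemma prod_psi_neq0 (a : nat -> R) : (forall k, (k < m 1)%N -> a k != 0) ->
  psi (\prod_(k < m 1) a k) != 0.
Proof. by move=> a0; rewrite rmorph_prod prodf_seq_neq0; apply/allP => k _; rewrite psi_neq0 ?a0. Qed.

(** Since B (i + 1) is L i times c i, the factor of degree i is a quotient of consecutive signed
    values of B times the signed value of H i / c i. The B part telescopes, and H and c are trivial
    outside degrees 1 and 2. Division is available in F; the identity is stated in R with
    denominators cleared. *)
Lemma det_ratio :
  (\prod_(i <- degrees lo len)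
     if odd `|i|%N then ndet (n i) (g i)
     else ndet (n i) (fun k l => dpair (v' i k) (u i l))) *
  (\prod_(k < m 1) alpha k) * det_coh_part h1 h2 m v u' 2 =
  (\prod_(k < m 1) beta k) * det_coh_part h1 h2 m v u' 1.
Proof.
apply: psi_inj; rewrite !rmorphM [psi (\prod_(i <- _) _)]rmorph_prod.
have G i : psi (ndet (n i) (g i)) = B i * L i * H i.
  by rewrite -!rmorphM (ndet_transition spu spv) //; exact: domain_of_inj.
have G0 i : psi (ndet (n i) (g i)) != 0.
  have := congr1 psi (ndet_transition_dual i); rewrite rmorphM rmorph1.
  by apply: contra_eqN => /eqP ->; rewrite mulr0 eq_sym oner_eq0.
have B0 i : B i != 0 by apply: contra_neqN (G0 i) => /eqP; rewrite G => ->; rewrite !mul0r.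
have L0 i : L i != 0.
  by apply: contra_neqN (G0 i) => /eqP; rewrite G => ->; rewrite mulr0 mul0r.
have H0 i : H i != 0 by apply: contra_neqN (G0 i) => /eqP; rewrite G => ->; rewrite mulr0.
have a0 := prod_psi_neq0 alpha0; have b0 := prod_psi_neq0 beta0.
have c0 i : c i != 0 by rewrite /c; case: ifP => _; rewrite ?oner_neq0 // mulf_neq0 ?invr_neq0.
have BL i : B (i + 1) = L i * c i.
  have := congr1 psi (det_cobound_lift spu spv ub uu' i); rewrite !rmorphM -/(B _) -/(L _) /c.
  have [->|i1] := eqVneq i 1 => h; last first.
    by move: h; rewrite !big1 // !rmorph1 mul1r.
  by rewrite mulrA -h mulrAC divff // mul1r.
rewrite (eq_bigr (fun i => (e i (B i) / e (i + 1) (B (i + 1))) * e i (H i / c i))); last first.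
  move=> i _; rewrite /e odd_absS BL; case: odd => /=.
    by rewrite G invrK; field; rewrite c0.
  have -> : psi (ndet (n i) (fun k l => dpair (v' i k) (u i l))) = (B i * L i * H i)^-1.
    apply: (mulIf (G0 i)); rewrite -rmorphM ndet_transition_dual rmorph1 G mulVf //.
    by rewrite -G.
  by field; rewrite c0 L0 B0 H0.
have m0 i : n i = 0%N -> m i = 0%N /\ m (i - 1) = 0%N /\ coh_dim h1 h2 i = 0%N.
  by rewrite (split_rank spu); lia.
(* Just outside the range of degrees the modules have rank 0, so both ends of the telescope are
   determinants of empty matrices. *)
have out : n (lo - 1) = 0%N by apply: n0; rewrite degreesP; lia.
have out' : n (lo + len%:Z) = 0%N by apply: n0; rewrite degreesP; lia.
rewrite big_split /= prod_telescope; last first.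
  by move=> i; rewrite /e; case: ifP => _; rewrite ?invr_neq0.
rewrite /e /B /det_cobound (m0 _ out).1 (m0 _ out').2.1 !ndet0 rmorph1 invr1 !if_same divr1 mul1r.
have Hc i : i \notin degrees lo len -> H i / c i = 1.
  move=> /n0 /m0[mi [_ hi]]; rewrite /H /det_coh_part hi ndet0 rmorph1 /c.
  by case: eqP => [i1|_]; rewrite ?divr1 // -i1 mi !big_ord0 rmorph1 divr1 divr1.
rewrite (@prod_two _ _ _ 1 2) ?degrees_uniq //=; last first.
- by move=> /Hc ->; rewrite invr1.
- by move=> /Hc ->.
- move=> i i1 i2; rewrite /H /det_coh_part /coh_dim /c (negPf i1) (negPf i2) ndet0 rmorph1.
  by rewrite divr1 invr1 if_same.
have c2 : c 2 = 1 by [].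
rewrite c2 /c eqxx divr1 -/(H 1) -/(H 2).
by field; rewrite a0 b0 H0.
Qed.

End DetRatio.

Lemma sum_cat (M : nmodType) a b (F : nat -> M) :
  \sum_(l < a + b) F l = \sum_(l < a) F l + \sum_(l < b) F (a + l)%N.
Proof. by rewrite big_split_ord. Qed.

Lemma sum_blocks (M : nmodType) (n m : int -> nat) (h1 h2 : nat) (i : int) (F : nat -> M) :
  n i = (m (i - 1)%R + m i + coh_dim h1 h2 i)%N ->
  \sum_(l < n i) F l = \sum_(j < m (i - 1)%R) F (cobound_start m i + j)%N +
    \sum_(j < m i) F (lift_start m i + j)%N +
    \sum_(j < coh_dim h1 h2 i) F (coh_start m i + j)%N.
Proof.
move=> ->; rewrite /cobound_start /lift_start /coh_start.
case: odd; rewrite sum_cat; congr (_ + _); first by rewrite sum_cat.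
by rewrite addnC sum_cat addrC.
Qed.

Lemma sum_mul_delta (R : comNzRingType) n (F : nat -> R) l : (l < n)%N ->
  \sum_(k < n) F k * (val k == l)%:R = F l.
Proof.
move=> ln; rewrite (bigD1 (Ordinal ln)) //= eqxx mulr1 big1 ?addr0 // => k kl.
by have /negPf -> : (k != l :> nat) := kl; rewrite mulr0.
Qed.

Lemma scaler_comb (A : comNzRingType) (M : lmodType A) (a : A) n (c : nat -> A) (u : nat -> M) :
  a *: (\sum_(k < n) c k *: u k) = \sum_(k < n) (a * c k) *: u k.
Proof. by rewrite scaler_sumr; apply: eq_bigr => k _; rewrite scalerA. Qed.

Lemma bcC1Z (A B : comNzRingType) (phi : {rmorphism A -> B}) (V : cpx A) i a (x : V i) :
  bc1 phi (a *: x) = phi a *: (bc1 phi x : bcC phi V i).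
Proof. exact: bc1Z. Qed.

(** * Bases after base change *)

Section BaseChangeBasis.
Variables (A R : comNzRingType) (phi : {rmorphism A -> R}).

Lemma bc_generates (M : lmodType A) n (u : nat -> M) :
  (forall x, exists b b' (c : nat -> A), phi b * b' = 1 /\ b *: x = \sum_(k < n) c k *: u k) ->
  generates n (fun k => bc1 phi (u k)).
Proof.
move=> gu.
apply: (bc_ind (T := [set x | exists c : nat -> R, x = \sum_(k < n) c k *: bc1 phi (u k)])).
  exact: (submodule_span n (fun k => bc1 phi (u k))).
move=> x.
have [b [b' [c [bb' bx]]]] := gu x; exists (fun k => b' * phi (c k)).
rewrite -[LHS]scale1r -bb' mulrC -scalerA -bc1Z bx bc1_sum scaler_sumr.
by apply: eq_bigr => k _; rewrite scalerA.
Qed.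

(** The fractions [phi (c x k) * b' x] do not depend on the expansion chosen, by independence of u
    over A. They are therefore semilinear in x and extend to linear forms on the base change dual to
    the family, which proves independence there. *)
Lemma bc_basis (M : lmodType A) n (u : nat -> M) : indep n u ->
  (forall x, exists b b' (c : nat -> A), phi b * b' = 1 /\ b *: x = \sum_(k < n) c k *: u k) ->
  is_basis n (fun k => bc1 phi (u k)).
Proof.
move=> iu gu; split; last exact: bc_generates.
have [b bP] := choice gu; have [b' b'P] := choice bP; have [c cP] := choice b'P.
pose co k x := phi (c x k) * b' x.
have co_uniq k x d d' (e : nat -> A) : (k < n)%N -> phi d * d' = 1 ->
    d *: x = \sum_(k < n) e k *: u k -> co k x = phi (e k) * d'.
  move=> kn dd' dx; have [bb' bx] := cP x.
  have eqc : \sum_(k < n) (d * c x k) *: u k = \sum_(k < n) (b x * e k) *: u k.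
    by rewrite -(scaler_comb d) -(scaler_comb (b x)) -bx -dx !scalerA mulrC.
  have := congr1 phi (indep_eq (c := fun k => d * c x k) (c' := fun k => b x * e k) iu eqc kn).
  rewrite !rmorphM /co => E.
  transitivity ((phi d * phi (c x k)) * d' * b' x); last rewrite E.
    by rewrite -[LHS]mul1r -dd'; ring.
  by rewrite -[RHS]mul1r -bb'; ring.
have colin k : (k < n)%N -> semilin (idfun \o phi) (co k : M -> R^o).
  move=> kn a x y; have [bb' bx] := cP x; have [bb'' byy] := cP y.
  rewrite (@co_uniq k _ (b x * b y) (b' x * b' y)
    (fun k => a * b y * c x k + b x * c y k)) //.
  - rewrite /co !rmorphD !rmorphM /=; rewrite [RHS](_ : _ =
      phi a * (phi (c x k) * b' x) + phi (c y k) * b' y) //.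
    rewrite -[X in _ = X + _]mul1r -[X in _ = _ + X]mul1r -{1}bb'' -{1}bb'.
    by ring.
  - by rewrite rmorphM -[RHS]mulr1 -{1}bb' -bb''; ring.
  - under eq_bigr do rewrite scalerDl.
    rewrite big_split -(scaler_comb (a * b y)) -(scaler_comb (b x)) -bx -byy.
    by rewrite scalerDr !scalerA; congr (_ *: _ + _ *: _); ring.
move=> e e0 k kn.
have cd j : (j < n)%N -> co k (u j) = (j == k)%:R.
  move=> jn; rewrite (@co_uniq k _ 1 1 (fun l => (l == j)%:R)) //.
  - by rewrite mulr1 rmorph_nat eq_sym.
  - by rewrite rmorph1 mulr1.
  - rewrite scale1r; under eq_bigr do rewrite eq_sym.
    by rewrite sum_delta.
have fl := bc_lift_semilinear (psi := idfun) (colin k kn).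
have [f0 _ _ _] := semilinearB (phi := idfun) fl.
have := semilin_sum (phi := idfun) fl n e (fun k => bc1 phi (u k)).
rewrite /= e0 f0 => /esym; rewrite (bigD1 (Ordinal kn)) //=.
rewrite (bc_liftE (psi := idfun) (colin k kn)) cd // eqxx [_ *: _]mulr1 big1 ?addr0 //.
move=> j jk; rewrite (bc_liftE (psi := idfun) (colin k kn)) cd //.
by have /negPf -> : (j != k :> nat) := jk; rewrite [_ *: _]mulr0.
Qed.

End BaseChangeBasis.

(** * Integral models of adapted bases *)

Section Model.
Variables (A R : comNzRingType) (F : fieldType) (phi : {rmorphism A -> R}).
Variables (psi : {rmorphism R -> F}).
Hypothesis psi_inj : injective psi.
Hypothesis phi_inj : injective phi.
Variables (V : cpx A) (n : int -> nat) (h1 h2 : nat).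

(** The vectors lie in V itself, so that they can be reduced modulo t, and they generate V only up
    to denominators that [phi] makes invertible. The same notion is used for [to_locI] and, after
    reduction, for [io]. *)
Record model (m : int -> nat) (a : forall i, nat -> V i) (alpha : nat -> A) : Prop := Model {
  model_split : split_cpx n h1 h2 m a alpha;
  model_gen : forall i x, exists b b' (c : nat -> A),
    phi b * b' = 1 /\ b *: x = \sum_(k < n i) c k *: a i k;
  model_basis : forall i, is_basis (n i) (fun k => bc1 phi (a i k) : bcC phi V i);
  model_alpha : forall k, (k < m 1)%N -> phi (alpha k) != 0 }.

Variables (m : int -> nat) (a : forall i, nat -> V i) (alpha : nat -> A).
Hypothesis mo : model m a alpha.
Variables (lo : int) (len : nat).
Hypothesis n0 : forall i, i \notin degrees lo len -> n i = 0%N.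
Variable u' : forall i, nat -> mdual (bcC phi V i).

Let u (i : int) (k : nat) : bcC phi V i := bc1 phi (a i k).
Hypothesis uu' : forall i, dual_families (n i) (u i) (u' i).

Let sp := model_split mo.
Let ub i : is_basis (n i) (u i) := model_basis mo i.
Let R_dom := domain_of_inj psi_inj.

Lemma model_split_bc : split_cpx n h1 h2 m u (fun k => phi (alpha k)).
Proof.
split=> [i|i k km|i k kn nk]; first exact: split_rank sp i.
- rewrite bcC_d1 (split_lift sp km) bcC1Z.
  by rewrite (fun_if phi) rmorph1.
- by rewrite bcC_d1 (split_cocycle sp) // bc1_0.
Qed.

(** After base change the lift coefficients become dual coordinates of a cocycle and vanish;
    injectivity of [phi] brings this back to A. *)
Lemma model_cocycle i x : cd V i (i + 1) x = 0 -> exists b b' (c : nat -> A), phi b * b' = 1 /\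
  b *: x = \sum_(j < m (i - 1)%R) c (cobound_start m i + j)%N *: a i (cobound_start m i + j)%N +
    \sum_(j < coh_dim h1 h2 i) c (coh_start m i + j)%N *: a i (coh_start m i + j)%N.
Proof.
move=> dx; have [b [b' [c [bb' bx]]]] := model_gen mo x; exists b, b', c; split=> //.
rewrite bx (sum_blocks (fun l => c l *: a i l) (split_rank sp i)).
congr (_ + _); rewrite -[RHS]addr0; congr (_ + _).
rewrite big1 // => j _; suff -> : c (lift_start m i + j)%N = 0 by rewrite scale0r.
apply: phi_inj; rewrite rmorph0.
have ln : (lift_start m i + j < n i)%N.
  by apply: leq_trans (lift_bound sp i); rewrite ltn_add2l.
have dx' : cd (bcC phi V) i (i + 1) (bc1 phi x) = 0 := bcC_cocycle phi dx.
have := cocycle_dual_coord model_split_bc ub uu' R_dom (model_alpha mo) dx' (ltn_ord j).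
move/(congr1 (fun z => phi b * z)); rewrite mulr0 -dpairZr -bc1Z bx bc1_sum.
rewrite (dpair_sum _ (n i) (fun k => phi (c k)) (u i)).
rewrite (bigD1 (Ordinal ln)) //= uu' // eqxx mulr1 big1 ?addr0 // => k jk.
rewrite uu' // eq_sym; have /negPf -> : (k != (lift_start m i + j)%N :> nat) := jk.
by rewrite mulr0.
Qed.

Lemma coh_cls_cobound1 j : (j < m 0)%N -> coh_cls (a 1 (cobound_start m 1 + j)%N) = 0.
Proof.
move=> jm; apply/coh_cls_eq0; first exact: (split_cobound_cocycle (i := 0) sp jm).
by have := split_lift sp (i := 0) jm; rewrite /= scale1r => <-; eexists.
Qed.

Lemma coh_cls_cobound2 j : (j < m 1)%N ->
  alpha j *: coh_cls (a 2 (cobound_start m 2 + j)%N) = 0.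
Proof.
move=> jm; have dc := split_cobound_cocycle (i := 1) sp jm.
rewrite -coh_clsZ //; apply/coh_cls_eq0; first by rewrite linearZ /= dc scaler0.
by have := split_lift sp (i := 1) jm; rewrite /= => <-; eexists.
Qed.

Let x0 (k : nat) : bc phi (coh V 1) := bc1 phi (coh_cls (a 1 (m 0 + m 1 + k)%N)).
Let zeta (k : nat) : bc phi (coh V 2) := bc1 phi (coh_cls (a 2 (m 1 + m 2 + k)%N)).
Let y0 (k : nat) : mdual (bc phi (coh V 2)) := coh_form (u' 2 (m 1 + m 2 + k)%N).

Lemma model_coh1 c : exists b b' (d : nat -> A), phi b * b' = 1 /\
  b *: c = \sum_(k < h1) d k *: coh_cls (a 1 (m 0 + m 1 + k)%N).
Proof.
have [b [b' [d [bb' bx]]]] := model_cocycle (coh_rep_cocycle c).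
exists b, b', (fun k => d (coh_start m 1 + k)%N); split=> //.
have dB j : (j < m 0)%N -> cd V 1 (1 + 1) (a 1 (cobound_start m 1 + j)%N) = 0.
  by move=> jm; apply: (split_cobound_cocycle (i := 0) sp jm).
have dH j : (j < h1)%N -> cd V 1 (1 + 1) (a 1 (coh_start m 1 + j)%N) = 0.
  by move=> jm; apply: (split_coh_cocycle (i := 1) sp jm).
rewrite -[in LHS](coh_repK c) -coh_clsZ ?coh_rep_cocycle // bx.
rewrite coh_clsD; first last.
- exact: (submodule_comb (fun j => d (coh_start m 1 + j)%N) (submodule_cocycle V 1) dH).
- exact: (submodule_comb (fun j => d (cobound_start m 1 + j)%N) (submodule_cocycle V 1) dB).
rewrite (coh_cls_sum (fun j => d (cobound_start m 1 + j)%N) dB).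
rewrite (coh_cls_sum (fun j => d (coh_start m 1 + j)%N) dH) big1 ?add0r //.
by move=> j _; rewrite coh_cls_cobound1 ?scaler0.
Qed.

Lemma model_coh2 c : exists b b' (d : nat -> A), phi b * b' = 1 /\
  b *: c = \sum_(k < m 1) d (cobound_start m 2 + k)%N *: coh_cls (a 2 (cobound_start m 2 + k)%N)
    + \sum_(k < h2) d (m 1 + m 2 + k)%N *: coh_cls (a 2 (m 1 + m 2 + k)%N).
Proof.
have [b [b' [d [bb' bx]]]] := model_cocycle (coh_rep_cocycle c).
exists b, b', d; split=> //.
have dB j : (j < m 1)%N -> cd V 2 (2 + 1) (a 2 (cobound_start m 2 + j)%N) = 0.
  by move=> jm; apply: (split_cobound_cocycle (i := 1) sp jm).
have dH j : (j < h2)%N -> cd V 2 (2 + 1) (a 2 (coh_start m 2 + j)%N) = 0.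
  by move=> jm; apply: (split_coh_cocycle (i := 2) sp jm).
rewrite -[in LHS](coh_repK c) -coh_clsZ ?coh_rep_cocycle // bx.
rewrite coh_clsD; first last.
- exact: (submodule_comb (fun j => d (coh_start m 2 + j)%N) (submodule_cocycle V 2) dH).
- exact: (submodule_comb (fun j => d (cobound_start m 2 + j)%N) (submodule_cocycle V 2) dB).
rewrite (coh_cls_sum (fun j => d (cobound_start m 2 + j)%N) dB).
by rewrite (coh_cls_sum (fun j => d (coh_start m 2 + j)%N) dH).
Qed.

Lemma model_generates1 : generates h1 x0.
Proof. exact: bc_generates model_coh1. Qed.

(** [alpha j] kills the class of the j-th coboundary vector and has nonzero image in a domain, so
    forms on H^2 cannot see the torsion classes. *)
Lemma form_torsion (f : mdual (bc phi (coh V 2))) j : (j < m 1)%N ->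
  dpair f (bc1 phi (coh_cls (a 2 (cobound_start m 2 + j)%N))) = 0.
Proof.
move=> jm; have := congr1 (fun c => dpair f (bc1 phi c)) (coh_cls_cobound2 jm).
rewrite /= bc1Z dpairZr bc1_0 dpair0r => /R_dom/orP[|/eqP//].
by rewrite (negPf (model_alpha mo jm)).
Qed.

Lemma model_form_ext (f f' : mdual (bc phi (coh V 2))) :
  (forall k, (k < h2)%N -> dpair f (zeta k) = dpair f' (zeta k)) -> f = f'.
Proof.
move=> ff'; apply: dpair_ext; apply: (@semilin_bc_ext A R R phi idfun _ R^o);
  try exact: dpair_semilin.
move=> c; have [b [b' [d [bb' bc]]]] := model_coh2 c.
have key g : phi b * dpair g (bc1 phi c) = \sum_(k < h2) phi (d (m 1 + m 2 + k)%N) * dpair g (zeta k).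
  rewrite -dpairZr -bc1Z bc bc1D.
  rewrite (bc1_sum phi (m 1) (fun k => d (cobound_start m 2 + k)%N)
    (fun k => coh_cls (a 2 (cobound_start m 2 + k)%N))).
  rewrite (bc1_sum phi h2 (fun k => d (m 1 + m 2 + k)%N)
    (fun k => coh_cls (a 2 (m 1 + m 2 + k)%N))) dpairDr.
  rewrite (dpair_sum g (m 1) (fun k => phi (d (cobound_start m 2 + k)%N))
    (fun k => bc1 phi (coh_cls (a 2 (cobound_start m 2 + k)%N)))).
  rewrite big1 ?add0r => [|j _]; last by rewrite form_torsion ?mulr0.
  exact: (dpair_sum g h2 (fun k => phi (d (m 1 + m 2 + k)%N)) zeta).
have e : phi b * dpair f (bc1 phi c) = phi b * dpair f' (bc1 phi c).
  by rewrite !key; apply: eq_bigr => k _; rewrite ff'.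
by have := congr1 (fun z => b' * z) e; rewrite !mulrA [b' * _]mulrC bb' !mul1r.
Qed.

Let E := bcC phi V.

Lemma dual_coord_coboundary_coh i k x : (k < coh_dim h1 h2 i)%N ->
  dpair (u' i (coh_start m i + k)%N) (cd E (i - 1) i x) = 0.
Proof.
move=> kh; apply: (dual_coord_coboundary model_split_bc ub uu').
  exact: (coh_bound sp kh).
by have := coh_notin_cobound m (i - 1) k; rewrite !subrK.
Qed.

Lemma y0E k z w : (k < h2)%N -> cd E 2 (2 + 1) w = 0 -> bc_coh z = coh_cls w ->
  dpair (y0 k) z = dpair (u' 2 (m 1 + m 2 + k)%N) w.
Proof. by move=> kh; apply: coh_formE => x; apply: (@dual_coord_coboundary_coh 2). Qed.

Lemma y0_zeta k l : (k < h2)%N -> (l < h2)%N -> dpair (y0 k) (zeta l) = (k == l)%:R.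
Proof.
move=> kh lh; have dl := split_coh_cocycle (i := 2) sp lh.
rewrite (@y0E k _ (u 2 (m 1 + m 2 + l)%N)) //.
- rewrite (uu' (i := 2)) ?eqn_add2l //; first exact: (coh_bound (i := 2) sp kh).
  exact: (coh_bound (i := 2) sp lh).
- exact: bcC_cocycle.
- exact: bc_cohE.
Qed.

(** Even when H^2 has torsion its dual is spanned by the forms [y0], because a form is determined by
    its values on the classes [zeta]. *)
Lemma form_expand (f : mdual (bc phi (coh V 2))) :
  f = \sum_(k < h2) dpair f (zeta k) *: y0 k.
Proof.
apply: model_form_ext => l lh.
rewrite (dpair_suml h2 (fun k => dpair f (zeta k)) y0 (zeta l)).
rewrite -[LHS](sum_mul_delta (fun k => dpair f (zeta k)) lh).
by apply: eq_bigr => k _; rewrite (y0_zeta (ltn_ord k) lh).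
Qed.

Let s := degrees lo len.
Let value := (\prod_(k < m 1) phi (alpha k)) *: tpure (wedge h1 x0) (wedge h2 y0).

Section Compare.
Variables (v : forall i, nat -> E i) (v' : forall i, nat -> mdual (E i)) (beta : nat -> R).
Variables (x : nat -> bc phi (coh V 1)) (y' : nat -> mdual (bc phi (coh V 2))).
Hypothesis spv : split_cpx n h1 h2 m v beta.
Hypothesis vv' : forall i, dual_families (n i) (v i) (v' i).
Hypothesis beta0 : forall k, (k < m 1)%N -> beta k != 0.
Hypothesis xE : forall k, (k < h1)%N ->
  bc_coh (x k) = coh_cls (v 1 (m 0 + m 1 + k)%N).
Hypothesis y'E : forall k l z, (k < h2)%N -> (l < h2)%N ->
  bc_coh z = coh_cls (v 2 (m 1 + m 2 + l)%N) -> dpair (y' k) z = (k == l)%:R.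

(** Cohomologous cocycles have the same coordinates in the cohomology block, so the coordinates of
    the classes are the corresponding entries of the transition matrix. *)
Lemma wedge_coh1 : wedge h1 x = det_coh_part h1 h2 m v u' 1 *: wedge h1 x0.
Proof.
have dH l : (l < h1)%N -> cd E 1 (1 + 1) (u 1 (coh_start m 1 + l)%N) = 0.
  by move=> lh; apply: (split_coh_cocycle (i := 1) model_split_bc lh).
apply: wedge_ndet => k kh; have [c xc] := model_generates1 (x k).
suff cE l : (l < h1)%N -> transition v u' 1 (coh_start m 1 + k) (coh_start m 1 + l) = c l.
  by rewrite {1}xc; apply: eq_bigr => l _; rewrite cE.
move=> lh.
have dS : cd E 1 (1 + 1) (\sum_(l < h1) c l *: u 1 (coh_start m 1 + l)%N) = 0 :=
  submodule_comb c (submodule_cocycle E 1) dH.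
have e : coh_cls (v 1 (coh_start m 1 + k)%N) =
    coh_cls (\sum_(l < h1) c l *: u 1 (coh_start m 1 + l)%N).
  rewrite (coh_cls_sum c dH) -[LHS](xE kh) xc.
  rewrite (semilin_sum (phi := idfun) (@bc_coh_semilin _ _ phi V 1) h1 c x0).
  apply: eq_bigr => j _; congr (_ *: _); apply: bc_cohE.
  exact: (split_coh_cocycle (i := 1) sp (ltn_ord j)).
have dv := split_coh_cocycle (i := 1) spv kh.
have [w /(congr1 (fun z => z + \sum_(l < h1) c l *: u 1 (coh_start m 1 + l)%N))] :=
  (coh_cls_eq dv dS).1 e.
rewrite subrK => {}e; rewrite /transition [in LHS]e dpairDr.
rewrite (dual_coord_coboundary_coh (i := 1)) // add0r.
rewrite (dpair_sum (u' 1 _) h1 c (fun l => u 1 (coh_start m 1 + l)%N)).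
rewrite -[RHS](sum_mul_delta c lh); apply: eq_bigr => j _; congr (_ * _).
rewrite (uu' (i := 1)) ?eqn_add2l //; first by rewrite eq_sym.
  exact: (coh_bound (i := 1) sp lh).
exact: (coh_bound (i := 1) sp (ltn_ord j)).
Qed.

Lemma wedge_coh2 : exists d, wedge h2 y' = d *: wedge h2 y0 /\
  d * det_coh_part h1 h2 m v u' 2 = 1.
Proof.
exists (ndet h2 (fun k l => dpair (y' k) (zeta l))); split.
  by apply: wedge_ndet => k kh; apply: form_expand.
rewrite -[det_coh_part _ _ _ _ _ _]ndet_tr -ndetM -[RHS](ndet_delta _ h2).
apply: eq_ndet => k l kh lh.
set hs := coh_start m 2; set cs := cobound_start m 2.
pose g := transition v u' 2.
(* The vector of v may also involve coboundary vectors of u, whose classes can be nonzero torsion.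
   They are collected in [zB], which every form annihilates. *)
pose zB := \sum_(j < m 1) g (hs + l)%N (cs + j)%N *: bc1 phi (coh_cls (a 2 (cs + j)%N)).
pose zH := \sum_(j < h2) g (hs + l)%N (hs + j)%N *: zeta j.
have dB j : (j < m 1)%N -> cd E 2 (2 + 1) (u 2 (cs + j)%N) = 0.
  by move=> jm; apply: (split_cobound_cocycle (i := 1) model_split_bc jm).
have dH j : (j < h2)%N -> cd E 2 (2 + 1) (u 2 (hs + j)%N) = 0.
  by move=> jm; apply: (split_coh_cocycle (i := 2) model_split_bc jm).
have dB' j : (j < m 1)%N -> cd V 2 (2 + 1) (a 2 (cs + j)%N) = 0.
  by move=> jm; apply: (split_cobound_cocycle (i := 1) sp jm).
have dH' j : (j < h2)%N -> cd V 2 (2 + 1) (a 2 (hs + j)%N) = 0.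
  by move=> jm; apply: (split_coh_cocycle (i := 2) sp jm).
have zE : bc_coh (zB + zH) = coh_cls (v 2 (hs + l)%N).
  have [_ bcD _ _] := semilinearB (phi := idfun) (@bc_coh_semilin _ _ phi V 2).
  rewrite bcD (semilin_sum (phi := idfun) (@bc_coh_semilin _ _ phi V 2) (m 1)
    (fun j => g (hs + l)%N (cs + j)%N) (fun j => bc1 phi (coh_cls (a 2 (cs + j)%N)))).
  rewrite (semilin_sum (phi := idfun) (@bc_coh_semilin _ _ phi V 2) h2
    (fun j => g (hs + l)%N (hs + j)%N) zeta).
  rewrite (eq_bigr (fun j : 'I__ => g (hs + l)%N (cs + j)%N *: coh_cls (u 2 (cs + j)%N))); last first.
    by move=> j _; congr (_ *: _); apply: bc_cohE; apply: dB'.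
  rewrite [X in _ + X](eq_bigr (fun j : 'I__ => g (hs + l)%N (hs + j)%N *: coh_cls (u 2 (hs + j)%N))); last first.
    by move=> j _; congr (_ *: _); apply: bc_cohE; apply: dH'.
  rewrite -(coh_cls_sum (fun j => g (hs + l)%N (cs + j)%N) dB).
  rewrite -(coh_cls_sum (fun j => g (hs + l)%N (hs + j)%N) dH).
  rewrite -coh_clsD; first last.
  - exact: (submodule_comb (fun j => g (hs + l)%N (hs + j)%N) (submodule_cocycle E 2) dH).
  - exact: (submodule_comb (fun j => g (hs + l)%N (cs + j)%N) (submodule_cocycle E 2) dB).
  congr coh_cls; rewrite [RHS](dual_coord _ (ub 2).2 (@uu' 2)).
  rewrite (sum_blocks (fun j => g (hs + l)%N j *: u 2 j) (split_rank sp 2)).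
  rewrite [X in _ = _ + X + _]big1 ?addr0 // => j _.
  rewrite /g (transition_lift0 model_split_bc spv ub uu' R_dom (model_alpha mo)) ?scale0r //.
    exact: (coh_bound (i := 2) sp lh).
  exact: (coh_notin_lift m 2 l).
rewrite -(y'E kh lh zE) dpairDr.
rewrite (dpair_sum (y' k) (m 1) (fun j => g (hs + l)%N (cs + j)%N)
  (fun j => bc1 phi (coh_cls (a 2 (cs + j)%N)))).
rewrite (dpair_sum (y' k) h2 (fun j => g (hs + l)%N (hs + j)%N) zeta).
rewrite [X in _ = X + _]big1 ?add0r => [|j _]; last by rewrite form_torsion // mulr0.
by apply: eq_bigr => j _; rewrite mulrC.
Qed.

Lemma det_coh_indep (L : detinv E n s -> R^o) :
  (forall v v', L (detinv_gen n s v v') = \prod_(i <- s)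
    if odd `|i|%N then ndet (n i) (fun k l => dpair (u' i l) (v i k))
    else ndet (n i) (fun k l => dpair (v' i k) (u i l))) ->
  L (detinv_gen n s v v') *: value =
  (\prod_(k < m 1) beta k) *: tpure (wedge h1 x) (wedge h2 y').
Proof.
move=> LE; have [d [-> dE]] := wedge_coh2; rewrite wedge_coh1 LE.
rewrite tpureZl tpureZr /value; move: (tpure _ _) => T.
rewrite !(scalerA _ _ T); congr (_ *: T).
have := det_ratio psi_inj model_split_bc spv ub uu' vv' (model_alpha mo) beta0 n0.
move/(congr1 (fun z => z * d)); rewrite -!mulrA [det_coh_part _ _ _ _ _ _ * d]mulrC dE mulr1.
by move=> ->.
Qed.

End Compare.

(** The forced candidate sends z to its coefficient on the generator of the model times [value]. By
    [det_coh_indep] it meets the normalization for every adapted family, so [det_coh] is not the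
    default 0. *)
Lemma model_is_det_coh : is_det_coh (phi := phi) (V := V) (@det_coh A R phi V n s h1 h2).
Proof.
rewrite /det_coh; case: xgetP => // none; exfalso.
have [L [Ll LE]] := detinv_form n s u u'.
apply: (none (fun z => L z *: value)); split.
  by move=> a' z z'; rewrite Ll scalerDl -scalerA.
move=> m' v v' beta x y' [vb vr v0 vl vc] vv' xE y'E.
have i0 : n (lo - 1) = 0%N by apply: n0; rewrite degreesP; lia.
(* The competing adapted family comes with its own ranks, which must first be identified with those
   of the model. *)
have mm : m' = m by apply/funext; apply: (ranks_unique i0 vr (split_rank sp)).
rewrite {}mm in vr v0 vl vc xE y'E *.
exact: (det_coh_indep (SplitCpx vr vl vc) vv' v0 xE y'E LE).
Qed.

Lemma det_coh_model : @det_coh A R phi V n s h1 h2 (detinv_gen n s u u') = value.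
Proof.
apply: (model_is_det_coh.2 m u u' (fun k => phi (alpha k)) x0 y0) => //.
- split=> [i|i|k km|i k km|i k kn nk].
  + exact: ub.
  + exact: (split_rank sp).
  + exact: (model_alpha mo).
  + exact: (split_lift model_split_bc).
  + exact: (split_cocycle model_split_bc).
- by move=> k kh; apply: bc_cohE; apply: (split_coh_cocycle (i := 1) sp).
- move=> k l z kh lh zE; rewrite (y0E _ _ zE) //.
    rewrite (uu' (i := 2)) ?eqn_add2l //; first exact: (coh_bound (i := 2) sp kh).
    exact: (coh_bound (i := 2) sp lh).
  by apply: bcC_cocycle; apply: (split_coh_cocycle (i := 2) sp).
Qed.

End Model.

(** * The four-term isomorphism *)

Lemma dual_basis_ndet (R : comNzRingType) (M : lmodType R) n (u v : nat -> M)
    (u' v' : nat -> mdual M) : generates n u -> dual_families n u u' ->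
  dual_families n v v' ->
  ndet n (fun k l => dpair (v' k) (u l)) * ndet n (fun k l => dpair (u' l) (v k)) = 1.
Proof.
move=> gu uu' vv'; rewrite -[X in _ * X]ndet_tr -ndetM -[RHS](ndet_delta _ n).
apply: eq_ndet => k l kn ln; rewrite -(vv' k l kn ln) [in RHS](dual_coord (v l) gu uu').
rewrite (dpair_sum (v' k) n (fun j => dpair (u' j) (v l)) u).
by apply: eq_bigr => j _; rewrite mulrC.
Qed.

Section FourTermIso.
Variables (F : fieldType) (W U V X : lmodType F).
Variables (j : W -> U) (f : U -> V) (q : V -> X).
Hypotheses (jl : linear j) (fl : linear f).

Section Pair.
Variables (rho c t : nat).
Variables (u u2 : nat -> U) (v v2 : nat -> V) (u' u2' : nat -> mdual U) (v' v2' : nat -> mdual V).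
Variables (alpha alpha2 : nat -> F).
Hypotheses (ub : is_basis (rho + c) u) (vb : is_basis (rho + t) v).
Hypotheses (uu' : dual_families (rho + c) u u') (vv' : dual_families (rho + t) v v').
Hypothesis fu : forall i, (i < rho)%N -> alpha i != 0 /\ f (u i) = alpha i *: v i.
Hypothesis fu0 : forall i, (rho <= i < rho + c)%N -> f (u i) = 0.
Hypothesis fu2 : forall i, (i < rho)%N -> alpha2 i != 0 /\ f (u2 i) = alpha2 i *: v2 i.
Hypothesis fu20 : forall i, (rho <= i < rho + c)%N -> f (u2 i) = 0.

Lemma fourterm_coord x l : (l < rho + t)%N ->
  dpair (v' l) (f x) = if (l < rho)%N then dpair (u' l) x * alpha l else 0.
Proof.
move=> lb; rewrite [in LHS](dual_coord x ub.2 uu').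
rewrite (semilin_sum (phi := idfun) (semilin_id fl) (rho + c) (fun i => dpair (u' i) x) u).
rewrite (sum_cat rho c (fun i => dpair (u' i) x *: f (u i))).
rewrite [X in _ + X]big1 ?addr0; last first.
  by move=> i _; rewrite fu0 ?scaler0 // leq_addr ltn_add2l ltn_ord.
rewrite (eq_bigr (fun i : 'I_rho => (dpair (u' i) x * alpha i) *: v i)); last first.
  by move=> i _; rewrite (fu (ltn_ord i)).2 scalerA.
rewrite (dpair_sum (v' l) rho (fun i => dpair (u' i) x * alpha i) v).
case: ifP => [lr|/negbT]; last first.
  rewrite -leqNgt => lr; rewrite big1 // => i _; rewrite vv' //.
    by rewrite gtn_eqF ?mulr0 // (leq_trans _ lr).
  by rewrite (leq_trans (ltn_ord i)) ?leq_addr.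
rewrite -[RHS](sum_mul_delta (fun i => dpair (u' i) x * alpha i) lr).
apply: eq_bigr => i _; rewrite vv' 1?eq_sym //.
by rewrite (leq_trans (ltn_ord i)) ?leq_addr.
Qed.

Lemma fourterm_transition0 k l : (rho <= k < rho + c)%N -> (l < rho)%N ->
  dpair (u' l) (u2 k) = 0.
Proof.
move=> kr lr; have := @fourterm_coord (u2 k) l (ltn_addr _ lr).
rewrite fu20 // dpair0r lr => /esym/eqP; rewrite mulf_eq0 (negPf (fu lr).1) orbF.
by move/eqP.
Qed.

Lemma fourterm_transition k l : (k < rho)%N -> (l < rho + t)%N ->
  alpha2 k * dpair (v' l) (v2 k) = if (l < rho)%N then dpair (u' l) (u2 k) * alpha l else 0.
Proof. by move=> kr lb; rewrite -fourterm_coord // -dpairZr (fu2 kr).2. Qed.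

Lemma fourterm_ndetU : ndet (rho + c) (fun k l => dpair (u' l) (u2 k)) =
  ndet rho (fun k l => dpair (u' l) (u2 k)) *
  ndet c (fun k l => dpair (u' (rho + l)%N) (u2 (rho + k)%N)).
Proof. by rewrite ndet_ublock // => k l kr lr; apply: fourterm_transition0. Qed.

Lemma fourterm_ndetV : ndet (rho + t) (fun k l => dpair (v' l) (v2 k)) =
  ndet rho (fun k l => dpair (v' l) (v2 k)) *
  ndet t (fun k l => dpair (v' (rho + l)%N) (v2 (rho + k)%N)).
Proof.
rewrite ndet_lblock // => k l kr /andP[rl lb]; have := fourterm_transition kr lb.
by rewrite ltnNge rl => /eqP; rewrite mulf_eq0 (negPf (fu2 kr).1) => /eqP.
Qed.

(** Here f intertwines the blocks outside kernel and cokernel, so their determinants differ exactly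
    by the products of the coefficients. *)
Lemma fourterm_ndetUV : (\prod_(k < rho) alpha2 k) *
    ndet rho (fun k l => dpair (v' l) (v2 k)) =
  ndet rho (fun k l => dpair (u' l) (u2 k)) * \prod_(k < rho) alpha k.
Proof.
rewrite -ndet_scale_rows -ndet_scale_cols; apply: eq_ndet => k l kr lr.
by rewrite fourterm_transition ?lr // ltn_addr.
Qed.

End Pair.

Variables (rho c t : nat).
Variables (u : nat -> U) (v : nat -> V) (v' : nat -> mdual V) (alpha : nat -> F).
Variables (w : nat -> W) (x' : nat -> mdual X).
Hypotheses (ub : is_basis (rho + c) u) (vb : is_basis (rho + t) v).
Hypothesis vv' : dual_families (rho + t) v v'.
Hypothesis fu : forall i, (i < rho)%N -> alpha i != 0 /\ f (u i) = alpha i *: v i.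
Hypothesis fu0 : forall i, (rho <= i < rho + c)%N -> f (u i) = 0.
Hypothesis jw : forall i, (i < c)%N -> j (w i) = u (rho + i)%N.
Hypothesis x'q : forall i y, (i < t)%N -> dpair (x' i) (q y) = dpair (v' (rho + i)%N) y.
Hypothesis wg : generates c w.
Hypothesis xg : generates t (fun i => q (v (rho + i)%N)).

(** The candidate is the coefficient on one adapted pair of bases times [value]. A second adapted
    pair has block triangular transition matrices: the kernel and cokernel blocks account for the
    change of the wedges in the target, and the remaining blocks cancel by [fourterm_ndetUV]. *)
Lemma fourterm_isoP :
  is_fourterm_iso j f q (@fourterm_iso F W U V X j f q (rho + c) (rho + t) c t).
Proof.
rewrite /fourterm_iso; case: xgetP => // none; exfalso.
have [u' uu'] := dual_exists ub.
have [LU [LUl LUE]] := extp_form (rho + c) u'.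
have [LV [LVl LVE]] := extp_dual_form (rho + t) v.
have [L [Ll LE]] := tens_form LUl LVl.
pose value := (\prod_(i < rho) alpha i) *: tpure (wedge c w) (wedge t x').
apply: (none (fun z => L z *: value)); split.
  by move=> e z z'; rewrite Ll scalerDl -scalerA.
move=> u2 v2 v2' alpha2 w2 x2' u2b v2b v2v2' fu2 fu20 jw2 x2'q.
have rr : (rho + c - c)%N = rho by rewrite addnK.
rewrite rr in fu2 fu20 jw2 x2'q *.
have [u2' u2u2'] := dual_exists u2b.
pose dH := ndet c (fun k l => dpair (u' (rho + l)%N) (u2 (rho + k)%N)).
have wE : wedge c w2 = dH *: wedge c w.
  apply: wedge_ndet => k kc; have [e we] := wg (w2 k).
  suff eE l : (l < c)%N -> dpair (u' (rho + l)%N) (u2 (rho + k)%N) = e l.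
    by rewrite we; apply: eq_bigr => l _; rewrite eE.
  move=> lc; rewrite -jw2 // we (semilin_sum (phi := idfun) (semilin_id jl)).
  rewrite (dpair_sum _ c e (fun i => j (w i))) -[RHS](sum_mul_delta e lc).
  apply: eq_bigr => i _; rewrite jw // uu' ?ltn_add2l // eqn_add2l.
  by rewrite eq_sym.
pose h k l := dpair (v2' (rho + k)%N) (v (rho + l)%N).
have x'v i l : (i < t)%N -> (l < t)%N -> dpair (x' i) (q (v (rho + l)%N)) = (i == l)%:R.
  by move=> it lt; rewrite x'q // vv' ?ltn_add2l // eqn_add2l.
have xE : wedge t x2' = ndet t h *: wedge t x'.
  apply: wedge_ndet => k kt; apply: dpair_ext => y.
  rewrite (dpair_suml t (h k) x' y); have [e ->] := xg y.
  rewrite (dpair_sum (x2' k) t e (fun i => q (v (rho + i)%N))).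
  transitivity (\sum_(i < t) e i * h k i).
    by apply: eq_bigr => i _; rewrite x2'q.
  apply: eq_bigr => l _; rewrite mulrC; congr (_ * _).
  rewrite (dpair_sum (x' l) t e (fun i => q (v (rho + i)%N))).
  rewrite -[LHS](sum_mul_delta e (ltn_ord l)); apply: eq_bigr => i _.
  by rewrite x'v // eq_sym.
pose dH' := ndet t (fun k l => dpair (v' (rho + l)%N) (v2 (rho + k)%N)).
have hd : ndet t h * dH' = 1.
  rewrite /dH' -[X in _ * X]ndet_tr -ndetM -[RHS](ndet_delta _ t).
  apply: eq_ndet => k l kt lt.
  have := v2v2' (rho + k)%N (rho + l)%N; rewrite !ltn_add2l eqn_add2l => <- //.
  rewrite [in RHS](dual_coord (v2 (rho + l)%N) vb.2 vv').
  rewrite (dpair_sum _ (rho + t) (fun i => dpair (v' i) (v2 (rho + l)%N)) v).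
  rewrite (sum_cat rho t (fun i => dpair (v' i) (v2 (rho + l)%N) * dpair (v2' (rho + k)%N) (v i))).
  rewrite [X in _ = X + _]big1 ?add0r => [|i _].
    by apply: eq_bigr => i _; rewrite mulrC.
  have [ai fi] := fu (ltn_ord i).
  have := fourterm_coord u2b u2u2' v2v2' fu2 fu20 (u i) (l := (rho + k)%N).
  rewrite ltn_add2l kt ltnNge leq_addr => /(_ isT); rewrite fi dpairZr => /eqP.
  by rewrite mulf_eq0 (negPf ai) => /eqP ->; rewrite mulr0.
rewrite wE xE LE LUE LVE tpureZl tpureZr /value; move: (tpure _ _) => T.
rewrite !(scalerA _ _ T); congr (_ *: T).
have UV := fourterm_ndetUV ub uu' vv' fu fu0 fu2.
have inv := dual_basis_ndet vb.2 vv' v2v2'.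
rewrite (fourterm_ndetV ub uu' vv' fu fu0 fu2) -/dH' in inv.
rewrite (fourterm_ndetU ub uu' vv' fu fu0 fu20) -/dH.
set dL := ndet rho (fun k l => dpair (u' l) (u2 k)) in UV *.
set dB := ndet rho (fun k l => dpair (v' l) (v2 k)) in UV inv *.
set hf := ndet (rho + t) _ in inv *; set pa := \prod_(i < rho) alpha i in UV *.
(* The determinant of v2 in the basis v is invertible with inverse [hf]; multiplying by it turns the
   claim into a polynomial identity. *)
have nz : dB * dH' != 0 
  by apply: contra_eqN inv => /eqP e; rewrite e mulr0 eq_sym oner_eq0.
apply: (mulIf nz); transitivity (dL * pa * dH * (hf * (dB * dH'))); first by ring.
rewrite inv -UV; set pb := \prod_(i < rho) alpha2 i.
by transitivity (pb * dB * dH * (ndet t h * dH')); [rewrite hd|]; ring.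
Qed.

End FourTermIso.

(** * Splitting a complex over a discrete valuation ring *)

Section MatrixBases.
Variables (R : comNzRingType) (M : lmodType R).

Lemma extend_ord n (T : Type) (x : T) (F : 'I_n -> T) :
  exists G : nat -> T, forall i : 'I_n, G i = F i.
Proof. by exists (fun k => if insub k is Some i then F i else x) => i; rewrite valK. Qed.

Lemma span_mx n p (u v : nat -> M) : generates p v ->
  exists A : 'M[R]_(n, p), forall i : 'I_n, u i = \sum_(l < p) A i l *: v l.
Proof.
move=> gv; have [c cP] := choice gv.
exists (\matrix_(i < n, l < p) c (u i) l) => i.
by rewrite [LHS]cP; apply: eq_bigr => l _; rewrite mxE.
Qed.

Lemma indep_mx1 n p (u v : nat -> M) (A : 'M[R]_(n, p)) (B : 'M[R]_(p, n)) :
  indep n u -> (forall i : 'I_n, u i = \sum_(l < p) A i l *: v l) ->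
  (forall i : 'I_p, v i = \sum_(l < n) B i l *: u l) -> A *m B = 1%:M.
Proof.
move=> iu uA vB; apply/matrixP => i j.
have [G GP] := extend_ord 0 (fun j => (A *m B) i j).
rewrite -GP mxE eq_sym -val_eqE.
apply: (indep_eq (c := G) (c' := fun k => (k == i)%:R) iu _ (ltn_ord j)).
transitivity (u i); last first.
  by under eq_bigr do rewrite eq_sym; rewrite sum_delta.
rewrite uA; under eq_bigr do rewrite GP mxE scaler_suml.
rewrite exchange_big; apply: eq_bigr => l _; rewrite vB scaler_sumr.
by apply: eq_bigr => k _; rewrite scalerA.
Qed.

Lemma basis_size n p (u v : nat -> M) : is_basis n u -> is_basis p v -> n = p.
Proof.
move=> [iu gu] [iv gv]; have [A AP] := span_mx n u gv; have [B BP] := span_mx p v gu.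
apply/eqP; rewrite eqn_leq (mulmx1_min (indep_mx1 iu AP BP)).
exact: (mulmx1_min (indep_mx1 iv BP AP)).
Qed.

(** One-sided inverses of square matrices over a commutative ring are two-sided, so n generators of
    a free module of rank n are independent. *)
Lemma basis_of_generates n (u v : nat -> M) : is_basis n u -> generates n v -> is_basis n v.
Proof.
move=> [iu gu] gv; split=> // c c0 k kn.
have [A AP] := span_mx n u gv; have [B BP] := span_mx n v gu.
have BA := mulmx1C (indep_mx1 iu AP BP).
pose r : 'rV[R]_n := \row_i c i.
suff r0 : r = 0 by have := congr1 (fun r : 'rV_n => r 0 (Ordinal kn)) r0; rewrite !mxE.
suff rB : r *m B = 0 by rewrite -[r]mulmx1 -BA mulmxA rB mul0mx.
apply/rowP => j; have [G GP] := extend_ord 0 (fun j => (r *m B) 0 j).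
rewrite -GP mxE; apply: (iu G _ _ (ltn_ord j)); rewrite -[RHS]c0.
under eq_bigr do rewrite GP mxE scaler_suml.
rewrite exchange_big; apply: eq_bigr => l _; rewrite BP scaler_sumr.
by apply: eq_bigr => i _; rewrite scalerA mxE.
Qed.

Lemma basis_scale n (u v : nat -> M) (s s' : R) : s * s' = 1 -> is_basis n u ->
  (forall k, (k < n)%N -> v k = s *: u k) -> is_basis n v.
Proof.
move=> ss' ub vu; apply: (basis_of_generates ub) => x; have [c ->] := ub.2 x.
exists (fun k => c k * s'); apply: eq_bigr => k _.
by rewrite vu // scalerA -mulrA [s' * s]mulrC ss' mulr1.
Qed.

End MatrixBases.

(** * Smith normal form with sorted exponents *)

Section Smith.
Variables (R : comNzRingType) (t : R).
Hypothesis dvr : forall x : R, x != 0 -> exists k y y', x = t ^+ k * y /\ y * y' = 1.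

Definition smith_form m n (r : nat) (a : nat -> nat) : 'M[R]_(m, n) :=
  \matrix_(i, j) if ((i : nat) == j) && (i < r)%N then t ^+ a i else 0.

Definition mx_equiv m n (A B : 'M[R]_(m, n)) :=
  exists (L L' : 'M[R]_m) (Q Q' : 'M[R]_n),
    [/\ L *m L' = 1%:M, Q *m Q' = 1%:M & L *m A *m Q = B].

Lemma mx_equiv_trans m n (A B C : 'M[R]_(m, n)) :
  mx_equiv A B -> mx_equiv B C -> mx_equiv A C.
Proof.
move=> [L [L' [Q [Q' [LL QQ <-]]]]] [L2 [L2' [Q2 [Q2' [LL2 QQ2 <-]]]]].
exists (L2 *m L), (L' *m L2'), (Q *m Q2), (Q2' *m Q'); split.
- by rewrite mulmxA -(mulmxA L2) LL mulmx1.
- by rewrite mulmxA -(mulmxA Q) QQ2 mulmx1.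
- by rewrite !mulmxA.
Qed.

Lemma mx_equiv_scale m n (A B : 'M[R]_(m, n)) a : mx_equiv A B -> mx_equiv (a *: A) (a *: B).
Proof.
move=> [L [L' [Q [Q' [LL QQ <-]]]]]; exists L, L', Q, Q'; split=> //.
by rewrite -scalemxAr -scalemxAl.
Qed.

Lemma mx_equiv_pivot m n (A : 'M[R]_(1 + m, 1 + n)) i j y : A i j * y = 1 ->
  exists E : 'M[R]_(m, n), mx_equiv A (block_mx 1%:M 0 0 E).
Proof.
move=> Ay; pose A1 := xrow i 0 (xcol j 0 A).
have e1 : mx_equiv A A1.
  have tt k (a b : 'I_k) : tperm_mx a b *m tperm_mx a b = 1%:M :> 'M[R]_k.
    by rewrite -perm_mxM tperm2 perm_mx1.
  exists (tperm_mx i 0), (tperm_mx i 0), (tperm_mx j 0), (tperm_mx j 0); split=> //.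
  by rewrite /A1 xrowE xcolE mulmxA.
have A1y : A1 0 0 * y = 1 by rewrite !mxE !tpermR.
pose b := ursubmx A1; pose c := dlsubmx A1; pose D := drsubmx A1.
have A1E : A1 = block_mx (A1 0 0)%:M b c D.
  rewrite -[LHS]submxK; congr block_mx; apply/matrixP => k l.
  rewrite !ord1 [RHS]mxE eqxx [LHS]mxE [LHS]mxE.
  have -> : lshift n 0 = 0 :> 'I_(1 + n) by apply/val_inj.
  by have -> : lshift m 0 = 0 :> 'I_(1 + m) by apply/val_inj.
move: A1y A1E; move: (A1 0 0) => x xy A1E.
exists (D - y *: (c *m b)); apply: mx_equiv_trans e1 _; rewrite A1E.
exists (block_mx y%:M 0 (- (y *: c)) 1%:M), (block_mx x%:M 0 c 1%:M).
exists (block_mx 1%:M (- (y *: b)) 0 1%:M), (block_mx 1%:M (y *: b) 0 1%:M); split.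
- rewrite mulmx_block !mulmx0 !mul0mx !mulmx1 !mul1mx !addr0 add0r.
  rewrite mul_scalar_mx mul_mx_scalar scale_scalar_mx mulrC xy scalerN scalerA.
  by rewrite xy scale1r addNr -scalar_mx_block.
- rewrite mulmx_block !mulmx0 !mul0mx !mulmx1 !mul1mx !addr0 !add0r subrr.
  by rewrite -scalar_mx_block.
rewrite !mulmx_block !(mul0mx, mulmx0, mulmx1, mul1mx, addr0, add0r).
rewrite !(mul_scalar_mx, mul_mx_scalar) scale_scalar_mx (mulrC y) xy !scalerN scalerA.
rewrite xy scale1r mul1mx !addNr mul0mx add0r; congr block_mx.
by rewrite mulNmx -scalemxAl addrC.
Qed.

(** An entry of least exponent divides all the others; after extracting that power of t it becomes a
    unit, ready to serve as pivot. *)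
Lemma mx_pivot m n (A : 'M[R]_(m, n)) : A != 0 -> exists k (B : 'M[R]_(m, n)) i j y,
  A = t ^+ k *: B /\ B i j * y = 1.
Proof.
move=> A0.
have /choice[k kP] : forall ij : 'I_m * 'I_n, exists k, A ij.1 ij.2 != 0 ->
    exists y y', A ij.1 ij.2 = t ^+ k * y /\ y * y' = 1.
  move=> ij; have [->|/dvr[k [y [y' h]]]] := eqVneq (A ij.1 ij.2) 0.
    by exists 0%N.
  by exists k => _; exists y, y'.
have [ij0 ijA] : exists ij : 'I_m * 'I_n, A ij.1 ij.2 != 0.
  apply/existsP; apply: contraNT A0; rewrite negb_exists => /forallP h.
  by apply/eqP/matrixP => i j; rewrite mxE; apply/eqP; have := h (i, j); rewrite negbK.
case: (@arg_minnP _ ij0 (fun ij => A ij.1 ij.2 != 0) k ijA) => -[i j] /= Aij kmin.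
have /choice[f fP] : forall ij : 'I_m * 'I_n, exists y,
    A ij.1 ij.2 = t ^+ k (i, j) * y.
  move=> ij; have [->|h] := eqVneq (A ij.1 ij.2) 0; first by exists 0; rewrite mulr0.
  have [y [_ [-> _]]] := kP _ h; exists (t ^+ (k ij - k (i, j)) * y).
  by rewrite mulrA -exprD subnKC // kmin.
have [y [y' [Ay yy']]] := kP (i, j) Aij.
exists (k (i, j)), (\matrix_(i', j') if (i', j') == (i, j) then y else f (i', j')), i, j, y'.
split; last by rewrite mxE eqxx.
apply/matrixP => i' j'; rewrite !mxE; case: eqP => [[-> ->] //|_].
exact: fP (i', j').
Qed.

(** The power t^k common to all entries is extracted before the pivot is cleared, so every later
    exponent is k plus one of the smaller block; this is what keeps them sorted. *)
Lemma smith_mx m n (A : 'M[R]_(m, n)) : exists r a,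
  [/\ mx_equiv A (smith_form m n r a), (r <= m)%N, (r <= n)%N &
      forall k l, (k <= l)%N -> (l < r)%N -> (a k <= a l)%N].
Proof.
have z m' n' (B : 'M[R]_(m', n')) : B = 0 -> exists r a,
    [/\ mx_equiv B (smith_form m' n' r a), (r <= m')%N, (r <= n')%N &
      forall k l, (k <= l)%N -> (l < r)%N -> (a k <= a l)%N].
  move=> ->; exists 0%N, (fun=> 0%N); split=> //.
  exists 1%:M, 1%:M, 1%:M, 1%:M; rewrite !mulmx1 mulmx0; split=> //.
  by apply/matrixP => i j; rewrite !mxE andbF.
elim: m n A => [|m IH] [|n] A.
- by apply: z; apply/matrixP => -[].
- by apply: z; apply/matrixP => -[].
- by apply: z; apply/matrixP => i [].
have [/z//|A0] := eqVneq A 0.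
have [k [B [i [j [y [-> By]]]]]] := mx_pivot A0.
have [E BE] := @mx_equiv_pivot m n B i j y By.
have [r [a [[L [L' [Q [Q' [LL QQ LQ]]]]] rm rn am]]] := IH n E.
exists r.+1, (fun i => if i is i'.+1 then k + a i' else k)%N; split=> //; last first.
  by case=> [|k'] [|l] //= kl lr; rewrite ?leq_addr // leq_add2l am.
apply: mx_equiv_trans (mx_equiv_scale (t ^+ k) BE) _.
exists (block_mx 1%:M 0 0 L), (block_mx 1%:M 0 0 L').
exists (block_mx 1%:M 0 0 Q), (block_mx 1%:M 0 0 Q'); split.
- by rewrite mulmx_block !mulmx0 !mul0mx !mul1mx !addr0 !add0r LL -scalar_mx_block.
- by rewrite mulmx_block !mulmx0 !mul0mx !mul1mx !addr0 !add0r QQ -scalar_mx_block.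
rewrite -scalemxAr -scalemxAl !mulmx_block !mulmx0 !mul0mx !mul1mx !addr0 !add0r !mul0mx LQ.
apply/matrixP => i' j'; rewrite !mxE.
case: splitP => p ip; rewrite mxE; case: splitP => q jq; rewrite !mxE ip jq ?ord1 /=.
- by rewrite big_ord1 !mxE eqxx !mulr1.
- by rewrite mulr0.
- by rewrite mulr0.
- by rewrite !add1n eqSS ltnS exprD; case: ifP; rewrite ?mulr0.
Qed.

Lemma smith_linear (U V : lmodType R) (f : U -> V) n p (u : nat -> U) (v : nat -> V) :
  linear f -> is_basis n u -> is_basis p v -> exists u2 v2 r (a : nat -> nat),
  is_basis n u2 /\ is_basis p v2 /\
  [/\ (r <= n)%N, (r <= p)%N,
     forall k, (k < r)%N -> f (u2 k) = t ^+ a k *: v2 k,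
     forall k, (r <= k < n)%N -> f (u2 k) = 0 &
     forall k l, (k <= l)%N -> (l < r)%N -> (a k <= a l)%N].
Proof.
move=> /semilin_id fl ub vb; have [A AP] := span_mx n (fun k => f (u k)) vb.2.
have [r [a [[L [L' [Q [Q' [LL QQ LAQ]]]]] rn rp am]]] := smith_mx A.
have [u2 u2P] := extend_ord 0 (fun i : 'I_n => \sum_(l < n) L i l *: u l).
(* The images of the new source vectors have matrix L A, and A is A Q Q', so the target basis is
   changed by [Q'] and not by [Q]. *)
have [v2 v2P] := extend_ord 0 (fun i : 'I_p => \sum_(l < p) Q' i l *: v l).
have inv_gen (W : lmodType R) q (w w2 : nat -> W) (X Y : 'M[R]_q) : is_basis q w ->
    X *m Y = 1%:M -> (forall i : 'I_q, w2 i = \sum_(l < q) X i l *: w l) -> is_basis q w2.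
  move=> wb /mulmx1C YX w2P; apply: (basis_of_generates wb) => x; have [c ->] := wb.2 x.
  have [G GP] := extend_ord 0 (fun l : 'I_q => \sum_(k < q) c k * Y k l).
  exists G; under [RHS]eq_bigr do rewrite GP w2P scaler_suml.
  rewrite exchange_big; apply: eq_bigr => k _ /=.
  under eq_bigr do rewrite -scalerA.
  rewrite -scaler_sumr; congr (_ *: _).
  under eq_bigr do rewrite scaler_sumr; rewrite exchange_big /=.
  transitivity (\sum_(j < q) (1%:M k j : R) *: w j).
    rewrite (bigD1 k) //= mxE eqxx scale1r big1 ?addr0 // => j jk.
    by rewrite mxE eq_sym (negPf jk) scale0r.
  rewrite -YX; apply: eq_bigr => j _; rewrite mxE scaler_suml.
  by apply: eq_bigr => i _; rewrite scalerA.
have fu2 k : f (u2 (k : 'I_n)) = \sum_(j < p) smith_form n p r a k j *: v2 j.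
  have -> : smith_form n p r a = L *m A *m Q by rewrite LAQ.
  transitivity (\sum_(l < n) L k l *: f (u l)).
    have [G GP] := extend_ord 0 (fun l : 'I_n => L k l).
    rewrite u2P; have := semilin_sum (phi := idfun) fl n G u.
    by under eq_bigr do rewrite GP; under [X in _ = X]eq_bigr do rewrite /= GP.
  have AQ : A = A *m Q *m Q' by rewrite -mulmxA QQ mulmx1.
  under eq_bigr do rewrite AP scaler_sumr.
  rewrite exchange_big /=; under [RHS]eq_bigr do rewrite v2P scaler_sumr.
  rewrite [RHS]exchange_big /=; apply: eq_bigr => l _.
  under eq_bigr do rewrite scalerA; under [RHS]eq_bigr do rewrite scalerA.
  rewrite -!scaler_suml; congr (_ *: _).
  transitivity ((L *m A *m Q *m Q') k l); last by rewrite mxE.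
  by rewrite -!mulmxA QQ mulmx1 mxE.
exists u2, v2, r, a; split; first exact: inv_gen ub LL u2P.
split; first exact: inv_gen vb (mulmx1C QQ) v2P.
split=> // [k kr|k /andP[rk kn]].
  have kn := leq_trans kr rn; have kp := leq_trans kr rp.
  rewrite (fu2 (Ordinal kn)) (bigD1 (Ordinal kp)) //= mxE /= eqxx kr big1 ?addr0 // => j jk.
  by rewrite mxE /= eq_sym; have /negPf -> : (j != k :> nat) := jk; rewrite scale0r.
rewrite (fu2 (Ordinal kn)) big1 // => j _.
by rewrite mxE /= ltnNge rk andbF scale0r.
Qed.

End Smith.

(** * Localization at the ideal I *)

Section SeriesVariable.
Variable O : idomainType.
Local Notation Lambda := (series O).

Definition tX : Lambda := fun i => (i == 1%N)%:R.

Lemma series_tX (s : Lambda) i : (tX * s) i = if i is j.+1 then s j else 0.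
Proof.
rewrite [in LHS]/GRing.mul /= /series_mul; case: i => [|i].
  by rewrite big_ord1 mul0r.
rewrite big_ord_recl mul0r add0r big_ord_recl mul1r big1 ?addr0; last first.
  by move=> j _; rewrite mul0r.
by congr (s _); rewrite /= subSS subn0.
Qed.

Lemma series_tXn k (s : Lambda) i :
  (tX ^+ k * s) i = if (i < k)%N then 0 else s (i - k)%N.
Proof.
elim: k s i => [|k IH] s i; first by rewrite expr0 mul1r subn0.
by rewrite exprS -mulrA series_tX; case: i => [//|i]; rewrite IH ltnS subSS.
Qed.

Lemma series_tXn0 k : (tX ^+ k : Lambda) 0%N = (k == 0%N)%:R.
Proof. by rewrite -[tX ^+ k]mulr1 series_tXn; case: k. Qed.

Lemma Ipow_tXnM k (s : Lambda) : Ipow k (tX ^+ k * s).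
Proof. by move=> i ik; rewrite series_tXn ik. Qed.

Lemma Ipow_tXn k (a : Lambda) : Ipow k a -> exists a', a = tX ^+ k * a'.
Proof.
move=> Ia; exists (fun i => a (i + k)%N); apply/funext => i; rewrite series_tXn.
by case: ltnP => ik; [rewrite Ia|rewrite subnK].
Qed.

Lemma tXn_neq0 k : tX ^+ k != 0 :> Lambda.
Proof.
apply/eqP => /(congr1 (fun s : Lambda => s k)); rewrite -[tX ^+ k]mulr1.
by rewrite series_tXn ltnn subnn => /eqP; rewrite -[_ == _]/(1 == 0 :> O) oner_eq0.
Qed.

Lemma Ipow1 (a : Lambda) : Ipow 1 a <-> a 0%N = 0.
Proof. by split=> [->//|a0 [|//]]. Qed.

Lemma series0_1 : (1 : Lambda) 0%N = 1. Proof. by []. Qed.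

Lemma series0B (a b : Lambda) : (a - b) 0%N = a 0%N - b 0%N. Proof. by []. Qed.

Lemma series0M (a b : Lambda) : (a * b) 0%N = a 0%N * b 0%N.
Proof. exact: (rmorphM (@ev0 O)). Qed.

Lemma series_factor (a : Lambda) : a != 0 -> exists k a', a = tX ^+ k * a' /\ ~ Ipow 1 a'.
Proof.
move=> a0; have ex : exists n, a n != 0.
  apply: contrapT => h; move/eqP: a0; apply; apply/funext => n.
  by apply/eqP/negPn/negP => cn; apply: h; exists n.
case: (ex_minnP ex) => k ak kmin.
have Ik : Ipow k a.
  by move=> i ik; apply/eqP/negPn/negP => /kmin; rewrite leqNgt ik.
have [a' e] := Ipow_tXn Ik; exists k, a'; split=> // /Ipow1 a'0.
by move: ak; rewrite e series_tXn ltnn subnn a'0 eqxx.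
Qed.

(** A named copy of [val] that carries a ring morphism structure; it is the embedding into a field
    required where inverses are used over Lambda_I. *)
Definition locI_frac : locI O -> {fraction Lambda} := val.
HB.instance Definition _ := GRing.RMorphism.on locI_frac.

Lemma locI_frac_inj : injective locI_frac. Proof. exact: val_inj. Qed.

Lemma locI_frac_to (a : Lambda) : locI_frac (to_locI a) = tofrac a. Proof. by []. Qed.

Lemma to_locI_inj : injective (@to_locI O).
Proof. by move=> a b /(congr1 locI_frac)/eqP; rewrite !locI_frac_to tofrac_eq => /eqP. Qed.

Lemma locI_denom (x : locI O) : exists a b, ~ Ipow 1 b /\ to_locI b * x = to_locI a.
Proof.
have /asboolP[a [b [Ib xab]]] := locI_valP x; exists a, b; split=> //.
apply: locI_frac_inj; transitivity (tofrac b * locI_val x); first exact: rmorphM.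
by rewrite xab mulrC divfK // notI_neq0.
Qed.

Lemma locI_unit (b : Lambda) : ~ Ipow 1 b -> exists b', to_locI b * b' = 1.
Proof.
move=> Ib; have inv : (tofrac b)^-1 \in @locI_pred O.
  by apply/asboolP; exists 1, b; split; rewrite // tofrac1 div1r.
exists (LocI inv); apply: locI_frac_inj; transitivity (tofrac b * (tofrac b)^-1); first exact: rmorphM.
by rewrite divff ?rmorph1 // notI_neq0.
Qed.

Lemma to_locI_unit (b : Lambda) b' : to_locI b * b' = 1 -> ~ Ipow 1 b.
Proof.
have [a [c [Ic cb]]] := locI_denom b' => bb' /Ipow1 b0; apply: Ic; apply/Ipow1.
have /to_locI_inj -> : to_locI c = to_locI (b * a).
  by rewrite rmorphM /= -cb mulrCA bb' mulr1.
by rewrite series0M b0 mul0r.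
Qed.

Lemma locI_dvr (x : locI O) : x != 0 -> exists k y y',
  x = to_locI tX ^+ k * y /\ y * y' = 1.
Proof.
move=> x0; have [a [b [Ib bx]]] := locI_denom x; have [b' bb'] := locI_unit Ib.
have a0 : a != 0.
  apply: contraNneq x0 => a0; rewrite -[x]mul1r -bb' mulrAC bx a0.
  by rewrite rmorph0 mul0r.
have [k [a1 [ak Ia]]] := series_factor a0; have [a1' aa] := locI_unit Ia.
exists k, (to_locI a1 * b'), (a1' * to_locI b); split.
  by rewrite -[LHS]mul1r -bb' mulrAC bx ak rmorphM rmorphXn mulrA.
by rewrite mulrACA aa mul1r mulrC.
Qed.

Lemma locI_tXn_unit k y : to_locI tX ^+ k * y = 1 -> k = 0%N.
Proof.
rewrite -rmorphXn => /to_locI_unit h; case: k h => // k; case.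
by apply/Ipow1; rewrite series_tXn0.
Qed.

End SeriesVariable.

Section Evaluation.
Variables (O : idomainType) (K : fieldType) (io : {rmorphism O -> K}).

(** The proof that [io] is injective is a parameter, so that the ring morphism structure established
    from it can be attached to [evI]. *)
Definition evR (io_inj : injective io) : locI O -> K := evI io.

Variable io_inj : injective io.
Local Notation ev := (evR io_inj).

Lemma evR_frac x (a b : series O) : ~ Ipow 1 b -> to_locI b * x = to_locI a ->
  ev x = io (a 0%N) / io (b 0%N).
Proof.
move=> Ib bx; apply: evIE => //.
have <- : tofrac b * locI_val x = tofrac a.
  by rewrite -[RHS](congr1 (@locI_frac O) bx); symmetry; apply: rmorphM.
by rewrite mulrC mulKf // notI_neq0.
Qed.

Lemma evR_to (a : series O) : ev (to_locI a) = io (a 0%N).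
Proof.
have e : to_locI 1 * to_locI a = to_locI a by rewrite -rmorphM mul1r.
by have := evR_frac (@notI1 O) e; rewrite series0_1 rmorph1 divr1.
Qed.

Lemma io_neq0 (b : series O) : ~ Ipow 1 b -> io (b 0%N) != 0.
Proof. by move=> /notI; rewrite -(inj_eq io_inj) rmorph0. Qed.

Lemma evR_zmod : zmod_morphism ev.
Proof.
move=> x y; have [a [b [Ib bx]]] := locI_denom x; have [c [d [Id dy]]] := locI_denom y.
rewrite (evR_frac Ib bx) (evR_frac Id dy) (evR_frac (notIM Ib Id) (a := d * a - b * c)).
  rewrite series0B !series0M rmorphB !rmorphM; field.
  by rewrite !io_neq0.
by rewrite rmorphB !rmorphM /= -bx -dy; ring.
Qed.

Lemma evR_monoid : monoid_morphism ev.
Proof.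
split=> [|x y]; first by rewrite -(rmorph1 (@to_locI O)) evR_to
    series0_1 rmorph1.
have [a [b [Ib bx]]] := locI_denom x; have [c [d [Id dy]]] := locI_denom y.
rewrite (evR_frac Ib bx) (evR_frac Id dy) (evR_frac (notIM Ib Id) (a := a * c)).
  by rewrite !series0M !rmorphM; field; rewrite !io_neq0.
by rewrite !rmorphM /= -bx -dy; ring.
Qed.

HB.instance Definition _ := GRing.isZmodMorphism.Build _ _ ev evR_zmod.
HB.instance Definition _ := GRing.isMonoidMorphism.Build _ _ ev evR_monoid.

End Evaluation.

Lemma cobound_reindex (R : comNzRingType) (E : cpx R) (i : int) (x : E (i + 1)) :
  (exists w, x = cd E (i + 1 - 1) (i + 1) w) -> exists w, x = cd E i (i + 1) w.
Proof.
suff gen j (e : j = i) (w : E j) : x = cd E j (i + 1) w -> exists w, x = cd E i (i + 1) w.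
  by case=> w; apply: gen; rewrite addrK.
by case: i / e x w => x w ->; exists w.
Qed.

Lemma indep_cat (R : comNzRingType) (M : lmodType R) a b (u : nat -> M) (c d : nat -> R) :
  indep (a + b) u ->
  \sum_(k < a) c k *: u k + \sum_(k < b) d k *: u (a + k)%N = 0 ->
  (forall k, (k < a)%N -> c k = 0) /\ (forall k, (k < b)%N -> d k = 0).
Proof.
move=> iu cd0; pose e k := if (k < a)%N then c k else d (k - a)%N.
have e0 : \sum_(k < a + b) e k *: u k = 0.
  rewrite (sum_cat a b (fun k => e k *: u k)) -[RHS]cd0; congr (_ + _).
    by apply: eq_bigr => k _; rewrite /e ltn_ord.
  by apply: eq_bigr => k _; rewrite /e ltnNge leq_addr addKn.
split=> k kn; first by have := iu e e0 k (ltn_addr b kn); rewrite /e kn.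
have := iu e e0 (a + k)%N; rewrite ltn_add2l /e => /(_ kn).
by rewrite ltnNge leq_addr addKn.
Qed.

(** * Adapted bases over a discrete valuation ring *)

Section SplitOverDVR.
Variables (R : comNzRingType) (t : R).
Hypothesis dvr : forall x : R, x != 0 -> exists k y y', x = t ^+ k * y /\ y * y' = 1.
Hypothesis t0 : t != 0.
Hypothesis t_unit : forall k y, t ^+ k * y = 1 -> k = 0%N.
Hypothesis R_dom : GRing.integral_domain_axiom R.
Variables (E : cpx R) (n : int -> nat).
Hypothesis Eb : forall i, exists u : nat -> E i, is_basis (n i) u.

Lemma t_neq0 k : t ^+ k != 0.
Proof.
elim: k => [|k IH]; first by rewrite expr0 oner_neq0.
by rewrite exprS; apply/eqP => /R_dom; rewrite (negPf t0) (negPf IH).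
Qed.

(** In a Smith form of the differential the source vectors beyond the rank span the kernel, since
    the powers of t in front of the others are not zero divisors. *)
Lemma cocycles_basis i : exists p (z : nat -> cocycles E i), is_basis p z.
Proof.
have [u ub] := Eb i; have [v vb] := Eb (i + 1).
have fl : linear (cd E i (i + 1)) by move=> a x y; rewrite linearP.
have [u2 [v2 [r [a [u2b [v2b [rn rp fu fu0 _]]]]]]] := smith_linear dvr fl ub vb.
have nr : n i = (r + (n i - r))%N by rewrite subnKC.
have sub := submodule_cocycle E i.
have zE k : (k < n i - r)%N ->
    mval (insub0 [set x | cd E i (i + 1) x = 0] (u2 (r + k)%N)) = u2 (r + k)%N.
  by move=> kr; apply: insub0_val => //=; apply: fu0; rewrite leq_addr nr ltn_add2l.
have fu0' k : (k < n i - r)%N -> cd E i (i + 1) (u2 (r + k)%N) = 0.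
  by move=> kr; apply: fu0; rewrite leq_addr nr ltn_add2l.
exists (n i - r)%N, (fun k => insub0 _ (u2 (r + k)%N)).
have ml : linear (@mval _ _ [set x | cd E i (i + 1) x = 0]) by [].
have ms := semilin_sum (phi := idfun) (semilin_id ml).
split=> [c c0 k kr|x].
  have := congr1 (@mval _ _ _) c0.
  rewrite (ms (n i - r)%N c (fun k => insub0 _ (u2 (r + k)%N))) => h.
  have [||_ ->] // := @indep_cat _ _ r (n i - r) u2 (fun=> 0) c.
    by rewrite -nr; exact: u2b.1.
  rewrite big1 ?add0r => [|j _]; last by rewrite scale0r.
  by rewrite -[RHS]h; apply: eq_bigr => j _; rewrite /= zE.
have dx : cd E i (i + 1) (mval x) = 0 := mval_in x sub.
have [c xc] := u2b.2 (mval x); exists (fun k => c (r + k)%N).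
apply/val_inj; rewrite [RHS](ms (n i - r)%N (fun k => c (r + k)%N) (fun k => insub0 _ (u2 (r + k)%N))).
rewrite [LHS]xc [in LHS]nr (sum_cat r (n i - r) (fun i0 => c i0 *: u2 i0)) big1 ?add0r; last first.
  have f0 : \sum_(k < r) (c k * t ^+ a k) *: v2 k = 0.
    rewrite -[RHS]dx xc nr (sum_cat r (n i - r) (fun i0 => c i0 *: u2 i0)) linearD.
    rewrite [X in _ = _ + X]linear_sum [X in _ = _ + X]big1 ?addr0; last first.
      by move=> k _; rewrite linearZ /= fu0' ?scaler0.
    by rewrite linear_sum; apply: eq_bigr => k _; rewrite linearZ /= fu // scalerA.
  move=> k _; suff -> : c k = 0 by rewrite scale0r.
  have pr : (n (i + 1) = r + (n (i + 1) - r))%N by rewrite subnKC.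
  have [||/(_ k (ltn_ord k)) h _] := @indep_cat _ _ r (n (i + 1) - r) v2
      (fun k => c k * t ^+ a k) (fun=> 0).
  - by rewrite -pr; exact: v2b.1.
  - by rewrite f0 add0r big1 // => j _; rewrite scale0r.
  by have /R_dom/orP[/eqP//|] := h; rewrite (negPf (t_neq0 _)).
by apply: eq_bigr => j _; rewrite zE.
Qed.

Definition cocycle_basis i p (z : nat -> E i) :=
  [/\ forall k, cd E i (i + 1) (z k) = 0, indep p z &
      forall x, cd E i (i + 1) x = 0 -> exists c : nat -> R, x = \sum_(k < p) c k *: z k].

(** The Smith form is taken for the differential with values in the free module of cocycles of
    degree i + 1. The target basis then consists of cocycles and can be used again when the basis of
    the next degree is assembled. *)
Lemma split_data i : exists (lam : nat -> E i) (z : nat -> E (i + 1)) m p (a : nat -> nat),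
  is_basis (n i) lam /\ cocycle_basis p z /\
  [/\ (m <= n i)%N, (m <= p)%N,
     forall k, (k < m)%N -> cd E i (i + 1) (lam k) = t ^+ a k *: z k,
     forall k, (m <= k < n i)%N -> cd E i (i + 1) (lam k) = 0 &
     forall k l, (k <= l)%N -> (l < m)%N -> (a k <= a l)%N].
Proof.
have [u ub] := Eb i; have [p [z zb]] := cocycles_basis (i + 1).
have sub := submodule_cocycle E (i + 1).
pose f x : cocycles E (i + 1) := insub0 _ (cd E i (i + 1) x).
have fE x : mval (f x) = cd E i (i + 1) x.
  by apply: insub0_val => //=; apply: cd_comp.
have fl : linear f.
  by move=> a x y; apply/val_inj; rewrite [LHS]fE linearP -!fE.
have [lam [z2 [m [a [lb [z2b [mn mp fm fm0 am]]]]]]] := smith_linear dvr fl ub zb.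
have ml : linear (@mval _ _ [set x | cd E (i + 1) (i + 1 + 1) x = 0]) by [].
have ms := semilin_sum (phi := idfun) (semilin_id ml).
exists lam, (fun k => mval (z2 k)), m, p, a; split=> //; split; split=> //.
- by move=> k; apply: (mval_in (z2 k) sub).
- by move=> c c0; apply: z2b.1; apply/val_inj; rewrite [LHS](ms p c z2).
- move=> x dx; have [c xc] := z2b.2 (insub0 _ x); exists c.
  by rewrite -(ms p c z2) -xc insub0_val.
- by move=> k km; rewrite -fE fm.
- by move=> k km; rewrite -fE fm0.
Qed.

(** Bundles these data so that a single choice provides them in all degrees at once. *)
Record split_datum i := SplitDatum {
  sd_lift : nat -> E i; sd_cocycle : nat -> E (i + 1); sd_rank : nat; sd_size : nat;
  sd_exp : nat -> nat;
  sd_prop : is_basis (n i) sd_lift /\ cocycle_basis sd_size sd_cocycle /\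
    [/\ (sd_rank <= n i)%N, (sd_rank <= sd_size)%N,
      forall k, (k < sd_rank)%N -> cd E i (i + 1) (sd_lift k) = t ^+ sd_exp k *: sd_cocycle k,
      forall k, (sd_rank <= k < n i)%N -> cd E i (i + 1) (sd_lift k) = 0 &
      forall k l, (k <= l)%N -> (l < sd_rank)%N -> (sd_exp k <= sd_exp l)%N] }.

Lemma split_datum_exists i : exists _ : split_datum i, True.
Proof.
by have [lam [z [m [p [a h]]]]] := split_data i; exists (SplitDatum h).
Qed.

Hypothesis E_acyclic : forall i, i != 1 -> i != 2 -> acyclic_at E i.
Hypothesis E_free : exists (b : nat) (x : nat -> coh E 1), is_basis b x.

Section Arrangement.
Variables (lam : forall i, nat -> E i) (z : forall i, nat -> E (i + 1)).
Variables (m q : int -> nat) (a : int -> nat -> nat).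
Arguments lam : clear implicits.
Arguments z : clear implicits.
Hypothesis H : forall i, is_basis (n i) (lam i) /\ cocycle_basis (q i) (z i) /\
  [/\ (m i <= n i)%N, (m i <= q i)%N,
    forall k, (k < m i)%N -> cd E i (i + 1) (lam i k) = t ^+ a i k *: z i k,
    forall k, (m i <= k < n i)%N -> cd E i (i + 1) (lam i k) = 0 &
    forall k l, (k <= l)%N -> (l < m i)%N -> (a i k <= a i l)%N].

(** The data of degree i - 1 yield cocycles in degree [i - 1 + 1]; the transport places them in
    degree i. *)
Definition zc i : nat -> E i := eq_rect (i - 1 + 1) (fun j => nat -> E j) (z (i - 1)) i (subrK 1 i).
Let p i := q (i - 1).

Lemma zcS i : zc (i + 1) = z i.
Proof.
rewrite /zc; move: (subrK 1 (i + 1)); move: (i + 1 - 1) (addrK 1 i) => j ji.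
by subst j => e; rewrite (eq_irrelevance e erefl).
Qed.

Lemma zcP i : cocycle_basis (p i) (@zc i).
Proof.
rewrite /p; suff gen j (e : j + 1 = i) : cocycle_basis (q j)
    (eq_rect (j + 1) (fun j => nat -> E j) (z j) i e) by exact: gen.
by case: i / e; have [_ []] := H j.
Qed.

(** The differential is injective on the span of the first m i vectors [lam], so this span meets the
    cocycles trivially; the other vectors [lam] are themselves cocycles. *)
Lemma lift_basis i : is_basis (m i + p i) (fun k => if (k < m i)%N then lam i k else zc i (k - m i)).
Proof.
have [lb [[_ iz _] [mn mq dl dl0 _]]] := H i; have [dz izc gzc] := zcP i.
split=> [c|x].
  rewrite (sum_cat (m i) (p i) (fun k => c k *: (if (k < m i)%N then lam i k else zc i (k - m i)))).
  rewrite (eq_bigr (fun k : 'I_(m i) => c k *: lam i k)); last by move=> k _; rewrite ltn_ord.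
  rewrite [X in _ + X](eq_bigr (fun k : 'I_(p i) => c (m i + k)%N *: zc i k)); last first.
    by move=> k _; rewrite ltnNge leq_addr addKn.
  move=> c0; have d0 : \sum_(k < m i) (c k * t ^+ a i k) *: z i k = 0.
    have := congr1 (cd E i (i + 1)) c0; rewrite linearD !linear_sum linear0.
    rewrite [X in _ + X = _]big1 ?addr0 => [|k _]; last by rewrite linearZ /= dz scaler0.
    by move=> e; rewrite -[RHS]e; apply: eq_bigr => k _; rewrite linearZ /= dl // scalerA.
  have cl k : (k < m i)%N -> c k = 0.
    move=> km; have qm : (q i = m i + (q i - m i))%N by rewrite subnKC.
    have [||/(_ k km) h _] := @indep_cat _ _ (m i) (q i - m i) (z i)
      (fun k => c k * t ^+ a i k) (fun=> 0).
    - by rewrite -qm.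
    - by rewrite d0 add0r big1 // => j _; rewrite scale0r.
    by have /R_dom/orP[/eqP//|] := h; rewrite (negPf (t_neq0 _)).
  rewrite big1 ?add0r in c0; last by move=> k _; rewrite cl ?scale0r.
  move=> k; case: (ltnP k (m i)) => [/cl //|mk kp]; rewrite -(subnKC mk).
  by apply: (izc (fun k => c (m i + k)%N) c0); rewrite -(ltn_add2l (m i)) subnKC.
have [c xc] := lb.2 x; have nm : (n i = m i + (n i - m i))%N by rewrite subnKC.
have [d yd] : exists d : nat -> R, \sum_(k < n i - m i) c (m i + k)%N *: lam i (m i + k)%N =
    \sum_(k < p i) d k *: zc i k.
  apply: gzc; rewrite linear_sum big1 // => k _; rewrite linearZ /= dl0 ?scaler0 //.
  by rewrite leq_addr -ltn_subRL ltn_ord.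
exists (fun k => if (k < m i)%N then c k else d (k - m i)%N).
rewrite (sum_cat (m i) (p i) (fun k => (if (k < m i)%N then c k else d (k - m i)%N) *:
  (if (k < m i)%N then lam i k else zc i (k - m i)))).
rewrite [LHS]xc nm (sum_cat _ _ (fun k => c k *: lam i k)) yd; congr (_ + _).
  by apply: eq_bigr => k _; rewrite ltn_ord.
by apply: eq_bigr => k _; rewrite ltnNge leq_addr addKn.
Qed.

Lemma n_split i : n i = (m i + p i)%N.
Proof. by have [lb _] := H i; apply: basis_size lb (lift_basis i). Qed.

Lemma m_le_p i : (m (i - 1) <= p i)%N.
Proof. by have [_ [_ [_ ? _ _ _]]] := H (i - 1). Qed.

(** The first [m (i - 1)] vectors of [zc i] are the coboundaries up to powers of t. The order of the
    blocks changes with the parity as [lift_start] and [cobound_start] prescribe. *)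
Definition arranged i (k : nat) : E i :=
  if odd `|i|%N then
    if (k < m (i - 1))%N then zc i k
    else if (k < m (i - 1) + m i)%N then lam i (k - m (i - 1)) else zc i (k - m i)
  else if (k < m i)%N then lam i k else zc i (k - m i).

Lemma arranged_lift i k : (k < m i)%N -> arranged i (lift_start m i + k) = lam i k.
Proof.
move=> km; rewrite /arranged /lift_start; case: odd; last by rewrite add0n km.
by rewrite ltnNge leq_addr /= ltn_add2l km addKn.
Qed.

Lemma arranged_cobound i k : (k < m (i - 1))%N ->
  arranged i (cobound_start m i + k) = zc i k.
Proof.
move=> km; rewrite /arranged /cobound_start; case: odd; first by rewrite add0n km.
by rewrite ltnNge leq_addr addKn.
Qed.

Lemma arranged_basis i : is_basis (n i) (arranged i).
Proof.
rewrite n_split; apply: (basis_of_generates (lift_basis i)) => x.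
have ub := lift_basis i; have mp := m_le_p i.
have pE : p i = (m (i - 1) + (p i - m (i - 1)))%N by rewrite subnKC.
have [c ->] := ub.2 x; rewrite /arranged; case: odd; last by exists c.
pose e k := if (k < m (i - 1))%N then c (m i + k)%N
  else if (k < m (i - 1) + m i)%N then c (k - m (i - 1))%N else c k.
exists e; rewrite (sum_cat (m i) (p i) (fun k => c k *: (if (k < m i)%N then lam i k else zc i (k - m i)))).
pose F k := e k *: (if (k < m (i - 1))%N then zc i k
  else if (k < m (i - 1) + m i)%N then lam i (k - m (i - 1)) else zc i (k - m i)).
rewrite -[RHS]/(\sum_(l < m i + p i) F l) [in RHS]pE addnCA.
rewrite (sum_cat (m (i - 1)) _ F) (sum_cat (m i) _ (fun l => F (m (i - 1) + l)%N)).
rewrite [in LHS]pE (sum_cat (m (i - 1)) _ (fun k => c (m i + k)%N *: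
  (if (m i + k < m i)%N then lam i (m i + k) else zc i (m i + k - m i)))).
rewrite addrCA; congr (_ + (_ + _)); apply: eq_bigr => k _.
- rewrite /F /e ltn_ord; have -> : (m i + k < m i)%N = false by lia.
  by rewrite addKn.
- rewrite /F /e ltn_ord; have -> : (m (i - 1) + k < m (i - 1))%N = false by lia.
  by rewrite ltn_add2l ltn_ord addKn.
- rewrite /F /e; have -> : (m (i - 1) + (m i + k) < m (i - 1))%N = false by lia.
  have -> : (m (i - 1) + (m i + k) < m (i - 1) + m i)%N = false by lia.
  have -> : (m i + (m (i - 1) + k) < m i)%N = false by lia.
  by rewrite (addnCA (m i)); congr (_ *: zc i _); lia.
Qed.

(** The coordinates of a coboundary on [z i] are multiples of the t^(a i k) and vanish beyond m i.
    For c = 1 this forces the exponent to be 0, which is how vanishing cohomology is used. *)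
Lemma coboundary_coord i k c w : (k < q i)%N -> c *: z i k = cd E i (i + 1) w ->
  if (k < m i)%N then exists d, c = d * t ^+ a i k else c = 0.
Proof.
move=> kq; have [lb [[_ iz _] [mn mq dl dl0 _]]] := H i.
have [e ->] := lb.2 w; have nm : (n i = m i + (n i - m i))%N by rewrite subnKC.
rewrite nm (sum_cat _ _ (fun k => e k *: lam i k)) linearD [X in _ = _ + X]linear_sum.
rewrite [X in _ = _ + X]big1 ?addr0 => [|l _]; last first.
  by rewrite linearZ /= dl0 ?scaler0 // leq_addr -ltn_subRL ltn_ord.
rewrite linear_sum => ce; have qm : (q i = m i + (q i - m i))%N by rewrite subnKC.
pose f l := if (l < m i)%N then e l * t ^+ a i l else 0.
have fk : f k = c * (k == k)%:R.
  apply: (indep_eq (c := f) (c' := fun l => c * (k == l)%:R) iz _ kq).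
  rewrite -(scaler_comb c (q i) (fun l => (k == l)%:R) (z i)) (sum_delta (z i) kq) ce qm.
  rewrite (sum_cat _ _ (fun l => f l *: z i l)) [X in _ + X = _]big1 ?addr0 => [|l _]; last first.
    by rewrite /f ltnNge leq_addr scale0r.
  by apply: eq_bigr => l _; rewrite /f ltn_ord linearZ /= dl // scalerA.
move: fk; rewrite eqxx mulr1 /f; case: ifP => _ <- //.
by exists (e k).
Qed.

Lemma cocycle_coboundary i : (forall k, exists w, z i k = cd E i (i + 1) w) ->
  m i = q i /\ forall k, (k < m i)%N -> a i k = 0%N.
Proof.
move=> ac; have [_ [_ [_ mq _ _ _]]] := H i.
have key k : (k < q i)%N -> (k < m i)%N /\ a i k = 0%N.
  move=> kq; have [w zw] := ac k.
  have := @coboundary_coord i k 1 w kq; rewrite scale1r => /(_ zw).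
  case: ifP => [_ [d e]|_ /eqP]; last by rewrite oner_eq0.
  by split=> //; apply: (@t_unit _ d); rewrite e mulrC.
split=> [|k km]; last by have [] := key k (leq_trans km mq).
by apply/eqP; rewrite eqn_leq mq leqNgt; apply/negP => /key[]; rewrite ltnn.
Qed.

Lemma acyclic_coboundary i : acyclic_at E (i + 1) ->
  forall k, exists w, z i k = cd E i (i + 1) w.
Proof.
move=> ac k; have [_ [[dz _ _] _]] := H i; apply: cobound_reindex.
by apply/(coh_cls_eq0 (dz k)); apply: ac.
Qed.

(** A power of t kills the class of [z 0 k] in H^1. Freeness makes the class itself zero, so the
    cocycle is a coboundary and its exponent is 0. *)
Lemma free_exponents k : (k < m 0)%N -> a 0 k = 0%N.
Proof.
move=> km; have [_ [[dz _ _] [_ mq dl _ _]]] := H 0.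
have dz0 : cd E 1 (1 + 1) (z 0 k) = 0 := dz k.
have c0 : t ^+ a 0 k *: coh_cls (z 0 k : E 1) = 0.
  rewrite -coh_clsZ //; apply/coh_cls_eq0; first by rewrite linearZ /= dz0 scaler0.
  by exists (lam 0 k); symmetry; apply: (dl k km).
have [b [x [ix gx]]] := E_free; have [d dE] := gx (coh_cls (z 0 k : E 1)).
have d0 l : (l < b)%N -> d l = 0.
  move=> lb; have := ix (fun l => t ^+ a 0 k * d l); rewrite -(scaler_comb (t ^+ a 0 k) b d x) -dE.
  by move=> /(_ c0 l lb)/R_dom/orP[|/eqP//]; rewrite (negPf (t_neq0 _)).
have /coh_cls_eq0[//|w zw] : coh_cls (z 0 k : E 1) = 0.
  by rewrite dE big1 // => l _; rewrite d0 ?scale0r.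
have := @coboundary_coord 0 k 1 w (leq_trans km mq); rewrite scale1r km => /(_ zw)[d' e].
by apply: (@t_unit _ d'); rewrite e mulrC.
Qed.

Lemma arranged_split :
  split_cpx n (p 1 - m 0) (p 2 - m 1) m arranged (fun k => t ^+ a 1 k).
Proof.
(* Acyclicity in degree i + 1 turns all cocycles there into coboundaries with exponent 0; only i = 0
   and i = 1 escape, and i = 0 is covered by freeness of H^1. *)
have ac i : i + 1 != 1 -> i + 1 != 2 -> m i = q i /\ forall k, (k < m i)%N -> a i k = 0%N.
  by move=> i1 i2; apply/cocycle_coboundary/acyclic_coboundary/E_acyclic.
split=> [i|i k km|i k kn nk].
- rewrite n_split addnAC addnC; congr (_ + _)%N; rewrite /coh_dim.
  case: eqP => [->|/eqP i1]; first by rewrite subnKC //; apply: (m_le_p 1).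
  case: eqP => [->|/eqP i2]; first by rewrite subnKC //; apply: (m_le_p 2).
  by have := ac (i - 1); rewrite subrK addn0 => /(_ i1 i2)[-> _].
- have := arranged_cobound (i := i + 1) (k := k); rewrite addrK => /(_ km) ->.
  rewrite arranged_lift // zcS; have [_ [_ [_ _ dl _ _]]] := H i; rewrite dl //.
  congr (_ *: _); case: eqP => [->//|/eqP i1].
  suff -> : a i k = 0%N by rewrite expr0.
  have [i0|i0] := eqVneq i 0; first by rewrite i0 in km *; apply: free_exponents.
  have [||_ ->//] := ac i; first by apply: contra_neq i0 => e; apply: (addIr 1); rewrite e.
  by apply: contra_neq i1 => e; apply: (addIr 1); rewrite e.
have [lb [_ [_ _ _ dl0 _]]] := H i; have [dz _ _] := zcP i.
have mp := m_le_p i; rewrite n_split in kn; move: nk.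
rewrite /arranged /lift_start; case: odd.
  by case: ltnP => k1; rewrite ?dz //; case: ltnP => k2; rewrite ?dz // k1.
by rewrite add0n leq0n /= => /negPf ->; rewrite dz.
Qed.

End Arrangement.

Lemma split_exists : exists m h1 h2 (u : forall i, nat -> E i) (a : nat -> nat),
  [/\ split_cpx n h1 h2 m u (fun k => t ^+ a k), forall i, is_basis (n i) (u i) &
      forall k l, (k <= l)%N -> (l < m 1)%N -> (a k <= a l)%N].
Proof.
pose sd i := sval (cid (split_datum_exists i)); have H i := sd_prop (sd i).
have sp := arranged_split H; have ub := arranged_basis H.
exists (fun i => sd_rank (sd i)); do 2 eexists; eexists; exists (sd_exp (sd 1)).
by split; [exact: sp|exact: ub|have [_ [_ []]] := H 1].
Qed.

End SplitOverDVR.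

(** * Clearing denominators in the localized complex *)

Lemma clear_comb (R : comNzRingType) (N : lmodType R) (a b c d r : R) (x y : N) :
  c * r = a -> (c * (b * d)) *: (r *: x + y) = (d * a) *: (b *: x) + (c * b) *: (d *: y).
Proof. by move=> <-; rewrite scalerDr !scalerA; congr (_ *: _ + _ *: _); ring. Qed.

Section ClearDenominators.
Variable O : idomainType.
Local Notation Lambda := (series O).
Local Notation phi := (@to_locI O).

Lemma clear_scalars n (r : nat -> locI O) : exists b (c : nat -> Lambda),
  ~ Ipow 1 b /\ forall k, (k < n)%N -> to_locI b * r k = to_locI (c k).
Proof.
elim: n => [|n [b [c [Ib bc]]]]; first by exists 1, (fun=> 0); split=> //; apply: notI1.
have [x [d [Id dx]]] := locI_denom (r n).
exists (d * b), (fun k => if k == n then b * x else d * c k); split; first exact: notIM.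
move=> k; rewrite ltnS leq_eqVlt rmorphM /=; case: eqP => [-> _|_ kn].
  by rewrite mulrAC dx rmorphM /= mulrC.
by rewrite -mulrA bc // rmorphM.
Qed.

Lemma bc1_locI_inj (M : lmodType Lambda) n (w : nat -> M) : is_basis n w ->
  forall x y : M, bc1 phi x = bc1 phi y -> x = y.
Proof.
move=> [iw gw] x y; have [c ->] := gw x; have [d ->] := gw y; rewrite !bc1_sum => cd.
have [ib _] : is_basis n (fun k => bc1 phi (w k)).
  apply: bc_basis => // z; have [e ->] := gw z.
  by exists 1, 1, e; rewrite rmorph1 mulr1 scale1r.
apply: eq_bigr => k _; congr (_ *: _); apply: (@to_locI_inj O).
exact: (indep_eq (c := fun k => to_locI (c k)) (c' := fun k => to_locI (d k)) ib cd (ltn_ord k)).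
Qed.

Lemma clear_bc (M : lmodType Lambda) (q : bc phi M) :
  exists b x, ~ Ipow 1 b /\ to_locI b *: q = bc1 phi x.
Proof.
apply: (bc_ind (T := [set q | exists b x, ~ Ipow 1 b /\ to_locI b *: q = bc1 phi x])).
  split=> [|r q1 q2 [b [x [Ib bx]]] [d [y [Id dy]]]].
    by exists 1, 0; rewrite scaler0 bc1_0; split=> //; apply: notI1.
  have [a [c [Ic cr]]] := locI_denom r.
  exists (c * (b * d)), ((d * a) *: x + (c * b) *: y); split; first by do 2 apply: notIM => //.
  have mE (e f : series O) : to_locI (e * f) = to_locI e * to_locI f by rewrite rmorphM.
  by rewrite !mE (clear_comb (to_locI b) (to_locI d) q1 q2 cr) bx dy bc1D !bc1Z !(rmorphM (@to_locI O)).
by move=> x; exists 1, x; rewrite rmorph1 scale1r; split=> //; apply: notI1.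
Qed.

Lemma clear_family (M : lmodType Lambda) n (q : nat -> bc phi M) :
  exists b, ~ Ipow 1 b /\ forall k, (k < n)%N -> exists x, to_locI b *: q k = bc1 phi x.
Proof.
elim: n => [|n [b [Ib bq]]]; first by exists 1; split=> //; apply: notI1.
have [d [y [Id dy]]] := clear_bc (q n).
exists (d * b); split=> [|k]; first exact: notIM.
rewrite ltnS leq_eqVlt rmorphM /= => /orP[/eqP ->|/bq[x bx]].
  by exists (b *: y); rewrite bc1Z -dy (scalerA _ _ (q n)) mulrC.
by exists (d *: x); rewrite bc1Z -bx (scalerA _ _ (q k)).
Qed.

End ClearDenominators.

Section IntegralModel.
Variables (O : idomainType) (P : cpx (series O)) (n : int -> nat) (lo : int) (len : nat).
Local Notation phi := (@to_locI O).
Hypothesis P_perfect : perfect_cpx P n lo len.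
Let E := bcC phi P.

Lemma perfect_n0 i : i \notin degrees lo len -> n i = 0%N.
Proof. exact: P_perfect.2. Qed.

Lemma perfect_bc1_inj i (x y : P i) : bc1 phi x = bc1 phi y -> x = y.
Proof. by have [w wb] := P_perfect.1 i; apply: bc1_locI_inj wb x y. Qed.

Lemma perfect_bc_basis (R : comNzRingType) (f : {rmorphism series O -> R}) i (w : nat -> P i) :
  is_basis (n i) w -> is_basis (n i) (fun k => bc1 f (w k)).
Proof.
move=> [iw gw]; apply: bc_basis => // z; have [e ->] := gw z.
by exists 1, 1, e; rewrite rmorph1 mulr1 scale1r.
Qed.

(** Only finitely many degrees have nonzero rank, so one denominator serves for the whole
    complex. *)
Lemma clear_complex (u : forall i, nat -> E i) : exists b, ~ Ipow 1 b /\
  forall i k, (k < n i)%N -> exists x, to_locI b *: u i k = (bc1 phi x : E i).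
Proof.
suff [b [Ib bu]] : exists b, ~ Ipow 1 b /\ forall i, i \in degrees lo len ->
    forall k, (k < n i)%N -> exists x, to_locI b *: u i k = (bc1 phi x : E i).
  exists b; split=> // i k kn; apply: bu => //; apply: contraTT kn => /perfect_n0 ->.
  by rewrite ltn0.
elim: (degrees lo len) => [|j s [b [Ib bu]]].
  by exists 1; split=> //; apply: notI1.
have [d [Id du]] := clear_family (n j) (u j).
exists (d * b); split=> [|i]; first exact: notIM.
rewrite inE rmorphM /= => /orP[/eqP -> k kn|/bu{}bu k /bu[x bx]].
  by have [x dx] := du k kn; exists (b *: x); rewrite bcC1Z -[bc1 _ x]dx (scalerA _ _ (u j k)) mulrC.
by exists (d *: x); rewrite bcC1Z -bx (scalerA _ _ (u i k)).
Qed.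

Hypothesis E_acyclic : forall i, i != 1 -> i != 2 -> acyclic_at E i.
Hypothesis E_free : exists (b : nat) (x : nat -> coh E 1), is_basis b x.

(** All adapted vectors, in all degrees, are multiplied by the same unit s of Lambda_I. The
    relations between lifts and coboundaries thus keep their coefficients, and they descend to P
    because P embeds in its localization. *)
Lemma integral_model : exists m h1 h2 (u : forall i, nat -> P i) (a : nat -> nat),
  model phi n h1 h2 m u (fun k => @tX O ^+ a k) /\
  forall k l, (k <= l)%N -> (l < m 1)%N -> (a k <= a l)%N.
Proof.
have R_dom := domain_of_inj (@locI_frac_inj O).
have t0 : to_locI (tX O) != 0.
  by rewrite -(inj_eq (@locI_frac_inj O)) rmorph0 tofrac_eq0 -[tX O]expr1 tXn_neq0.
have Eb i : exists u : nat -> E i, is_basis (n i) u.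
  by have [w wb] := P_perfect.1 i; exists (fun k => bc1 phi (w k)); apply: perfect_bc_basis.
have [m [h1 [h2 [v [a [sp vb am]]]]]] :=
  split_exists (@locI_dvr O) t0 (@locI_tXn_unit O) R_dom Eb E_acyclic E_free.
have [s [Is sv]] := clear_complex v; have [s' ss'] := locI_unit Is.
pose u i k : P i := xget 0 [set x | to_locI s *: v i k = (bc1 phi x : E i)].
have uE i k : (k < n i)%N -> (bc1 phi (u i k) : E i) = to_locI s *: v i k.
  move=> kn; rewrite /u; case: xgetP => [x _ ->//|none].
  by have [x sx] := sv i k kn; case: (none x).
have ub i : is_basis (n i) (fun k => bc1 phi (u i k) : E i).
  by apply: (basis_scale ss' (vb i)) => k kn; apply: uE.
exists m, h1, h2, u, a; split; last exact: am.
split; [| |exact: ub|].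
- split=> [i|i k km|i k kn nk].
  + exact: (split_rank sp).
  + apply: perfect_bc1_inj; rewrite -bcC_d1 uE; last first.
      by apply: leq_trans (lift_bound sp i); rewrite ltn_add2l.
    rewrite linearZ /= (split_lift sp km) bcC1Z uE; last first.
      by apply: leq_trans (cobound_bound sp i); rewrite ltn_add2l.
    rewrite !(scalerA _ _ (v (i + 1) _)) mulrC.
    by case: (i == 1); rewrite ?rmorphXn ?rmorph1.
  + apply: perfect_bc1_inj; rewrite -bcC_d1 (uE _ _ kn) linearZ /= (split_cocycle sp kn nk).
    by rewrite scaler0 bc1_0.
- move=> i x; have [r xr] := (ub i).2 (bc1 phi x).
  have [b [c [Ib bc]]] := clear_scalars (n i) r; have [b' bb'] := locI_unit Ib.
  exists b, b', c; split=> //; apply: perfect_bc1_inj.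
  rewrite bc1Z bc1_sum [X in _ *: X]xr scaler_sumr; apply: eq_bigr => k _.
  by rewrite (scalerA _ _ (bc1 phi (u i k))) bc.
- move=> k _; rewrite -(inj_eq (@locI_frac_inj O)) rmorph0 tofrac_eq0.
  exact: tXn_neq0.
Qed.

End IntegralModel.

(** * Derived Bockstein maps *)

Section Bockstein.
Variables (O : idomainType) (P : cpx (series O)).
Local Notation T := (@tX O).
Local Notation ev := (@ev0 O).
Hypothesis P_free : forall i, exists n (w : nat -> P i), is_basis n w.

Lemma tXn_inj k i (x y : P i) : T ^+ k *: x = T ^+ k *: y -> x = y.
Proof.
have [n [w [iw gw]]] := P_free i; have [c ->] := gw x; have [d ->] := gw y.
rewrite !(scaler_comb (T ^+ k) n _ w) => e; apply: eq_bigr => j _; congr (_ *: _).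
have := indep_eq (c := fun j => T ^+ k * c j) (c' := fun j => T ^+ k * d j) iw e (ltn_ord j).
by move/mulfI; apply; apply: tXn_neq0.
Qed.

Lemma bc_ev0_surj (M : lmodType (series O)) (z : bc ev M) : exists x, z = bc1 ev x.
Proof.
apply: (bc_ind (T := [set z | exists x, z = bc1 ev x])) => [|x]; last by exists x.
split=> [|a _ _ [x ->] [y ->]]; first by exists 0; rewrite bc1_0.
by exists ((series_C a : series O) *: x + y); rewrite bc1D bc1Z.
Qed.

Lemma bc_ev0_ker i (x : P i) : bc1 ev x = 0 -> exists y, x = T *: y.
Proof.
have [n [w [iw gw]]] := P_free i; have [c ->] := gw x; rewrite bc1_sum => c0.
have [ib _] : is_basis n (fun k => bc1 ev (w k)).
  apply: bc_basis => // z; have [e ->] := gw z.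
  by exists 1, 1, e; rewrite rmorph1 mulr1 scale1r.
have cI k : (k < n)%N -> exists d, c k = T * d.
  move=> kn; have /Ipow1/Ipow_tXn[d ->] := ib (fun k => c k 0%N) c0 k kn.
  by exists d; rewrite expr1.
have [d dP] : exists d : nat -> series O, forall k, (k < n)%N -> c k = T * d k.
  exists (fun k => xget 0 [set d | c k = T * d]) => k kn.
  by case: xgetP => [d _ ->//|none]; have [d cd] := cI k kn; case: (none d).
exists (\sum_(k < n) d k *: w k); rewrite (scaler_comb T n d w).
by apply: eq_bigr => k _; rewrite dP.
Qed.

Lemma bc_ev0_T i (x : P i) : bc1 ev (T *: x) = 0.
Proof. by rewrite bc1Z scale0r. Qed.

Section FiltrationStep.
Variable k : nat.

Lemma mspan_IM (M : lmodType (series O)) (y : M) :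
  mspan (@IM _ k M) y <-> exists x, y = T ^+ k *: x.
Proof.
split=> [|[x ->]]; last first.
  by apply: sub_mspan; exists (T ^+ k), x; rewrite -[T ^+ k]mulr1; split=> //; apply: Ipow_tXnM.
move=> /(_ [set y | exists x, y = T ^+ k *: x]); apply.
  split=> [|a _ _ [x ->] [x' ->]]; first by exists 0; rewrite scaler0.
  by exists (a *: x + x'); rewrite scalerDr !scalerA mulrC.
by move=> _ [a [x [/Ipow_tXn[a' ->] ->]]]; exists (a' *: x); rewrite scalerA.
Qed.

(** Multiplication by T^k parametrizes I^k P by P, injectively since P is free. In this
    parametrization the inclusions become multiplication by T and the projections to C_0 become
    reduction. *)
Definition Imk i (x : P i) : IC P k i := insub0 _ (T ^+ k *: x).

Lemma mval_Imk i (x : P i) : mval (Imk x) = T ^+ k *: x.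
Proof. by apply: insub0K; apply/mspan_IM; exists x. Qed.

Lemma Imk_surj i (y : IC P k i) : exists x, y = Imk x.
Proof.
have /mspan_IM[x yx] := mspan_mval (y : submod (@IM _ k (P i))).
by exists x; apply/val_inj; rewrite [RHS]mval_Imk.
Qed.

Lemma Imk_inj i : injective (@Imk i).
Proof.
by move=> x y /(congr1 (fun z : submod (@IM _ k (P i)) => mval z)); rewrite !mval_Imk => /tXn_inj.
Qed.

Lemma Imk_lin i : semilin idfun (@Imk i).
Proof.
move=> a x y; apply/val_inj; rewrite [LHS]mval_Imk.
rewrite -[RHS]/(a *: mval (Imk x) + mval (Imk y)) !mval_Imk.
by rewrite scalerDr !scalerA mulrC.
Qed.

Lemma cd_Imk i j (x : P i) : cd (IC P k) i j (Imk x) = Imk (cd P i j x).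
Proof. by apply/val_inj; rewrite [LHS]IdE [RHS]mval_Imk mval_Imk linearZ. Qed.

Lemma Imk_cocycle i (x : P i) :
  cd P i (i + 1) x = 0 <-> cd (IC P k) i (i + 1) (Imk x) = 0.
Proof.
have [I0 _ _ _] := semilinearB (phi := idfun) (@Imk_lin (i + 1)).
by rewrite cd_Imk; split=> [->//|]; rewrite -I0 => /Imk_inj.
Qed.

Lemma coh_Imk (c : coh (IC P k) 2) : exists y, cd P 2 (2 + 1) y = 0 /\ c = coh_cls (Imk y).
Proof.
have [y e] := Imk_surj (coh_rep c); exists y.
by split; [apply/Imk_cocycle; rewrite -e; apply: coh_rep_cocycle|rewrite -e coh_repK].
Qed.

Lemma coh_Imk_eq (y y' : P 2) : cd P 2 (2 + 1) y = 0 -> cd P 2 (2 + 1) y' = 0 ->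
  coh_cls (Imk y) = coh_cls (Imk y') <-> exists w, y - y' = cd P 1 2 w.
Proof.
move=> dy dy'; rewrite coh_cls_eq; try by apply/Imk_cocycle.
have [_ ID IN _] := semilinearB (phi := idfun) (@Imk_lin 2).
split=> [[w]|[w e]].
  have [w' ->] := Imk_surj w; rewrite -IN -ID.
  by rewrite [X in _ = X](cd_Imk 2 w') => /Imk_inj e; exists w'.
by exists (Imk (w : P (2 - 1))); rewrite [RHS](cd_Imk 2 w) -e ID IN.
Qed.

Lemma Iproj_Imk i (x : P i) : Iproj (Imk x) = bc1 ev x.
Proof.
(* The presentation [a *: x'] found by the choice may differ from the given one, but a is T^k times
   some a' and T^k can be cancelled in a free module. *)
rewrite /Iproj; case: xgetP => [z _ [a [x' [/Ipow_tXn[a' aE] yx ->]]]|none].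
  have ak : a k = a' 0%N by rewrite aE series_tXn ltnn subnn.
  have -> : x = a' *: x' by apply: (@tXn_inj k); rewrite scalerA -aE -yx mval_Imk.
  by rewrite bc1Z; exact: (congr1 (fun c : O => c *: bc1 ev x') ak).
case: (none (bc1 ev x)); exists (T ^+ k), x.
split; rewrite ?mval_Imk //; first by rewrite -[T ^+ k]mulr1; apply: Ipow_tXnM.
have tk : (T ^+ k : series O) k = 1 by rewrite -[T ^+ k]mulr1 series_tXn ltnn subnn.
by rewrite -[LHS](scale1r (bc1 ev x)); exact: (congr1 (fun c : O => c *: bc1 ev x) (esym tk)).
Qed.

Lemma Iproj_semilin i : semilin ev (@Iproj _ P k i).
Proof.
move=> a y y'; have [x ->] := Imk_surj y; have [x' ->] := Imk_surj y'.
by rewrite -Imk_lin !Iproj_Imk bc1_semilinear.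
Qed.

Lemma bpi_Imk (y : P 2) : cd P 2 (2 + 1) y = 0 ->
  bpi (coh_cls (Imk y)) = coh_cls (V := C0 P) (bc1 ev y).
Proof.
move=> dy; rewrite -(Iproj_Imk y).
apply: (@coh_map_cls _ _ ev (IC P k) (C0 P) 2 (@Iproj _ P k 2)).
- exact: Iproj_semilin.
- move=> z; have [x ->] := Imk_surj z => /Imk_cocycle dx.
  by rewrite Iproj_Imk; apply: bcC_cocycle.
- move=> w; have [w' ->] := Imk_surj w; exists (bc1 ev w').
  by rewrite cd_Imk Iproj_Imk [RHS]bcC_d1.
- exact/Imk_cocycle.
Qed.

End FiltrationStep.

Lemma Iincl_Imk k i (x : P i) : Iincl (Imk k.+1 x) = Imk k (T *: x).
Proof.
apply/val_inj; rewrite [RHS]mval_Imk [LHS]insub0K mval_Imk.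
  by rewrite exprSr scalerA.
by apply/mspan_IM; exists (T *: x); rewrite exprSr scalerA.
Qed.

Lemma iota_Imk k (y : P 2) : cd P 2 (2 + 1) y = 0 ->
  iota_coh (coh_cls (Imk k.+1 y)) = coh_cls (Imk k (T *: y)).
Proof.
move=> dy; rewrite -Iincl_Imk.
apply: (@coh_map_cls _ _ idfun (IC P k.+1) (IC P k) 2 (@Iincl _ P k 2)).
- move=> a u v; have [x ->] := Imk_surj u; have [x' ->] := Imk_surj v.
  by rewrite -Imk_lin !Iincl_Imk -[RHS]Imk_lin scalerDr !scalerA mulrC.
- move=> z; have [x ->] := Imk_surj z => /Imk_cocycle dx; rewrite Iincl_Imk.
  by apply/Imk_cocycle; rewrite linearZ /= dx scaler0.
- move=> w; have [w' ->] := Imk_surj w; exists (Imk k (T *: w')).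
  by rewrite !cd_Imk Iincl_Imk linearZ.
- exact/Imk_cocycle.
Qed.

Lemma iotasS k (z : coh (IC P k.+2) 2) : iotas z = iotas (iota_coh z).
Proof. by []. Qed.

Lemma iotas_Imk k (y : P 2) : cd P 2 (2 + 1) y = 0 ->
  iotas (coh_cls (Imk k.+1 y)) = coh_cls (Imk 1 (T ^+ k *: y)).
Proof.
elim: k y => [|k IH] y dy; first by rewrite expr0 scale1r.
have dTy : cd P 2 (2 + 1) (T *: y) = 0 by rewrite linearZ /= dy scaler0.
have e : iotas (iota_coh (coh_cls (Imk k.+2 y))) = coh_cls (Imk 1 (T ^+ k *: (T *: y))).
  by rewrite (iota_Imk k.+1 dy) (IH _ dTy).
have Ty : T ^+ k *: (T *: y) = T ^+ k.+1 *: y by rewrite scalerA -exprSr.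
by rewrite iotasS e Ty.
Qed.

Local Notation H1 := (coh (C0 P) 1).
Local Notation H2 := (coh (C0 P) 2).
Local Notation cl1 x := (coh_cls (V := C0 P) (i := 1) (bc1 ev x)).
Local Notation cl2 y := (coh_cls (V := C0 P) (i := 2) (bc1 ev y)).

Lemma divided_cocycle k (x : P 1) (y : P 2) : cd P 1 2 x = T ^+ k *: y -> cd P 2 (2 + 1) y = 0.
Proof.
move=> dx; apply: (@tXn_inj k (2 + 1)); transitivity (cd P 2 (2 + 1) (T ^+ k *: y)).
  by rewrite linearZ.
by rewrite -dx cd_comp scaler0.
Qed.

Lemma reduced_cocycle k (x : P 1) (y : P 2) : cd P 1 2 x = T ^+ k.+1 *: y ->
  cd (C0 P) 1 (1 + 1) (bc1 ev x) = 0.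
Proof.
move=> dx; rewrite [LHS]bcC_d1 -[cd P 1 (1 + 1) x]/(cd P 1 2 x) dx exprS -scalerA.
exact: bc_ev0_T.
Qed.

Lemma cl1_eq (x x' : P 1) : cd (C0 P) 1 (1 + 1) (bc1 ev x) = 0 ->
  cd (C0 P) 1 (1 + 1) (bc1 ev x') = 0 -> cl1 x = cl1 x' <->
  exists w q, x - x' = cd P 0 1 w + T *: q.
Proof.
move=> dx dx'; rewrite coh_cls_eq //.
have [_ bD bN _] := semilinearB (@bc1_semilinear _ _ ev (P 1)).
split=> [[w]|[w [q e]]].
  have [w' ->] := bc_ev0_surj w; rewrite [X in _ = X](bcC_d1 ev (V := P) (i := 0) 1 w').
  rewrite -bN -bD => /eqP; rewrite -subr_eq0 -bN -bD => /eqP/bc_ev0_ker[q e].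
  by exists w', q; rewrite -e [RHS]addrC subrK.
exists (bc1 ev w); rewrite [RHS](bcC_d1 ev (V := P) (i := 0) 1 w).
by rewrite -[LHS]/(bc1 ev x - bc1 ev x') -bN -bD e bD bc_ev0_T addr0.
Qed.

Lemma cl2_eq (y y' : P 2) : cd (C0 P) 2 (2 + 1) (bc1 ev y) = 0 ->
  cd (C0 P) 2 (2 + 1) (bc1 ev y') = 0 -> cl2 y = cl2 y' ->
  exists w q, y - y' = cd P 1 2 w + T *: q.
Proof.
move=> dy dy' /(coh_cls_eq dy dy')[w].
have [w' ->] := bc_ev0_surj w; rewrite [X in _ = X](bcC_d1 ev (V := P) (i := 1) 2 w').
rewrite -bc1B => /eqP; rewrite -subr_eq0 -bc1B => /eqP/bc_ev0_ker[q e].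
by exists w', q; rewrite -e [RHS]addrC subrK.
Qed.

End Bockstein.

(** * Description of the Bockstein stages by divisible differentials *)

Section BocksteinStages.
Variables (O : idomainType) (P : cpx (series O)).
Local Notation T := (@tX O).
Local Notation ev := (@ev0 O).
Hypothesis P_free : forall i, exists n (w : nat -> P i), is_basis n w.
Local Notation H1 := (coh (C0 P) 1).
Local Notation H2 := (coh (C0 P) 2).
Local Notation cl1 x := (coh_cls (V := C0 P) (i := 1) (bc1 ev x)).
Local Notation cl2 y := (coh_cls (V := C0 P) (i := 2) (bc1 ev y)).

(** The classical picture of the Bockstein: for positive k, if the differential of x is T^k y, then
    beta^(k) sends the class of x modulo T to that of y. *)
Definition divisible_d (k : nat) (x : P 1) (y : P 2) := cd P 1 2 x = T ^+ k *: y.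

(* The kernel of H^2(C_0) -> coker beta^(k), and the image of ker beta^(k) in H^1(C_0). *)
Definition cok_rel (k : nat) : set H2 := [set h | exists x y, divisible_d k x y /\ h = cl2 y].
Definition ker_img (k : nat) : set H1 := [set h | exists x y, divisible_d k.+1 x y /\ h = cl1 x].

Lemma divisible_comb k a x y x' y' : divisible_d k x y -> divisible_d k x' y' ->
  divisible_d k (a *: x + x') (a *: y + y').
Proof.
by rewrite /divisible_d => dx dx'; rewrite linearP dx dx' scalerDr !scalerA mulrC.
Qed.

Lemma divisible_T k x y : divisible_d k x y -> divisible_d k.+1 (T *: x) y.
Proof. by rewrite /divisible_d => dx; rewrite linearZ /= dx scalerA exprS. Qed.

Lemma divisible_cocycle2 k x y : divisible_d k x y -> cd (C0 P) 2 (2 + 1) (bc1 ev y) = 0.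
Proof. by move/(divided_cocycle P_free); apply: bcC_cocycle. Qed.

Lemma divisible_cocycle1 k x y : divisible_d k.+1 x y -> cd (C0 P) 1 (1 + 1) (bc1 ev x) = 0.
Proof. exact: reduced_cocycle. Qed.

Lemma cl2_comb (a : O) y y' : cd (C0 P) 2 (2 + 1) (bc1 ev y) = 0 ->
  cd (C0 P) 2 (2 + 1) (bc1 ev y') = 0 ->
  cl2 ((series_C a : series O) *: y + y') = a *: cl2 y + cl2 y'.
Proof. by move=> dy dy'; rewrite bc1_semilinear; apply: coh_cls_lin. Qed.

Lemma cl2B y y' : cd (C0 P) 2 (2 + 1) (bc1 ev y) = 0 ->
  cd (C0 P) 2 (2 + 1) (bc1 ev y') = 0 -> cl2 (y - y') = cl2 y - cl2 y'.
Proof. by move=> dy dy'; rewrite bc1B; apply: coh_clsB. Qed.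

Lemma cl1_comb (a : O) x x' : cd (C0 P) 1 (1 + 1) (bc1 ev x) = 0 ->
  cd (C0 P) 1 (1 + 1) (bc1 ev x') = 0 ->
  cl1 ((series_C a : series O) *: x + x') = a *: cl1 x + cl1 x'.
Proof. by move=> dx dx'; rewrite bc1_semilinear; apply: coh_cls_lin. Qed.

Lemma submodule_cok_rel k : submodule (cok_rel k).
Proof.
split=> [|a _ _ [x [y [dx ->]]] [x' [y' [dx' ->]]]].
  by exists 0, 0; split; rewrite ?/divisible_d ?linear0 ?scaler0 // bc1_0 coh_cls0.
exists ((series_C a : series O) *: x + x'), ((series_C a : series O) *: y + y').
split; first exact: divisible_comb.
exact: esym (cl2_comb a (divisible_cocycle2 dx) (divisible_cocycle2 dx')).
Qed.

Lemma cok_rel_mono k : cok_rel k `<=` cok_rel k.+1.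
Proof. by move=> _ [x [y [dx ->]]]; exists (T *: x), y; split=> //; apply: divisible_T. Qed.

Lemma cok_rel0 h : cok_rel 0 h <-> h = 0.
Proof.
split=> [[x [y [dx ->]]]|->]; last exact: (submodule_cok_rel 0).1.
apply/coh_cls_eq0; first exact: divisible_cocycle2 dx.
exists (bc1 ev x); rewrite [RHS](bcC_d1 ev (V := P) (i := 1) 2 x).
by rewrite dx expr0 scale1r.
Qed.

Lemma ker_img0 h : ker_img 0 h.
Proof.
have [x e] := bc_ev0_surj (coh_rep h).
have := coh_rep_cocycle h; rewrite e [LHS](bcC_d1 ev (V := P) (i := 1) 2 x).
move=> /(bc_ev0_ker P_free)[y dx]; exists x, y; split; last by rewrite -e coh_repK.
by rewrite /divisible_d expr1.
Qed.

(** Two lifts of the class differ by a coboundary and some T q, and T q changes y only by the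
    differential of q. The value of [delta] is therefore independent of the lift chosen in its
    definition. *)
Lemma delta0E x y : divisible_d 1 x y -> delta (k := 0) (cl1 x) = coh_cls (Imk 1 y).
Proof.
move=> dx; rewrite /delta; case: xgetP => [z _ [x1 [px ->]]|none].
  have [x' x1E] := Imk_surj x1; rewrite {}x1E in px *.
  have mE : mval (Imk 0 x') = x' by rewrite mval_Imk expr0 scale1r.
  rewrite {}mE; have dr := coh_rep_cocycle (cl1 x).
  rewrite (Iproj_Imk P_free) in px; rewrite -px in dr.
  have e : cl1 x' = cl1 x by rewrite [bc1 ev x']px coh_repK.
  have [w [q xq]] := (cl1_eq P_free dr (divisible_cocycle1 dx)).1 e.
  have -> : x' = x + (cd P 0 1 w + T *: q) by rewrite -xq addrC subrK.
  have d2 : cd P 1 2 (x + (cd P 0 1 w + T *: q)) = T *: (y + cd P 1 2 q).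
    by rewrite scalerDr !linearD linearZ /= cd_comp add0r dx expr1.
  rewrite d2; have dy := divided_cocycle P_free dx.
  have -> : insub0 _ (T *: (y + cd P 1 2 q)) = Imk 1 (y + cd P 1 2 q).
    by rewrite /Imk expr1.
  apply/(coh_Imk_eq P_free); rewrite ?linearD ?dy ?add0r ?cd_comp //.
  by exists q; rewrite addrC addKr.
have [x' e] := bc_ev0_surj (coh_rep (cl1 x)).
case: (none (coh_cls (V := IC P 1) (insub0 _ (cd P 1 2 (mval (Imk 0 x')))))).
by exists (Imk 0 x'); split=> //; rewrite (Iproj_Imk P_free).
Qed.

(** The invariant that frees a stage from the choices made in earlier ones: [kerB] is a copy of
    [ker_img k] inside H^1 and [cokB] is the quotient of H^2 by [cok_rel k]. *)
Record stage_inv k (S : stage P k) : Prop := StageInv {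
  si_in_lin : semilin idfun (@kerB_in _ _ k S);
  si_in_inj : injective (@kerB_in _ _ k S);
  si_in : forall h, (exists c, kerB_in (s := S) c = h) <-> ker_img k h;
  si_pr_lin : semilin idfun (@cokB_pr _ _ k S : H2 -> cokB S);
  si_pr_surj : forall c, exists h : H2, cokB_pr S h = c;
  si_pr_ker : forall h : H2, cokB_pr S h = 0 <-> cok_rel k h }.

Section OneStage.
Variables (k : nat) (S : stage P k).
Hypothesis inv : stage_inv S.

Lemma stage_pr_eq (h h' : H2) : cokB_pr S h = cokB_pr S h' <-> cok_rel k (h - h').
Proof.
have [_ pD pN _] := semilinearB (phi := idfun) (si_pr_lin inv).
rewrite -(si_pr_ker inv) pD pN.
by split=> [->|/eqP]; [rewrite subrr|rewrite subr_eq0 => /eqP].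
Qed.

(** The preimage under [iotas] is not unique. For two preimages given by y and y', T^k (y - y') is a
    differential, so y' - y represents an element of [cok_rel k], which [cokB_pr] kills. *)
Lemma betaSE c x y : divisible_d k.+1 x y -> kerB_in (s := S) c = cl1 x ->
  betaS c = cokB_pr S (cl2 y).
Proof.
move=> dx cx; have dy := divided_cocycle P_free dx.
have dk : divisible_d 1 x (T ^+ k *: y) by rewrite /divisible_d dx scalerA -exprD add1n.
have dTy : cd P 2 (2 + 1) (T ^+ k *: y) = 0 := divided_cocycle P_free dk.
rewrite /betaS; case: xgetP => [z _ [ct [dct ->]]|none]; last first.
  case: (none (cokB_pr S (cl2 y))); exists (coh_cls (Imk k.+1 y)); split.
    by rewrite cx (delta0E dk) (iotas_Imk P_free).
  by rewrite (bpi_Imk P_free).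
have [y' [dy' ctE]] := coh_Imk P_free ct; rewrite {}ctE in dct *.
rewrite (bpi_Imk P_free) //; apply/stage_pr_eq.
have dTy' : cd P 2 (2 + 1) (T ^+ k *: y') = 0 by rewrite linearZ /= dy' scaler0.
move: dct; rewrite cx (delta0E dk) (iotas_Imk P_free) // => /(coh_Imk_eq P_free 1 dTy dTy')[w e].
exists (- w), (y' - y); split; first by rewrite /divisible_d linearN -e opprB scalerBr.
have dy2 : cd (C0 P) 2 (2 + 1) (bc1 ev y) = 0 := bcC_cocycle ev dy.
have dy2' : cd (C0 P) 2 (2 + 1) (bc1 ev y') = 0 := bcC_cocycle ev dy'.
exact: esym (cl2B dy2' dy2).
Qed.

Lemma betaS_semilin : semilin idfun (@betaS _ _ k S).
Proof.
move=> a c c'.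
have /(si_in inv)[x [y [dx cx]]] : exists c0, kerB_in (s := S) c0 = kerB_in c by exists c.
have /(si_in inv)[x' [y' [dx' cx']]] : exists c0, kerB_in (s := S) c0 = kerB_in c' by exists c'.
have cc : kerB_in (a *: c + c') = cl1 ((series_C a : series O) *: x + x').
  rewrite (si_in_lin inv) cx cx'.
  exact: esym (cl1_comb a (divisible_cocycle1 dx) (divisible_cocycle1 dx')).
rewrite (betaSE dx cx) (betaSE dx' cx') (betaSE (divisible_comb _ dx dx') cc).
by rewrite (cl2_comb a (divisible_cocycle2 dx) (divisible_cocycle2 dx')) (si_pr_lin inv).
Qed.

Lemma submodule_ker_beta : submodule [set c : kerB S | betaS c = 0].
Proof.
have [b0 _ _ _] := semilinearB (phi := idfun) betaS_semilin.
by split=> //= a c c' e e'; rewrite betaS_semilin e e' scaler0 addr0.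
Qed.

Lemma submodule_im_beta : submodule (range (@betaS _ _ k S)).
Proof.
have [b0 _ _ _] := semilinearB (phi := idfun) betaS_semilin.
split=> [|a _ _ [c _ <-] [c' _ <-]]; first by exists 0.
by exists (a *: c + c') => //; rewrite betaS_semilin.
Qed.

Lemma next_stage_inv : stage_inv (next_stage S).
Proof.
split.
- by move=> a c c'; rewrite /= (si_in_lin inv).
- by move=> c c' /(si_in_inj inv) e; apply/val_inj.
- move=> h; split=> [[c <-]|[x [y [dx ->]]]].
    have b0 : betaS (mval c) = 0 := mval_in c submodule_ker_beta.
    have /(si_in inv)[x [y [dx cx]]] : exists c0, kerB_in (s := S) c0 = kerB_in (mval c).
      by exists (mval c).
    move: b0; rewrite (betaSE dx cx) => /(si_pr_ker inv)[x' [y' [dx' yy']]].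
    have [w] := (coh_cls_eq (divisible_cocycle2 dx) (divisible_cocycle2 dx')).1 yy'.
    have [w' ->] := bc_ev0_surj w; rewrite [X in _ = X](bcC_d1 ev (V := P) (i := 1) 2 w').
    have [_ bD bN _] := semilinearB (@bc1_semilinear _ _ ev (P 2)).
    rewrite -bN -bD => /eqP; rewrite -subr_eq0 -bN -bD => /eqP/(bc_ev0_ker P_free)[q e].
    (* Vanishing of beta gives y = y' + d w' + T q with d x' = T^k y'. Subtracting T x' + T^(k+1) w'
       from x leaves its class modulo T unchanged and makes its differential T^(k+2) q. *)
    have dn : divisible_d k.+2 (x - (T *: x' + T ^+ k.+1 *: w')) q.
      rewrite /divisible_d linearB linearD !linearZ /= dx dx' scalerA -exprS.
      by rewrite -scalerDr -scalerBr opprD addrA e scalerA -exprSr.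
    exists (x - (T *: x' + T ^+ k.+1 *: w')), q; split=> //.
    transitivity (cl1 x); first exact: cx.
    apply/(cl1_eq P_free (divisible_cocycle1 dx) (divisible_cocycle1 dn)).
    exists 0, (x' + T ^+ k *: w').
    by rewrite linear0 add0r opprB addrC subrK scalerDr scalerA -exprS.
  have : ker_img k (cl1 x).
    by exists x, (T *: y); split=> //; rewrite /divisible_d dx scalerA -exprSr.
  move=> /(si_in inv)[c cx].
  have dx' : divisible_d k.+1 x (T *: y) by rewrite /divisible_d dx scalerA -exprSr.
  have c0 : betaS c = 0.
    rewrite (betaSE dx' cx) bc_ev0_T coh_cls0.
    by have [-> _ _ _] := semilinearB (phi := idfun) (si_pr_lin inv).
  exists (insub0 _ c); rewrite /= insub0_val //; exact: submodule_ker_beta.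
- by move=> a h h'; rewrite /= (si_pr_lin inv) qpi_add qpi_scale.
- move=> c; have [h e] := si_pr_surj inv (qrep c); exists h.
  by rewrite /= e qrepK.
move=> h; rewrite /= qpi_eq0; last exact: submodule_im_beta.
split=> [[c _ bc]|[x [y [dx ->]]]].
  have /(si_in inv)[x [y [dx cx]]] : exists c0, kerB_in (s := S) c0 = kerB_in c by exists c.
  move: bc; rewrite (betaSE dx cx) => /esym/stage_pr_eq hy.
  rewrite -[h](subrK (cl2 y)); apply: submoduleD; first exact: submodule_cok_rel.
    exact: cok_rel_mono.
  by exists x, y.
have : ker_img k (cl1 x) by exists x, y.
by move=> /(si_in inv)[c cx]; exists c => //; apply: betaSE dx cx.
Qed.

End OneStage.

Lemma bstage_inv k : stage_inv (bstage P k).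
Proof.
elim: k => [|k IH]; last exact: next_stage_inv.
split=> //=.
- by move=> h; split=> _; [apply: ker_img0|exists h].
- by move=> c; exists c.
- by move=> h; rewrite cok_rel0.
Qed.

End BocksteinStages.

(** * Ranks of the Bockstein stages *)

Lemma dependent_rows (A : idomainType) n (C : 'M[A]_(n.+1, n)) :
  exists r : 'rV[A]_n.+1, r != 0 /\ r *m C = 0.
Proof.
elim: n C => [|n IH] C.
  by exists (const_mx 1); split; [apply/eqP => /rowP/(_ 0)/eqP; rewrite !mxE oner_eq0|exact: thinmx0].
have [C0|[i Ci]] : (forall i, C i 0 = 0) \/ exists i, C i 0 != 0.
  by apply: contrapT => /not_orP[h1 h2]; apply: h1 => i; apply/eqP/negPn/negP => h;
     apply: h2; exists i.
  pose D : 'M[A]_(1 + n.+1, 1 + n) := C.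
  have [r [r0 rE]] := IH (drsubmx D).
  exists (row_mx (0 : 'rV_1) r); split.
    apply: contra_neq r0 => e; rewrite -(row_mxKr (0 : 'rV_1) r).
    by rewrite [row_mx _ _]e; apply/rowP => k; rewrite !mxE.
  have dl0 : dlsubmx D = 0.
    apply/matrixP => k l; rewrite ord1 !mxE.
    by rewrite (_ : lshift n 0 = 0) ?C0 //; apply/val_inj.
  have : row_mx (0 : 'rV_1) r *m block_mx (ulsubmx D) (ursubmx D) (dlsubmx D) (drsubmx D) = 0.
    by rewrite mul_row_block rE dl0 !mul0mx mulmx0 !add0r row_mx0.
  by rewrite submxK.
pose D : 'M[A]_(1 + n.+1, 1 + n) := xrow i 0 C.
pose c := D 0 0; pose b := ursubmx D; pose d := dlsubmx D; pose E := drsubmx D.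
have DE : D = block_mx c%:M b d E.
  rewrite -[LHS]submxK; congr block_mx; apply/matrixP => k l.
  rewrite !ord1 [RHS]mxE eqxx [LHS]mxE [LHS]mxE.
  have -> : lshift n 0 = 0 :> 'I_(1 + n) by apply/val_inj.
  by have -> : lshift n.+1 0 = 0 :> 'I_(1 + n.+1) by apply/val_inj.
have c0 : c != 0 by rewrite /c /D !mxE tpermR.
have [r [r0 rE]] := IH (c *: E - d *m b).
pose s : 'rV[A]_(1 + n.+1) := row_mx (- (r *m d)) (c *: r).
have sD : s *m D = 0.
  rewrite DE mul_row_block !mulNmx mul_mx_scalar -!scalemxAl addNr.
  by rewrite -mulmxA scalemxAr addrC -mulmxBr rE row_mx0.
exists (s *m tperm_mx i 0); split.
  apply: contra_neq r0 => e; have s0 : s = 0.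
    by rewrite -[s]mulmx1 -(perm_mx1 _ _) -(tperm2 i 0) perm_mxM mulmxA e mul0mx.
  have cr : c *: r = 0.
    by rewrite -(row_mxKr (- (r *m d)) (c *: r)) -/s s0; apply/rowP => k; rewrite !mxE.
  apply/rowP => k; have /rowP/(_ k) := cr; rewrite !mxE => /eqP.
  by rewrite mulf_eq0 (negPf c0) => /eqP.
by rewrite -mulmxA -xrowE.
Qed.

Section Rank.
Variables (A : idomainType) (M : lmodType A).

(** Bases up to nonzero denominators: their length is [rk], and they become bases over any field
    into which A embeds. No freeness of the cohomology over O is thus involved. *)
Definition rational_basis n (u : nat -> M) := indep n u /\
  forall x, exists b (c : nat -> A), b != 0 /\ b *: x = \sum_(k < n) c k *: u k.

Lemma indep_prefix n m (u : nat -> M) : (m <= n)%N -> indep n u -> indep m u.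
Proof.
move=> mn iu c c0 k km; have nm : n = (m + (n - m))%N by rewrite subnKC.
have [||/(_ k km)] // := @indep_cat _ _ m (n - m) u c (fun=> 0).
  by rewrite -nm.
by rewrite c0 add0r big1 // => j _; rewrite scale0r.
Qed.

Lemma rational_basis_max n (u v : nat -> M) : rational_basis n u -> ~ indep n.+1 v.
Proof.
move=> [iu gu] iv; have [b bP] := choice gu; have [c cP] := choice bP.
have [r [r0 rC]] := dependent_rows (\matrix_(i < n.+1, j < n) c (v i) j).
have [R RP] := extend_ord 0 (fun i : 'I_n.+1 => r 0 i * b (v i)).
apply/negP: r0; apply/negPn/eqP/rowP => i; rewrite mxE; apply/eqP.
have /eqP : R i = 0.
  apply: (iv R _ i (ltn_ord i)).
  under eq_bigr do rewrite RP -scalerA (cP _).2 scaler_sumr.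
  rewrite exchange_big big1 //= => j _.
  under eq_bigr do rewrite scalerA.
  rewrite -scaler_suml; have /rowP/(_ j) := rC; rewrite !mxE => e.
  rewrite (_ : \sum_i0 _ = 0) ?scale0r // -[RHS]e.
  by apply: eq_bigr => k _; rewrite mxE.
by rewrite RP mulf_eq0 (negPf (cP (v i)).1) orbF.
Qed.

Lemma rk_rational_basis n (u : nat -> M) : rational_basis n u -> rk M = n.
Proof.
move=> ub; have nx := rational_basis_max ub; rewrite /rk; case: xgetP => [m _ [[v iv] mx]|none].
  apply/eqP; rewrite eqn_leq; apply/andP; split; rewrite leqNgt; apply/negP => h.
    exact: nx v (indep_prefix h iv).
  by apply: mx; exists u; apply: indep_prefix h ub.1.
by case: (none n); split; [exists u; exact: ub.1|case=> v; exact: nx].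
Qed.

Lemma rational_basis_bc (K : fieldType) (io : {rmorphism A -> K}) n (u : nat -> M) :
  injective io -> rational_basis n u -> is_basis n (fun k => bc1 io (u k)).
Proof.
move=> io_inj [iu gu]; apply: bc_basis => // x; have [b [c [b0 bx]]] := gu x.
exists b, (io b)^-1, c; split=> //; rewrite divff //.
by rewrite -(rmorph0 io) (inj_eq io_inj).
Qed.

End Rank.

Lemma rk_bij (A : comNzRingType) (M N : lmodType A) (f : M -> N) :
  semilin idfun f -> bijective f -> rk M = rk N.
Proof.
move=> fl [g fK gK].
have gl : semilin idfun g.
  by move=> a x y; apply: (can_inj fK); rewrite gK fl !gK.
have tr (M' N' : lmodType A) (h : M' -> N') n : semilin idfun h -> injective h ->
    (exists u : nat -> M', indep n u) -> exists u : nat -> N', indep n u.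
  move=> hl hi [u iu]; exists (h \o u) => c; rewrite /= -(semilin_sum (phi := idfun) hl).
  have [h0 _ _ _] := semilinearB (phi := idfun) hl.
  by rewrite -[RHS]h0 => /hi; apply: iu.
have eqn n : (exists u : nat -> M, indep n u) = (exists u : nat -> N, indep n u).
  by apply/propext; split; apply: tr => //; [apply: can_inj fK|apply: can_inj gK].
by rewrite /rk; congr (xget _ _); apply/funext => n; rewrite /mkset !eqn.
Qed.

Section ModelCohomologyRank.
Variables (A R : comNzRingType) (F : fieldType) (phi : {rmorphism A -> R}).
Variables (psi : {rmorphism R -> F}) (V : cpx A) (n : int -> nat) (h1 h2 : nat).
Hypotheses (psi_inj : injective psi) (phi_inj : injective phi).
Variables (m : int -> nat) (a : forall i, nat -> V i) (alpha : nat -> A).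
Hypothesis mo : model phi n h1 h2 m a alpha.

Lemma model_dual : exists u' : forall i, nat -> mdual (bcC phi V i),
  forall i, dual_families (n i) (fun k => bc1 phi (a i k) : bcC phi V i) (u' i).
Proof.
pose u' i := sval (cid (dual_exists (model_basis mo i))).
by exists u' => i; apply: svalP (cid (dual_exists (model_basis mo i))).
Qed.

Lemma model_coh_indep i :
  indep (coh_dim h1 h2 i) (fun k => coh_cls (a i (coh_start m i + k)%N)).
Proof.
have [u' uu'] := model_dual; have sp := model_split mo => c.
have dH k : (k < coh_dim h1 h2 i)%N -> cd V i (i + 1) (a i (coh_start m i + k)%N) = 0.
  exact: (split_coh_cocycle sp).
rewrite -(coh_cls_sum c dH) => /coh_cls_eq0[|w e k kh].
  exact: (submodule_comb c (submodule_cocycle V i) dH).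
apply: phi_inj; rewrite rmorph0.
have := dual_coord_coboundary_coh mo uu' (bc1 phi w) kh.
rewrite (bcC_d1 phi (V := V)) -e (bc1_sum phi _ c (fun k => a i (coh_start m i + k)%N)).
rewrite (dpair_sum _ (coh_dim h1 h2 i) (fun k => phi (c k))
  (fun k => bc1 phi (a i (coh_start m i + k)%N))) => <-.
rewrite -[LHS](sum_mul_delta (fun k => phi (c k)) kh); apply: eq_bigr => l _; congr (_ * _).
by rewrite uu' ?eqn_add2l 1?eq_sym // (coh_bound sp).
Qed.

End ModelCohomologyRank.

Section BocksteinRanks.
Variables (O : idomainType) (K : fieldType) (io : {rmorphism O -> K}).
Hypothesis io_inj : injective io.
Variables (P : cpx (series O)) (n : int -> nat) (lo : int) (len : nat).
Hypothesis P_perfect : perfect_cpx P n lo len.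
Local Notation phi := (@to_locI O).
Local Notation T := (@tX O).
Local Notation ev := (@ev0 O).
Variables (m : int -> nat) (h1 h2 : nat) (u : forall i, nat -> P i) (a : nat -> nat).
Hypothesis mo : model phi n h1 h2 m u (fun k => T ^+ a k).
Hypothesis am : forall k l, (k <= l)%N -> (l < m 1)%N -> (a k <= a l)%N.
Local Notation cl1 x := (coh_cls (V := C0 P) (i := 1) (bc1 ev x)).
Local Notation cl2 y := (coh_cls (V := C0 P) (i := 2) (bc1 ev y)).
Let sp := model_split mo.
Let phi_inj := @to_locI_inj O.
Let frac_inj := @locI_frac_inj O.

Lemma perfect_free i : exists k (w : nat -> P i), is_basis k w.
Proof. by have [w wb] := P_perfect.1 i; exists (n i), w. Qed.

Let P_free := perfect_free.

Lemma rk_coh1 : rk (coh P 1) = h1.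
Proof.
have [u' uu'] := model_dual mo.
apply: (rk_rational_basis (u := fun k => coh_cls (u 1 (m 0 + m 1 + k)%N))); split.
  exact: (model_coh_indep phi_inj mo (i := 1)).
move=> c; have [b [b' [d [bb' bc]]]] := model_coh1 frac_inj phi_inj mo uu' c.
exists b, d; split=> //; apply/eqP => b0.
by have := to_locI_unit bb'; apply; rewrite b0.
Qed.

Lemma rk_coh2 : rk (coh P 2) = h2.
Proof.
have [u' uu'] := model_dual mo.
apply: (rk_rational_basis (u := fun k => coh_cls (u 2 (m 1 + m 2 + k)%N))); split.
  exact: (model_coh_indep phi_inj mo (i := 2)).
move=> c; have [b [b' [d [bb' bc]]]] := model_coh2 frac_inj phi_inj mo uu' c.
(* T^N with N the sum of all exponents kills every torsion class of the model at once. *)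
pose N := (\sum_(k < m 1) a k)%N.
exists (T ^+ N * b), (fun k => T ^+ N * d (m 1 + m 2 + k)%N); split.
  rewrite mulf_neq0 ?tXn_neq0 //; apply/eqP => b0.
  by have := to_locI_unit bb'; apply; rewrite b0.
rewrite -scalerA bc scalerDr scaler_sumr big1 ?add0r; last first.
  move=> k _; rewrite scalerA mulrC -scalerA.
  have akN : (a k <= N)%N by rewrite /N (bigD1 k) //= leq_addr.
  rewrite -(subnK akN) exprD -scalerA.
  have -> : T ^+ a k *: coh_cls (u 2 (cobound_start m 2 + k)%N) = 0.
    exact: (coh_cls_cobound2 mo (ltn_ord k)).
  by rewrite !scaler0.
exact: (scaler_comb (T ^+ N) h2 (fun k => d (m 1 + m 2 + k)%N)
  (fun k => coh_cls (u 2 (m 1 + m 2 + k)%N))).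
Qed.

(* The exponents being sorted, those at most l are the first off l ones. *)
Definition off (l : nat) : nat := find (fun k => (l < a k)%N) (iota 0 (m 1)).

Lemma off_le l : (off l <= m 1)%N.
Proof. by rewrite -[X in (_ <= X)%N](size_iota 0) find_size. Qed.

Lemma offE l k : (k < m 1)%N -> (a k <= l)%N = (k < off l)%N.
Proof.
move=> km; case: (ltnP k (off l)) => h.
  have := before_find 0%N h; rewrite nth_iota ?add0n //.
  by rewrite ltnNge => /negbFE.
have om := leq_ltn_trans h km.
have := nth_find 0%N (_ : has (fun k => (l < a k)%N) (iota 0 (m 1))).
rewrite has_find size_iota -/(off l) om nth_iota // add0n => /(_ isT) la.
by apply/negbTE; rewrite -ltnNge (leq_trans la) // am.
Qed.

Lemma off_mono l : (off l <= off l.+1)%N.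
Proof.
rewrite leqNgt; apply/negP => h; have hm := leq_trans h (off_le l).
by move: (h); rewrite -offE // => /leqW; rewrite offE // ltnn.
Qed.

Lemma off0_le l : (off 0 <= off l)%N.
Proof. by elim: l => // l IH; apply: leq_trans IH (off_mono l). Qed.

(** Modulo T the differential survives only on the lifts with exponent 0, and positive exponents
    occur in degree 1 alone. *)
Definition m0 (i : int) : nat := if i == 1 then off 0 else m i.
Let g := (m 1 - off 0)%N.
Let u0 i k : C0 P i := bc1 ev (u i k).

Lemma m0E : (m 1 = off 0 + g)%N. Proof. by rewrite /g subnKC // off_le. Qed.

Lemma lift_start0 i : lift_start m0 i = lift_start m i.
Proof.
rewrite /lift_start /m0; case: (i - 1 =P 1) => // i1.
by have -> : i = 2 by rewrite -[i](subrK 1) i1.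
Qed.

Lemma cobound_start0 i : cobound_start m0 i = cobound_start m i.
Proof. by rewrite /cobound_start /m0; case: (i =P 1) => [->|]. Qed.

Lemma gen_denom i (x : P i) : exists b (c : nat -> series O), ~ Ipow 1 b /\ b *: x = \sum_(k < n i) c k *: u i k.
Proof.
by have [b [b' [c [/to_locI_unit Ib bx]]]] := model_gen mo x; exists b, c.
Qed.

Lemma model0_gen i (x : C0 P i) : exists b b' (c : nat -> O),
  io b * b' = 1 /\ b *: x = \sum_(k < n i) c k *: u0 i k.
Proof.
have [x' ->] := bc_ev0_surj x; have [b [c [Ib bx]]] := gen_denom x'.
exists (b 0%N), (io (b 0%N))^-1, (fun k => c k 0%N).
split; first by rewrite divff // io_neq0.
transitivity (bc1 ev (b *: x')); first by rewrite bc1Z.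
by rewrite bx bc1_sum.
Qed.

(** The g lifts of degree 1 with positive exponent and their g targets in degree 2 become
    cohomology. As the exponents are sorted these are the last vectors of their blocks, so the
    layout of the lists is preserved and all remaining coefficients are 1. *)
Lemma model0 : model io n (g + h1) (g + h2) m0 u0 (fun=> 1).
Proof.
split=> [| |i|k km].
- split=> [i|i k km|i k kn nk].
  + rewrite (split_rank sp) /coh_dim /m0.
    case: (i =P 1) => [->|i1] /=; first by rewrite m0E; lia.
    case: (i =P 2) => [->|i2] /=; first by rewrite m0E; lia.
    by case: (i - 1 =P 1) => // e; case: i2; rewrite -[i](subrK 1) e.
  + rewrite lift_start0 cobound_start0 if_same scale1r [LHS]bcC_d1.
    have km' : (k < m i)%N.
      move: km; rewrite /m0; case: (i =P 1) => // -> h; exact: leq_trans h (off_le 0).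
    rewrite (split_lift sp km'); case: (i =P 1) => [i1|_]; last by rewrite scale1r.
    move: km; rewrite i1 /m0 eqxx -offE; last by rewrite -i1.
    by rewrite leqn0 => /eqP ->; rewrite expr0 scale1r.
  + rewrite [LHS]bcC_d1; have [nk'|] := boolP (~~ (lift_start m i <= k < lift_start m i + m i)%N).
      by rewrite (split_cocycle sp kn nk') bc1_0.
    rewrite negbK => /andP[k1 k2]; move: nk; rewrite lift_start0 k1 /= -leqNgt /m0.
    case: (i =P 1) => [i1|_ h]; last by move: k2; rewrite ltnNge h.
    subst i; move=> k3; have jm : (k - lift_start m 1 < m 1)%N by rewrite ltn_subLR.
    have -> : k = (lift_start m 1 + (k - lift_start m 1))%N by rewrite subnKC.
    rewrite (split_lift sp jm) eqxx.
    have : ~~ (a (k - lift_start m 1) <= 0)%N by rewrite offE // -leqNgt leq_subRL.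
    by case: (a _) => // j _; rewrite exprS -scalerA; apply: bc_ev0_T.
- exact: model0_gen.
- have [w wb] := P_perfect.1 i.
  have wb0 : is_basis (n i) (fun k => bc1 io (bc1 ev (w k))).
    apply: bc_basis; first exact: (perfect_bc_basis ev wb).1.
    move=> x; have [c xc] := (perfect_bc_basis ev wb).2 x.
    by exists 1, 1, c; rewrite rmorph1 mulr1 scale1r.
  by apply: (basis_of_generates wb0); apply: bc_generates; apply: model0_gen.
- by rewrite rmorph1 oner_neq0.
Qed.

End BocksteinRanks.

(** * Bases and ranks of the Bockstein stages *)

Section StageRanks.
Variables (O : idomainType) (K : fieldType) (io : {rmorphism O -> K}).
Hypothesis io_inj : injective io.
Variables (P : cpx (series O)) (n : int -> nat) (lo : int) (len : nat).
Hypothesis P_perfect : perfect_cpx P n lo len.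
Local Notation phi := (@to_locI O).
Local Notation T := (@tX O).
Local Notation ev := (@ev0 O).
Variables (m : int -> nat) (h1 h2 : nat) (u : forall i, nat -> P i) (a : nat -> nat).
Hypothesis mo : model phi n h1 h2 m u (fun k => T ^+ a k).
Hypothesis am : forall k l, (k <= l)%N -> (l < m 1)%N -> (a k <= a l)%N.
Variable u' : forall i, nat -> mdual (bcC phi P i).
Hypothesis uu' : forall i, dual_families (n i) (fun k => bc1 phi (u i k) : bcC phi P i) (u' i).
Local Notation cl1 x := (coh_cls (V := C0 P) (i := 1) (bc1 ev x)).
Local Notation cl2 y := (coh_cls (V := C0 P) (i := 2) (bc1 ev y)).
Local Notation off := (off m a).
Let sp := model_split mo.
Let P_free := perfect_free P_perfect.
Let mo0 := model0 io_inj P_perfect mo am.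

Definition coordI i k (x : P i) : locI O := dpair (u' i k) (bc1 phi x).
(** Coordinates over Lambda_I reduced modulo I: they test independence of classes of C_0 directly on
    representatives in P. *)
Definition coord i k (x : P i) : K := evR io_inj (coordI k x).

Lemma coordI_lin i k c (x y : P i) : coordI k (c *: x + y) = phi c * coordI k x + coordI k y.
Proof. by rewrite /coordI bc1D bc1Z dpairDr dpairZr. Qed.

Lemma coord_lin i k c (x y : P i) : coord k (c *: x + y) = io (c 0%N) * coord k x + coord k y.
Proof. by rewrite /coord coordI_lin rmorphD rmorphM /= evR_to. Qed.

Lemma coord0 i k : coord k (0 : P i) = 0.
Proof. by rewrite /coord /coordI bc1_0 dpair0r rmorph0. Qed.

Lemma coordD i k (x y : P i) : coord k (x + y) = coord k x + coord k y.
Proof. by rewrite -[x]scale1r coord_lin series0_1 rmorph1 mul1r scale1r. Qed.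

Lemma coordZ i k c (x : P i) : coord k (c *: x) = io (c 0%N) * coord k x.
Proof. by rewrite -[_ *: _]addr0 coord_lin coord0 addr0. Qed.

Lemma coordB i k (x y : P i) : coord k (x - y) = coord k x - coord k y.
Proof.
by rewrite -scaleN1r coordD coordZ -[(-1 : series O) 0%N]/(- (1 : O)) rmorphN rmorph1 mulN1r.
Qed.

Lemma coordT i k (x : P i) : coord k (T *: x) = 0.
Proof. by rewrite coordZ rmorph0 mul0r. Qed.

Lemma coord_u i k l : (k < n i)%N -> (l < n i)%N -> coord k (u i l) = (k == l)%:R.
Proof. by move=> kn ln; rewrite /coord /coordI uu' // rmorph_nat. Qed.

Lemma coord_sum i k N (c : nat -> series O) (x : nat -> P i) :
  coord k (\sum_(l < N) c l *: x l) = \sum_(l < N) io (c l 0%N) * coord k (x l).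
Proof.
elim: N => [|N IH]; first by rewrite !big_ord0 coord0.
by rewrite !big_ord_recr /= coordD coordZ IH.
Qed.

Lemma coord_comb i k N (c : nat -> series O) (f : nat -> nat) :
  {in gtn N &, injective f} -> (forall l, (l < N)%N -> (f l < n i)%N) -> (k < N)%N ->
  coord (f k) (\sum_(l < N) c l *: u i (f l)) = io (c k 0%N).
Proof.
move=> fi fn kN; rewrite (coord_sum (f k) N c (fun l => u i (f l))).
rewrite -[RHS](sum_mul_delta (fun l => io (c l 0%N)) kN); apply: eq_bigr => l _.
congr (_ * _); rewrite coord_u ?fn //; congr (nat_of_bool _)%:R.
by apply/eqP/eqP => [/fi ->|->] //; rewrite ?inE.
Qed.

Lemma n1E : n 1 = (m 0 + (m 1 + h1))%N.
Proof. by rewrite (split_rank sp) addnA. Qed.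

Lemma n2E : n 2 = (m 2 + (m 1 + h2))%N.
Proof. by rewrite (split_rank sp) addnA [(m 2 + _)%N]addnC. Qed.

Lemma coordI_d k x : (k < m 1 + h2)%N -> coordI (m 2 + k)%N (cd P 1 2 x) =
  if (k < m 1)%N then coordI (m 0 + k)%N x * phi T ^+ a k else 0.
Proof.
move=> kn; rewrite /coordI -(bcC_d1 phi (V := P)).
have kn2 : (m 2 + k < n 2)%N by rewrite n2E ltn_add2l.
have := dual_coord_d (model_split_bc mo) (model_basis mo) uu' (i := 1) (bc1 phi x) kn2.
rewrite -[cobound_start m (1 + 1)]/(m 2) -[lift_start m 1]/(m 0) leq_addr ltn_add2l addKn.
by move=> ->; rewrite andTb eqxx rmorphXn.
Qed.

Lemma phiT_lreg l (x y : locI O) : phi T ^+ l * x = phi T ^+ l * y -> x = y.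
Proof.
move=> e; apply: (@locI_frac_inj O); have := congr1 (@locI_frac O) e.
rewrite !rmorphM rmorphXn /=; apply: mulfI; rewrite expf_neq0 //.
by rewrite locI_frac_to tofrac_eq0 -[tX O]expr1 tXn_neq0.
Qed.

Lemma phiTX_ev l (x : locI O) : (0 < l)%N -> evR io_inj (phi T ^+ l * x) = 0.
Proof.
by case: l => // l _; rewrite rmorphM rmorphXn /= evR_to rmorph0 expr0n mul0r.
Qed.

(** For an exponent a k larger than l, the coordinate of y is T^(a k - l) times one of x and so
    reduces to 0. Beyond m 1 the coordinate of a differential is zero outright. *)
Lemma coord_divisible2 l x y k : divisible_d l x y -> (off l <= k < m 1 + h2)%N ->
  coord (m 2 + k)%N y = 0.
Proof.
move=> dx /andP[ok kn]; have := coordI_d x kn; rewrite dx /coordI bc1Z dpairZr -/(coordI _ y).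
rewrite rmorphXn /=; case: (ltnP k (m 1)) => km e; last first.
  rewrite /coord (_ : coordI _ _ = 0) ?rmorph0 //; apply: (@phiT_lreg l).
  by rewrite e mulr0.
have lk : (l < a k)%N by rewrite ltnNge (offE am) // -leqNgt.
have yE : coordI (m 2 + k)%N y = phi T ^+ (a k - l) * coordI (m 0 + k)%N x.
  apply: (@phiT_lreg l); rewrite [LHS]e mulrA -exprD subnKC ?(ltnW lk) //.
  by rewrite mulrC.
by rewrite /coord yE phiTX_ev // subn_gt0.
Qed.

(** Here the exponent a k is at most l, and cancelling T^(a k) leaves a factor T^(l + 1 - a k),
    still a positive power, in the coordinate of x. *)
Lemma coord_divisible1 l x y k : divisible_d l.+1 x y -> (k < off l)%N ->
  coord (m 0 + k)%N x = 0.
Proof.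
move=> dx ko; have km := leq_trans ko (off_le m a l).
have := coordI_d x (ltn_addr h2 km); rewrite dx /coordI bc1Z dpairZr -/(coordI _ y) km.
rewrite rmorphXn /= => e; have al : (a k <= l)%N by rewrite (offE am).
have xE : coordI (m 0 + k)%N x = phi T ^+ (l.+1 - a k) * coordI (m 2 + k)%N y.
  apply: (@phiT_lreg (a k)); rewrite mulrC -[LHS]e mulrA -exprD subnKC //.
  exact: leqW.
by rewrite /coord xE phiTX_ev // subn_gt0 ltnS.
Qed.

(** The numbering skips the m 0 coboundaries in degree 1 and, for [e2], the m 2 lifts in degree 2.
    For k below m 1 the same k then names a lift and its coboundary; from m 1 on it names the
    vectors spanning the cohomology over Lambda_I. *)
Definition e1 k := cl1 (u 1 (m 0 + k)%N).
Definition e2 k := cl2 (u 2 (m 2 + k)%N).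

Lemma divisible_lift l k : (off l <= k < m 1 + h1)%N ->
  divisible_d l.+1 (u 1 (m 0 + k)%N)
    (if (k < m 1)%N then T ^+ (a k - l.+1) *: u 2 (m 2 + k)%N else 0).
Proof.
move=> /andP[ok kn]; rewrite /divisible_d; case: (ltnP k (m 1)) => km.
  have lk : (l < a k)%N by rewrite ltnNge (offE am) // -leqNgt.
  by rewrite [LHS](split_lift sp (i := 1) km) scalerA -exprD subnKC.
rewrite scaler0; apply: (split_cocycle sp (i := 1)); first by rewrite n1E ltn_add2l.
by rewrite negb_and -!leqNgt leq_add2l km orbT.
Qed.

Lemma u2_cocycle k : (k < m 1 + h2)%N -> cd P 2 (2 + 1) (u 2 (m 2 + k)%N) = 0.
Proof.
move=> kn; apply: (split_cocycle sp (i := 2)); first by rewrite n2E ltn_add2l.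
by rewrite add0n negb_and -leqNgt leq_addr orbT.
Qed.

Lemma e2_cok_rel l k : (k < off l)%N -> cok_rel l (e2 k).
Proof.
move=> ko; have km := leq_trans ko (off_le m a l).
have al : (a k <= l)%N by rewrite (offE am).
exists (T ^+ (l - a k) *: u 1 (m 0 + k)%N), (u 2 (m 2 + k)%N); split=> //.
rewrite /divisible_d linearZ -[T ^+ l](congr1 _ (subnK al)) exprD -scalerA; congr (_ *: _).
exact: (split_lift sp (i := 1) km).
Qed.

Lemma coord_cls1 x x' k : cd (C0 P) 1 (1 + 1) (bc1 ev x) = 0 ->
  cd (C0 P) 1 (1 + 1) (bc1 ev x') = 0 -> (k < m 1 + h1)%N -> cl1 x = cl1 x' ->
  coord (m 0 + k)%N x = coord (m 0 + k)%N x'.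
Proof.
move=> dx dx' kn /(cl1_eq P_free dx dx')[w [q e]].
apply/eqP; rewrite -subr_eq0 -coordB e coordD coordT addr0 /coord /coordI.
rewrite -(bcC_d1 phi (V := P)) (dual_coord_coboundary (model_split_bc mo) (model_basis mo) uu' (i := 1)).
- by rewrite rmorph0.
- by rewrite n1E ltn_add2l.
have : ~~ (0 <= m 0 + k < 0 + m 0)%N by rewrite add0n leq0n -leqNgt leq_addr.
exact.
Qed.

Lemma coord_cls2 y y' k : cd (C0 P) 2 (2 + 1) (bc1 ev y) = 0 ->
  cd (C0 P) 2 (2 + 1) (bc1 ev y') = 0 -> (off 0 <= k < m 1 + h2)%N -> cl2 y = cl2 y' ->
  coord (m 2 + k)%N y = coord (m 2 + k)%N y'.
Proof.
move=> dy dy' kn /(cl2_eq P_free dy dy')[w [q e]].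
apply/eqP; rewrite -subr_eq0 -coordB e coordD coordT addr0.
apply/eqP; apply: (@coord_divisible2 0 w) => //.
by rewrite /divisible_d expr0 scale1r.
Qed.

Definition comb1 o N (c : nat -> O) : P 1 :=
  \sum_(j < N) (series_C (c j) : series O) *: u 1 (m 0 + (o + j))%N.
Definition comb2 o N (c : nat -> O) : P 2 :=
  \sum_(j < N) (series_C (c j) : series O) *: u 2 (m 2 + (o + j))%N.

Lemma e1_cocycle k : (off 0 <= k < m 1 + h1)%N ->
  cd (C0 P) 1 (1 + 1) (bc1 ev (u 1 (m 0 + k)%N)) = 0.
Proof. by move=> kn; apply: divisible_cocycle1 (divisible_lift kn). Qed.

Lemma e2_cocycle k : (k < m 1 + h2)%N -> cd (C0 P) 2 (2 + 1) (bc1 ev (u 2 (m 2 + k)%N)) = 0.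
Proof. by move=> kn; apply: bcC_cocycle; apply: u2_cocycle. Qed.

Lemma comb1P o N c : (off 0 <= o)%N -> (o + N <= m 1 + h1)%N ->
  cd (C0 P) 1 (1 + 1) (bc1 ev (comb1 o N c)) = 0 /\
  cl1 (comb1 o N c) = \sum_(j < N) c j *: e1 (o + j)%N.
Proof.
move=> oo oN; have dc j : (j < N)%N -> cd (C0 P) 1 (1 + 1) (bc1 ev (u 1 (m 0 + (o + j))%N)) = 0.
  move=> jN; apply: e1_cocycle; rewrite (leq_trans oo (leq_addr _ _)).
  by rewrite (leq_trans _ oN) // ltn_add2l.
have e : bc1 ev (comb1 o N c) = \sum_(j < N) c j *: bc1 ev (u 1 (m 0 + (o + j))%N).
  exact: (bc1_sum ev N (fun j => series_C (c j) : series O) (fun j => u 1 (m 0 + (o + j))%N)).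
rewrite e; split; first exact: (submodule_comb c (submodule_cocycle (C0 P) 1) dc).
exact: (coh_cls_sum c dc).
Qed.

Lemma comb2P o N c : (o + N <= m 1 + h2)%N ->
  cd (C0 P) 2 (2 + 1) (bc1 ev (comb2 o N c)) = 0 /\
  cl2 (comb2 o N c) = \sum_(j < N) c j *: e2 (o + j)%N.
Proof.
move=> oN; have dc j : (j < N)%N -> cd (C0 P) 2 (2 + 1) (bc1 ev (u 2 (m 2 + (o + j))%N)) = 0.
  by move=> jN; apply: e2_cocycle; rewrite (leq_trans _ oN) // ltn_add2l.
have e : bc1 ev (comb2 o N c) = \sum_(j < N) c j *: bc1 ev (u 2 (m 2 + (o + j))%N).
  exact: (bc1_sum ev N (fun j => series_C (c j) : series O) (fun j => u 2 (m 2 + (o + j))%N)).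
rewrite e; split; first exact: (submodule_comb c (submodule_cocycle (C0 P) 2) dc).
exact: (coh_cls_sum c dc).
Qed.

Lemma coord_comb1 o N c j : (o + N <= m 1 + h1)%N -> (j < N)%N ->
  coord (m 0 + (o + j))%N (comb1 o N c) = io (c j).
Proof.
move=> oN jN; apply: (coord_comb (fun j => series_C (c j) : series O)
  (f := fun j => (m 0 + (o + j))%N)) => // [k l _ _ /addnI/addnI//|l lN].
by rewrite n1E ltn_add2l (leq_trans _ oN) // ltn_add2l.
Qed.

Lemma coord_comb2 o N c j : (o + N <= m 1 + h2)%N -> (j < N)%N ->
  coord (m 2 + (o + j))%N (comb2 o N c) = io (c j).
Proof.
move=> oN jN; apply: (coord_comb (fun j => series_C (c j) : series O)
  (f := fun j => (m 2 + (o + j))%N)) => // [k l _ _ /addnI/addnI//|l lN].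
by rewrite n2E ltn_add2l (leq_trans _ oN) // ltn_add2l.
Qed.

Lemma unit_neq0 (b : O) b' : io b * b' = 1 -> b != 0.
Proof. by move=> e; apply/eqP => b0; move: e; rewrite b0 rmorph0 mul0r => /esym/eqP; rewrite oner_eq0. Qed.

Lemma off0_split h : (off 0 + (m 1 - off 0 + h) = m 1 + h)%N.
Proof. by rewrite addnA subnKC // off_le. Qed.

Lemma e1_gen h : exists (b : O) (d : nat -> O), b != 0 /\
  b *: h = \sum_(k < m 1 - off 0 + h1) d k *: e1 (off 0 + k)%N.
Proof.
have [w ww] := model_dual mo0.
have [b [b' [d [bb' bh]]]] := model_coh1 (psi := idfun : {rmorphism K -> K}) (@inj_id K) io_inj mo0 ww h.
exists b, d; split; first exact: unit_neq0 bb'.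
by rewrite bh; apply: eq_bigr => k _; rewrite /e1 addnA.
Qed.

Lemma e2_gen h : exists (b : O) (d : nat -> O), b != 0 /\
  b *: h = \sum_(k < m 1 - off 0 + h2) d k *: e2 (off 0 + k)%N.
Proof.
have [w ww] := model_dual mo0.
have [b [b' [d [bb' bh]]]] := model_coh2 (psi := idfun : {rmorphism K -> K}) (@inj_id K) io_inj mo0 ww h.
exists b, (fun k => d (m0 m a 1 + m0 m a 2 + k)%N); split; first exact: unit_neq0 bb'.
rewrite bh big1 ?add0r => [|k _].
  by apply: eq_bigr => k _; rewrite /e2 addnA [(m 2 + _)%N]addnC.
by have := coh_cls_cobound2 mo0 (ltn_ord k); rewrite scale1r => ->; rewrite scaler0.
Qed.

Section Stage.
Variable l : nat.
Let S := bstage P l.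
Let inv := bstage_inv P_free l.
Local Notation ok := (off l).
Local Notation Nk := (m 1 + h1 - off l)%N.
Local Notation Nc := (m 1 + h2 - off l)%N.

Definition kap (k : nat) : ker_beta P l := xget 0 [set c | kerB_in (s := S) c = e1 k].
Definition cok (k : nat) : coker_beta P l := cokB_pr S (e2 k).

Lemma kapE k : (ok <= k < m 1 + h1)%N -> kerB_in (s := S) (kap k) = e1 k.
Proof.
move=> kn; rewrite /kap; case: xgetP => [c _ //|none].
have : ker_img l (e1 k) by do 2 eexists; split; first exact: divisible_lift kn.
by move=> /(si_in inv)[c ce]; case: (none c).
Qed.

(** The indices from off l up to off (l + 1) are those of exponent exactly l + 1, where dividing the
    differential by T^(l+1) gives the coboundary vector. A larger exponent leaves a factor T, which
    reduction kills. *)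
Lemma beta_kap k : (ok <= k < m 1 + h1)%N ->
  beta (kap k) = if (k < off l.+1)%N then cok k else 0.
Proof.
move=> kn; have := betaSE P_free inv (divisible_lift kn) (kapE kn).
rewrite -/(beta (kap k)) => ->; case/andP: kn => ko kn.
have [p0 _ _ _] := semilinearB (phi := idfun) (si_pr_lin inv).
have z : cokB_pr S (cl2 (0 : P 2)) = 0 by rewrite bc1_0 coh_cls0 p0.
case: (ltnP k (m 1)) => km; last first.
  by rewrite z ltnNge (leq_trans (off_le m a l.+1)).
have lk : (l < a k)%N by rewrite ltnNge (offE am) // -leqNgt.
rewrite -(offE am) //; case: (leqP (a k) l.+1) => al.
  by rewrite (_ : a k - l.+1 = 0)%N ?expr0 ?scale1r //; apply/eqP; rewrite subn_eq0.
rewrite -(subnSK al) exprS -scalerA bc_ev0_T.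
by rewrite -[X in cokB_pr S (coh_cls X)](bc1_0 ev) z.
Qed.

Lemma off_split h : (ok + (m 1 + h - ok) = m 1 + h)%N.
Proof. by rewrite subnKC // (leq_trans (off_le m a l)) ?leq_addr. Qed.

Lemma kap_range j : (j < Nk)%N -> (ok <= ok + j < m 1 + h1)%N.
Proof. by move=> jN; rewrite leq_addr -(off_split h1) ltn_add2l. Qed.

Let kap_lin := si_in_lin inv.
Let cok_lin := si_pr_lin inv.

(** Independence is read off the coordinates in K. For generation, a kernel class is expanded in all
    the [e1], and divisibility of its differential removes the terms of index below off l. *)
Lemma kap_basis : rational_basis Nk (fun j => kap (ok + j)).
Proof.
have ooN : (ok + Nk <= m 1 + h1)%N by rewrite off_split.
have oo : (off 0 + (m 1 - off 0 + h1) <= m 1 + h1)%N by rewrite off0_split.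
have [k0 _ _ _] := semilinearB (phi := idfun) kap_lin.
have sumE (c : nat -> O) : kerB_in (s := S) (\sum_(j < Nk) c j *: kap (ok + j)) =
    \sum_(j < Nk) c j *: e1 (ok + j)%N.
  rewrite (semilin_sum kap_lin Nk c (fun j => kap (ok + j))).
  by apply: eq_bigr => j _; rewrite kapE // kap_range.
split=> [c c0 j jN|c].
  have [dc cE] := comb1P c (off0_le am l) ooN.
  have z : cl1 (comb1 ok Nk c) = cl1 (0 : P 1) by rewrite cE -sumE c0 k0 bc1_0 coh_cls0.
  apply: io_inj; rewrite rmorph0 -(coord_comb1 c ooN jN).
  rewrite (coord_cls1 dc _ _ z) ?coord0 ?bc1_0 ?linear0 //.
  by case/andP: (kap_range jN).
have /(si_in inv)[x [y [dx cx]]] : exists c0, kerB_in (s := S) c0 = kerB_in c by exists c.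
have [b [d [b0 bc]]] := e1_gen (kerB_in c).
have [dd dE] := comb1P d (leqnn _) oo.
have dx1 := divisible_cocycle1 dx.
have bx : cl1 ((series_C b : series O) *: x) = cl1 (comb1 (off 0) (m 1 - off 0 + h1) d).
  rewrite dE -bc cx -[series_C b *: x]addr0 (cl1_comb b dx1).
    by rewrite bc1_0 coh_cls0 addr0.
  by rewrite bc1_0 linear0.
have dbx : cd (C0 P) 1 (1 + 1) (bc1 ev ((series_C b : series O) *: x)) = 0.
  rewrite bc1Z; have := submoduleZ b (submodule_cocycle (C0 P) 1) dx1; exact.
(* These indices have exponent at most l, so [coord_divisible1] annihilates the coordinates. *)
have d0 k : (k < ok - off 0)%N -> d k = 0.
  move=> ko; have ko' : (off 0 + k < ok)%N by rewrite -ltn_subRL.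
  have km : (off 0 + k < m 1 + h1)%N := leq_trans ko' (leq_trans (off_le m a l) (leq_addr _ _)).
  have kg : (k < m 1 - off 0 + h1)%N by rewrite -(ltn_add2l (off 0)) off0_split.
  apply: io_inj; rewrite rmorph0 -(coord_comb1 d oo kg) -(coord_cls1 dbx dd km bx).
  by rewrite coordZ (coord_divisible1 dx ko') mulr0.
exists b, (fun j => d (ok - off 0 + j)%N); split=> //.
apply: (si_in_inj inv).
apply: etrans (esym (sumE (fun j => d (ok - off 0 + j)%N))).
have [_ _ _ kZ] := semilinearB (phi := idfun) kap_lin.
rewrite kZ [LHS]bc.
have -> : (m 1 - off 0 + h1 = (ok - off 0) + Nk)%N.
  by apply/eqP; rewrite -(eqn_add2l (off 0)) off0_split addnA subnKC ?off_split // (off0_le am).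
rewrite (sum_cat (ok - off 0) Nk (fun k => d k *: e1 (off 0 + k)%N)) big1 ?add0r; last first.
  by move=> k _; rewrite d0 ?ltn_ord // scale0r.
by apply: eq_bigr => k _; rewrite addnA subnKC // (off0_le am).
Qed.

(** Elements of [cok_rel l] have zero coordinates from index off l on, which gives independence; the
    classes [e2 k] of smaller index belong to [cok_rel l], so the others generate. *)
Lemma cok_basis : rational_basis Nc (fun j => cok (ok + j)).
Proof.
have ooN : (ok + Nc <= m 1 + h2)%N by rewrite off_split.
have sumE N o (c : nat -> O) : cokB_pr S (\sum_(j < N) c j *: e2 (o + j)%N) = \sum_(j < N) c j *: cok (o + j).
  exact: (semilin_sum cok_lin N c (fun j => e2 (o + j)%N)).
split=> [c c0 j jN|c].
  have [dc cE] := comb2P c ooN.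
  have /(si_pr_ker inv)[x [y [dx yE]]] : cokB_pr S (cl2 (comb2 ok Nc c)) = 0.
    by rewrite cE sumE.
  have jr : (ok <= ok + j < m 1 + h2)%N by rewrite leq_addr -(off_split h2) ltn_add2l.
  apply: io_inj; rewrite rmorph0 -(coord_comb2 c ooN jN).
  rewrite (coord_cls2 dc (divisible_cocycle2 P_free dx) _ yE); first exact: coord_divisible2 dx jr.
  by case/andP: jr => o1 ->; rewrite (leq_trans (off0_le am l)).
have [h <-] := si_pr_surj inv c; have [b [d [b0 bh]]] := e2_gen h.
exists b, (fun j => d (ok - off 0 + j)%N); split=> //.
have [_ _ _ kZ] := semilinearB (phi := idfun) cok_lin.
rewrite -[LHS](kZ b h) bh sumE.
have -> : (m 1 - off 0 + h2 = (ok - off 0) + Nc)%N.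
  by apply/eqP; rewrite -(eqn_add2l (off 0)) off0_split addnA subnKC ?off_split // (off0_le am).
rewrite (sum_cat (ok - off 0) Nc (fun k => d k *: cok (off 0 + k))) big1 ?add0r; last first.
  move=> k _; rewrite (_ : cok _ = 0) ?scaler0 //; apply/(si_pr_ker inv); apply: e2_cok_rel.
  by rewrite -ltn_subRL ltn_ord.
by apply: eq_bigr => k _; rewrite addnA subnKC // (off0_le am).
Qed.

Lemma beta_lin : semilin idfun (@beta O P l).
Proof. exact: (betaS_semilin P_free inv). Qed.

Lemma im_basis : rational_basis (off l.+1 - ok)
  (fun j => insub0 (range (@beta O P l)) (cok (ok + j))).
Proof.
have sr : submodule (range (@beta O P l)) := submodule_im_beta P_free inv.
have o1 : (off l.+1 <= m 1)%N := off_le m a l.+1.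
have oS := off_mono am l.
have inr j : (j < off l.+1 - ok)%N -> range (@beta O P l) (cok (ok + j)).
  move=> jN; exists (kap (ok + j)) => //; rewrite beta_kap.
    by rewrite -ltn_subRL jN.
  rewrite leq_addr (leq_trans _ (leq_addr h1 _)) // (leq_trans _ o1) //.
  by rewrite -ltn_subRL.
have vl : semilin idfun (@mval _ _ (range (@beta O P l))) by [].
have sumE (c : nat -> O) : mval (\sum_(j < off l.+1 - ok) c j *:
    insub0 (range (@beta O P l)) (cok (ok + j))) = \sum_(j < off l.+1 - ok) c j *: cok (ok + j).
  rewrite (semilin_sum vl _ c (fun j => insub0 (range (@beta O P l)) (cok (ok + j)))).
  by apply: eq_bigr => j _; rewrite insub0_val //; apply: inr.
split=> [c c0|c].
  have [ic _] := cok_basis; have lN : (off l.+1 - ok <= Nc)%N.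
    by rewrite leq_sub2r // (leq_trans o1) ?leq_addr.
  apply: (indep_prefix lN ic); by rewrite -sumE c0.
have [x _ xc] := mval_in c sr.
have [_ /(_ x)[b [d [b0 bx]]]] := kap_basis.
exists b, d; split=> //; apply/val_inj; rewrite [RHS]sumE.
rewrite -[LHS]/(b *: mval c) -xc.
have [_ _ _ bZ] := semilinearB (phi := idfun) beta_lin.
rewrite -[LHS](bZ b x) bx (semilin_sum beta_lin Nk d (fun j => kap (ok + j))).
have -> : Nk = ((off l.+1 - ok) + (m 1 + h1 - off l.+1))%N.
  apply/eqP; rewrite -(eqn_add2l ok) off_split addnA (subnKC oS) subnKC //.
  by rewrite (leq_trans o1) ?leq_addr.
have jk j : (j < off l.+1 - ok + (m 1 + h1 - off l.+1))%N -> (ok <= ok + j < m 1 + h1)%N.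
  rewrite leq_addr -(ltn_add2l ok) addnA (subnKC oS) subnKC //.
  by rewrite (leq_trans o1) ?leq_addr.
rewrite (sum_cat (off l.+1 - ok) (m 1 + h1 - off l.+1) (fun j => d j *: beta (kap (ok + j)))).
rewrite [X in _ + X = _]big1 ?addr0; last first.
  move=> j _; rewrite beta_kap; last by rewrite jk // ltn_add2l.
  by rewrite addnA subnKC // ltnNge leq_addr scaler0.
apply: eq_bigr => j _; rewrite beta_kap; last by rewrite jk // ltn_addr.
by rewrite -ltn_subRL ltn_ord.
Qed.

End Stage.

Lemma sigma_numE l : sigma_num P l = (m 1 + h1 - off l)%N.
Proof. exact: rk_rational_basis (kap_basis l). Qed.

Lemma tau_numE l : tau_num P l = (m 1 + h2 - off l)%N.
Proof. exact: rk_rational_basis (cok_basis l). Qed.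

Lemma im_rankE l : im_rank P l.+1 = (off l.+1 - off l)%N.
Proof. exact: rk_rational_basis (im_basis l). Qed.

Lemma e_numE : e_num P = (m 1 + h2 - off 0)%N.
Proof. exact: tau_numE 0. Qed.

End StageRanks.

(** * The invariants of the complex in terms of the exponents *)

Section BocksteinInvariants.
Variables (O : idomainType) (K : fieldType) (io : {rmorphism O -> K}).
Hypothesis io_inj : injective io.
Variables (P : cpx (series O)) (n : int -> nat) (lo : int) (len : nat).
Hypothesis P_perfect : perfect_cpx P n lo len.
Local Notation phi := (@to_locI O).
Local Notation T := (@tX O).
Variables (m : int -> nat) (h1 h2 : nat) (u : forall i, nat -> P i) (a : nat -> nat).
Hypothesis mo : model phi n h1 h2 m u (fun k => T ^+ a k).
Hypothesis am : forall k l, (k <= l)%N -> (l < m 1)%N -> (a k <= a l)%N.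
Local Notation off := (off m a).

Lemma im_rankP l : im_rank P l.+1 = (off l.+1 - off l)%N.
Proof.
have [u' uu'] := model_dual mo.
exact: (im_rankE io_inj P_perfect mo am uu').
Qed.

Lemma off_full : exists N, forall l, (N <= l)%N -> off l = m 1.
Proof.
exists (\sum_(k < m 1) a k)%N => l Nl; apply/eqP; rewrite eqn_leq off_le leqNgt; apply/negP => om.
have : (a (off l) <= l)%N.
  by apply: leq_trans Nl; rewrite (bigD1 (Ordinal om)) //= leq_addr.
by rewrite (offE am) // ltnn.
Qed.

(** [k0] is defined by choice with a default. An integer with the required property exists because
    [off] is eventually constant, whence the images have rank 0 from some stage on. *)
Lemma k0P : is_k0 P (k0 P).
Proof.
have [N NP] := off_full.
have ex : exists k, `[< (0 < k)%N /\ forall l, (k < l)%N -> im_rank P l = 0%N >].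
  exists N.+1; apply/asboolP; split=> // [[//|l]] Nl.
  by rewrite im_rankP !NP ?subnn // ltnW // ltnW.
case: (ex_minnP ex) => k /asboolP[k_gt0 kP] kmin.
suff [k' k'P] : exists k', is_k0 P k'.+1.
  rewrite /k0; case: xgetP => [k1 _ //|none]; by case: (none k').
exists k.-1; rewrite prednK //; split=> // k1 k1_gt0 k1P.
by apply: kmin; apply/asboolP.
Qed.

(** Beyond k0 the images have rank 0, so [off] no longer moves; its eventual value is m 1. *)
Lemma off_k0 : off (k0 P) = m 1.
Proof.
have [_ z _] := k0P; have [N NP] := off_full.
suff e d : off (k0 P + d) = off (k0 P) by rewrite -(e N) NP // leq_addl.
elim: d => [|d IH]; first by rewrite addn0.
have : im_rank P (k0 P + d).+1 = 0%N by apply: z; rewrite ltnS leq_addr.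
rewrite im_rankP => /eqP; rewrite subn_eq0 => e; rewrite addnS -IH.
by apply/eqP; rewrite eqn_leq e (off_mono am).
Qed.

Lemma sigmaE : sigma P = h1.
Proof.
have [u' uu'] := model_dual mo.
by rewrite /sigma (sigma_numE io_inj P_perfect mo am uu') off_k0 addKn.
Qed.

Lemma tauE : tau P = h2.
Proof.
have [u' uu'] := model_dual mo.
by rewrite /tau (tau_numE io_inj P_perfect mo am uu') off_k0 addKn.
Qed.

(** The exponents are grouped by value: the positive value k occurs off k - off (k - 1) times, which
    is the rank of the image of beta^(k). *)
Lemma varrhoE : varrho P = (\sum_(j < m 1) a j)%N.
Proof.
rewrite /varrho -off_k0; elim: (k0 P) => [|l IH].
  rewrite big_nil big1 // => j _; apply/eqP; rewrite -leqn0 (offE am) //.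
  exact: leq_trans (ltn_ord j) (off_le m a 0).
rewrite big_nat_recr //= IH im_rankP -(subnKC (off_mono am l)) addKn.
rewrite (sum_cat (off l) (off l.+1 - off l) a); congr (_ + _)%N.
transitivity (\sum_(j < off l.+1 - off l) l.+1)%N; first by rewrite sum_nat_const card_ord mulnC.
apply: eq_bigr => j _.
have jo : (off l + j < off l.+1)%N by rewrite -ltn_subRL.
have jm := leq_trans jo (off_le m a l.+1).
apply/eqP; rewrite eqn_leq andbC (offE am) // jo ltnNge (offE am) //.
by rewrite -leqNgt leq_addr.
Qed.

End BocksteinInvariants.

(** * Determinants of the Bockstein stages *)

Lemma tens_wedge_mapE (A B : comNzRingType) (psi : {rmorphism A -> B}) p q
    (M N : lmodType A) (M' N' : lmodType B) (g : M -> M') (h : N -> N')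
    (x : nat -> M) (y : nat -> N) (x' : nat -> M') c :
  semilin psi g -> semilin psi h -> (forall i, (i < p)%N -> g (x i) = x' i) ->
  tens_map psi (extp_map psi g) (extp_map psi h) (c *: tpure (wedge p x) (wedge q y)) =
  psi c *: tpure (wedge p x') (wedge q (fun i => h (y i))).
Proof.
move=> gl hl gx; have Gl := extp_map_semilin (n := p) gl; have Hl := extp_map_semilin (n := q) hl.
have [_ _ _ ->] := semilinearB (tens_map_semilin Gl Hl).
have e : wedge p (g \o x) = wedge p x' by apply: eq_wedge.
by rewrite (tens_mapE Gl Hl) (extp_mapE _ _ gl) (extp_mapE _ _ hl) e.
Qed.

Section BocksteinDeterminant.
Variables (O : idomainType) (K : fieldType) (io : {rmorphism O -> K}).
Hypothesis io_inj : injective io.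
Variables (P : cpx (series O)) (n : int -> nat) (lo : int) (len : nat).
Hypothesis P_perfect : perfect_cpx P n lo len.
Local Notation phi := (@to_locI O).
Local Notation T := (@tX O).
Variables (m : int -> nat) (h1 h2 : nat) (u : forall i, nat -> P i) (a : nat -> nat).
Hypothesis mo : model phi n h1 h2 m u (fun k => T ^+ a k).
Hypothesis am : forall k l, (k <= l)%N -> (l < m 1)%N -> (a k <= a l)%N.
Hypothesis h21 : (h2 <= h1)%N.
Local Notation off := (off m a).
Local Notation r := (h1 - h2)%N.
Local Notation kap := (kap m u).
Local Notation cok := (cok m u).
Let P_free := perfect_free P_perfect.

Definition ker_gen l i : Qt io (ker_beta P l) := bc1 io (kap l (off l + i)%N).
Definition coker_gen l i : Qt io (coker_beta P l) := bc1 io (cok l (off l + i)%N).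

Lemma dim_kerE l : dim_ker P r l = (m 1 + h1 - off l)%N.
Proof.
have [u' uu'] := model_dual mo; have o0 := off_le m a 0.
case: l => [|l]; last exact: (sigma_numE io_inj P_perfect mo am uu').
rewrite /dim_ker (e_numE io_inj P_perfect mo am uu'); lia.
Qed.

Lemma dim_cokerE l : dim_coker P l = (m 1 + h2 - off l)%N.
Proof.
have [u' uu'] := model_dual mo.
case: l => [|l]; last exact: (tau_numE io_inj P_perfect mo am uu').
exact: (e_numE io_inj P_perfect mo am uu').
Qed.

Lemma ker_gen_basis l : is_basis (dim_ker P r l) (ker_gen l).
Proof.
have [u' uu'] := model_dual mo; rewrite dim_kerE.
exact: (rational_basis_bc io_inj (kap_basis io_inj P_perfect mo am uu' l)).
Qed.

Lemma coker_gen_basis l : is_basis (dim_coker P l) (coker_gen l).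
Proof.
have [u' uu'] := model_dual mo; rewrite dim_cokerE.
exact: (rational_basis_bc io_inj (cok_basis io_inj P_perfect mo am uu' l)).
Qed.

Lemma cok_eq0 l k : (k < off l)%N -> cok l k = 0.
Proof.
by move=> ko; apply/(si_pr_ker (bstage_inv P_free l)); apply: (e2_cok_rel mo am).
Qed.

Lemma mval_kap l k : (off l.+1 <= k < m 1 + h1)%N -> mval (kap l.+1 k) = kap l k.
Proof.
move=> kn; apply: (si_in_inj (bstage_inv P_free l)).
transitivity (e1 m u k); first exact: (kapE P_perfect mo am (l := l.+1) kn).
rewrite (kapE P_perfect mo am) //; case/andP: kn => ok ->; rewrite andbT.
exact: leq_trans (off_mono am l) ok.
Qed.

(** [beta] sends the first [rr] generators of the kernel to the first [rr] generators of the
    cokernel and kills the rest, so the bases are adapted with all coefficients equal to 1. The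
    survivors are the generators of the next stage. *)
Lemma det_stepP l Y Y' : dual_families (dim_coker P l) (coker_gen l) Y ->
  dual_families (dim_coker P l.+1) (coker_gen l.+1) Y' ->
  linear (@det_step O K io P r l) /\
  @det_step O K io P r l (tpure (wedge (dim_ker P r l) (ker_gen l)) (wedge (dim_coker P l) Y)) =
    tpure (wedge (dim_ker P r l.+1) (ker_gen l.+1)) (wedge (dim_coker P l.+1) Y').
Proof.
move=> dY dY'.
have oS := off_mono am l; have o1 := off_le m a l.+1.
pose c := dim_ker P r l.+1; pose t := dim_coker P l.+1; pose rr := (off l.+1 - off l)%N.
have kE : dim_ker P r l = (rr + c)%N by rewrite /c !dim_kerE /rr; lia.
have cE : dim_coker P l = (rr + t)%N by rewrite /t !dim_cokerE /rr; lia.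
have roff i : (off l + (rr + i) = off l.+1 + i)%N by rewrite addnA subnKC.
pose j := @Qt_map O K io _ _ (fun c : ker_of (bstage P l) => mval c).
pose f := @Qt_map O K io _ _ (@beta O P l).
pose q := @Qt_map O K io _ _ (fun h => qpi (range (@beta O P l)) h).
have jl0 : semilin idfun (fun c : ker_of (bstage P l) => mval c) by [].
have fl0 : semilin idfun (@beta O P l) := betaS_semilin P_free (bstage_inv P_free l).
have ql0 : semilin idfun (fun h : twist 1 (coker_beta P l) => qpi (range (@beta O P l)) h).
  by move=> b x y; rewrite qpi_add qpi_scale.
have jl : semilin idfun j := bc_map_semilin (th := idfun : {rmorphism O -> O}) (psi := idfun : {rmorphism K -> K}) (phi := io) (phi' := io) (fun=> erefl) jl0.
have fl : semilin idfun f := bc_map_semilin (th := idfun : {rmorphism O -> O}) (psi := idfun : {rmorphism K -> K}) (phi := io) (phi' := io) (fun=> erefl) fl0.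
have ql : semilin idfun q := bc_map_semilin (th := idfun : {rmorphism O -> O}) (psi := idfun : {rmorphism K -> K}) (phi := io) (phi' := io) (fun=> erefl) ql0.
have jE x : j (bc1 io x) = bc1 io (mval x)
  := bc_mapE (th := idfun : {rmorphism O -> O}) (psi := idfun : {rmorphism K -> K}) (phi := io) (phi' := io) (fun=> erefl) jl0 x.
have fE x : f (bc1 io x) = bc1 io (beta x)
  := bc_mapE (th := idfun : {rmorphism O -> O}) (psi := idfun : {rmorphism K -> K}) (phi := io) (phi' := io) (fun=> erefl) fl0 x.
have qE x : q (bc1 io x) = bc1 io (qpi (range (@beta O P l)) x)
  := bc_mapE (th := idfun : {rmorphism O -> O}) (psi := idfun : {rmorphism K -> K}) (phi := io) (phi' := io) (fun=> erefl) ql0 x.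
have fk i : (i < rr + c)%N -> f (ker_gen l i) = if (i < rr)%N then coker_gen l i else 0.
  move=> ic; rewrite [LHS]fE (beta_kap P_perfect mo am); last first.
    by move: ic; rewrite leq_addr /c dim_kerE /rr /=; lia.
  rewrite ltn_subRL; case: ifP => // _; exact: bc1_0.
have qk i : (i < rr)%N -> q (coker_gen l i) = 0.
  move=> ir; rewrite [LHS]qE -[qpi _ _]/(cok l.+1 (off l + i)) cok_eq0 ?bc1_0 //.
  by rewrite -ltn_subRL.
have qk' i : q (coker_gen l (rr + i)) = coker_gen l.+1 i.
  by rewrite [LHS]qE -[qpi _ _]/(cok l.+1 (off l + (rr + i))) roff.
have kb := ker_gen_basis l; have cb := coker_gen_basis l; rewrite kE in kb; rewrite cE in cb dY.
have fu i : (i < rr)%N -> 1 != 0 :> K /\ f (ker_gen l i) = 1 *: coker_gen l i.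
  by move=> ir; rewrite oner_eq0 (scale1r (coker_gen l i)) fk ?ir // ltn_addr.
have fu0 i : (rr <= i < rr + c)%N -> f (ker_gen l i) = 0.
  by case/andP=> ri ic; rewrite fk // ltnNge ri.
have jw i : (i < c)%N -> j (ker_gen l.+1 i) = ker_gen l (rr + i).
  move=> ic; rewrite [LHS]jE /ker_gen roff mval_kap //.
  by move: ic; rewrite /c dim_kerE leq_addr /=; lia.
have x'q i y : (i < t)%N -> dpair (Y' i) (q y) = dpair (Y (rr + i)%N) y.
  move=> it; have [d ->] := cb.2 y.
  rewrite (semilin_sum ql (rr + t) d (coker_gen l)).
  rewrite (dpair_sum _ (rr + t) d (fun k => q (coker_gen l k))).
  rewrite (dpair_sum _ (rr + t) d (coker_gen l)); apply: eq_bigr => k _; congr (_ * _).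
  case: (ltnP k rr) => kr.
    rewrite qk // dpair0r dY ?ltn_add2l // gtn_eqF //.
    exact: leq_trans kr (leq_addr _ _).
  have kt : (k - rr < t)%N by rewrite -(ltn_add2l rr) subnKC.
  by rewrite -(subnKC kr) qk' dY' // dY ?ltn_add2l // eqn_add2l.
have xg : generates t (fun i => q (coker_gen l (rr + i))).
  move=> x; have [d ->] := (coker_gen_basis l.+1).2 x; exists d.
  by apply: eq_bigr => k _; rewrite qk'.
(* The dimensions occur in the types of the wedges, so they are generalised before the equalities
   with [rr + c] and [rr + t] are substituted. *)
have main a0 b0 : a0 = (rr + c)%N -> b0 = (rr + t)%N ->
    linear (@fourterm_iso K _ _ _ _ j f q a0 b0 c t) /\
    @fourterm_iso K _ _ _ _ j f q a0 b0 c t (tpure (wedge a0 (ker_gen l)) (wedge b0 Y)) =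
    tpure (wedge c (ker_gen l.+1)) (wedge t Y').
  move=> -> ->; have [il iE] := fourterm_isoP jl fl kb cb dY fu fu0 jw x'q (ker_gen_basis l.+1).2 xg.
  split=> //; rewrite (iE (ker_gen l) (coker_gen l) Y (fun=> 1) (ker_gen l.+1) Y') ?addnK //.
  by rewrite big1 // (scale1r (tpure _ _)).
exact: main kE cE.
Qed.

(** Stated for a successor stage because [k0] is a successor by definition. The intermediate dual
    families are auxiliary choices. *)
Lemma det_compP l Y Y' c : dual_families (dim_coker P 0) (coker_gen 0) Y ->
  dual_families (dim_coker P l.+1) (coker_gen l.+1) Y' ->
  @det_comp O K io P r l.+1 (c *: tpure (wedge (dim_ker P r 0) (ker_gen 0)) (wedge (dim_coker P 0) Y)) =
  c *: tpure (wedge (dim_ker P r l.+1) (ker_gen l.+1)) (wedge (dim_coker P l.+1) Y').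
Proof.
move=> dY; elim: l Y' => [|l IH] Y' dY'.
  have [sl sE] := det_stepP dY dY'.
  have [_ _ _ sZ] := semilinearB (phi := idfun) (semilin_id sl).
  by rewrite -sE; apply: sZ.
have [Z dZ] := dual_exists (coker_gen_basis l.+1); have [sl sE] := det_stepP dZ dY'.
have [_ _ _ sZ] := semilinearB (phi := idfun) (semilin_id sl).
exact: etrans (congr1 (@det_step O K io P r l.+1) (IH Z dZ)) (etrans (sZ c _) (congr1 (fun z => c *: z) sE)).
Qed.

(** At stage k0 all m 1 lifts have been discarded, so the kernel generators map to the classes [e1]
    from index m 1 on, and the forms are pulled back from the last cokernel. *)
Lemma RmapE Y Y' c : dual_families (e_num P) (coker_gen 0) Y ->
  dual_families (tau P) (coker_gen (k0 P)) Y' ->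
  @Rmap O K io P r (c *: tpure (wedge (r + e_num P) (ker_gen 0)) (wedge (e_num P) Y)) =
  c *: tpure (wedge (sigma P) (fun i => bc1 io (e1 m u (m 1 + i))))
    (wedge (tau P) (fun i => dual_map
      (@Qt_map O K io _ _ (fun h : twist (k0 P) (coh (C0 P) 2) => cokB_pr (bstage P (k0 P)) h)) (Y' i))).
Proof.
move=> dY dY'; have ok0 := off_k0 io_inj P_perfect mo am.
have e := det_compP c dY dY'.
pose inv := bstage_inv P_free (k0 P).
have kl : semilin idfun (@Qt_map O K io _ _ (@kerB_in O P (k0 P) (bstage P (k0 P)))).
  exact: (bc_map_semilin (th := idfun : {rmorphism O -> O}) (psi := idfun : {rmorphism K -> K})
    (phi := io) (phi' := io) (fun=> erefl) (si_in_lin inv)).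
have ql : semilin idfun (@Qt_map O K io _ _
    (fun h : twist (k0 P) (coh (C0 P) 2) => cokB_pr (bstage P (k0 P)) h)).
  exact: (bc_map_semilin (th := idfun : {rmorphism O -> O}) (psi := idfun : {rmorphism K -> K})
    (phi := io) (phi' := io) (fun=> erefl) (si_pr_lin inv)).
have dl := semilin_id (dual_map_linear ql).
have x'E i : (i < sigma P)%N -> @Qt_map O K io _ _ (@kerB_in O P (k0 P) (bstage P (k0 P)))
    (ker_gen (k0 P) i) = bc1 io (e1 m u (m 1 + i)).
  move=> ih; apply: etrans (bc_mapE (th := idfun : {rmorphism O -> O})
    (psi := idfun : {rmorphism K -> K}) (phi := io) (phi' := io) (fun=> erefl) (si_in_lin inv) _) _.
  have ok : (off (k0 P) <= off (k0 P) + i < m 1 + h1)%N.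
    by rewrite leq_addr ok0 ltn_add2l -(sigmaE io_inj P_perfect mo am).
  by have := kapE P_perfect mo am ok; rewrite ok0 => ->.
have main := @tens_wedge_mapE _ _ (idfun : {rmorphism K -> K}) (sigma P) (tau P) _ _ _ _ _ _
  (ker_gen (k0 P)) Y' _ c kl dl x'E.
by apply: etrans main; rewrite -e.
Qed.

End BocksteinDeterminant.

(** * Comparison of the two composites *)

Lemma sgn_bc_semilin (A R : comNzRingType) (phi : {rmorphism A -> R}) i (M : lmodType A) :
  semilin phi (@sgn_bc _ _ phi i M).
Proof.
rewrite /sgn_bc /sgn_mod; case: odd; [exact: bc1_semilinear|exact: dual_bc_semilin].
Qed.

Lemma sgn_bc_fam (A R : comNzRingType) (phi : {rmorphism A -> R}) i (M : lmodType A)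
    (w : nat -> M) w' k :
  sgn_bc phi (sgn_fam i w w' k) = sgn_fam i (fun k => bc1 phi (w k)) (fun k => dual_bc phi (w' k)) k.
Proof. by rewrite /sgn_bc /sgn_fam /sgn_mod; case: odd. Qed.

Section GeneratorChange.
Variables (A R : comNzRingType) (phi : {rmorphism A -> R}) (V : cpx A) (n : int -> nat).
Variable s : seq int.

Lemma detinv_bc_semilin : semilin phi (@detinv_bc _ _ phi V n s).
Proof.
apply: btmap_semilin => i; apply: extp_map_semilin; exact: sgn_bc_semilin.
Qed.

Lemma detinv_bc_gen (w : forall i, nat -> V i) (w' : forall i, nat -> mdual (V i)) :
  detinv_bc phi (detinv_gen n s w w') =
  detinv_gen n s (fun i k => bc1 phi (w i k) : bcC phi V i) (fun i k => dual_bc phi (w' i k)).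
Proof.
apply: etrans (btmapE _ _ _) _.
  by move=> i; apply: extp_map_semilin; exact: sgn_bc_semilin.
apply: eq_btpure => i _; apply: etrans (extp_mapE _ _ (@sgn_bc_semilin _ _ phi i (V i))) _.
by apply: eq_wedge => k _; apply: sgn_bc_fam.
Qed.

Lemma detinv_cyclic (w : forall i, nat -> V i) (w' : forall i, nat -> mdual (V i)) :
  (forall i, is_basis (n i) (w i)) -> (forall i, dual_families (n i) (w i) (w' i)) ->
  forall z : detinv V n s, exists c, z = c *: detinv_gen n s w w'.
Proof.
move=> wb ww'; apply: btens_cyclic => i x; apply: extp_cyclic.
move: (wb i) (ww' i); rewrite /sgn_mod /sgn_fam; case: odd => [[_ //]|[_ gw] dw y].
by exists (fun k => dpair y (w i k)); apply: dual_coord_form.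
Qed.

End GeneratorChange.

(* Between the generators of det^{-1} attached to two families of bases, the ratio
   is a product of transition determinants, whose formation commutes with
   base change. *)
Lemma detinv_change (A R : comNzRingType) (phi : {rmorphism A -> R}) (V : cpx A) (n : int -> nat)
    (s : seq int) (w a : forall i, nat -> V i) (w' : forall i, nat -> mdual (V i))
    (u' : forall i, nat -> mdual (bcC phi V i)) :
  (forall i, is_basis (n i) (w i)) -> (forall i, dual_families (n i) (w i) (w' i)) ->
  (forall i, is_basis (n i) (fun k => bc1 phi (a i k) : bcC phi V i)) ->
  (forall i, dual_families (n i) (fun k => bc1 phi (a i k) : bcC phi V i) (u' i)) ->
  let D i := phi (ndet (n i) (fun k l => dpair (w' i k) (a i l))) in
  exists g : int -> R, (forall i, D i * g i = 1) /\
  detinv_bc phi (detinv_gen n s w w') =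
    (\prod_(i <- s) if odd `|i|%N then g i else D i) *:
      detinv_gen n s (fun i k => bc1 phi (a i k) : bcC phi V i) u'.
Proof.
move=> wb ww' ub uu' D.
pose u i k : bcC phi V i := bc1 phi (a i k).
pose g i := ndet (n i) (fun k l => dpair (u' i l) (bc1 phi (w i k))).
have DE i : D i = ndet (n i) (fun k l => dpair (dual_bc phi (w' i k)) (u i l)).
  by rewrite /D rmorph_ndet; apply: eq_ndet => k l _ _; rewrite dual_bcE.
exists g; split=> [i|].
  rewrite DE /g -[X in _ * X]ndet_tr -ndetM -[RHS](ndet_delta _ (n i)).
  apply: eq_ndet => k l kn ln; have := ww' i k l kn ln; move=> /(congr1 phi).
  rewrite rmorph_nat -dual_bcE => <-; rewrite [in RHS](dual_coord (bc1 phi (w i l)) (ub i).2 (@uu' i)).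
  rewrite (dpair_sum _ (n i) (fun j => dpair (u' i j) (bc1 phi (w i l))) (u i)).
  by apply: eq_bigr => j _; rewrite mulrC.
rewrite detinv_bc_gen.
have [x xE] := detinv_cyclic (s := s) ub uu' (detinv_gen n s (fun i k => bc1 phi (w i k) : bcC phi V i)
  (fun i k => dual_bc phi (w' i k))).
have [L [Ll LE]] := detinv_form n s u u'.
have [_ _ _ LZ] := semilinearB Ll.
have x1 : x = \prod_(i <- s) if odd `|i|%N then g i else D i.
  have := congr1 L xE; rewrite LZ !LE => e.
  rewrite -[LHS]mulr1; apply: etrans (etrans (esym e) _); last first.
    by apply: eq_bigr => i _; case: odd; rewrite ?DE.
  congr (_ * _); rewrite big1 // => i _.
  case: odd; rewrite -[RHS](ndet_delta R (n i)); apply: eq_ndet => k l kn ln.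
    by rewrite uu' // eq_sym.
  exact: uu'.
by rewrite xE x1.
Qed.

Lemma tpure_scale_mul (R : comNzRingType) (M N : lmodType R) b c d (x : M) (y : N) :
  b *: tpure (c *: x) (d *: y) = (b * c * d) *: tpure x y.
Proof. by rewrite tpureZl tpureZr; move: (tpure x y) => w; rewrite !scalerA. Qed.

Lemma form_inj (R : comNzRingType) (M : lmodType R) (L : M -> R^o) (w : M) b c :
  semilin idfun L -> L w = 1 -> b *: w = c *: w -> b = c.
Proof.
move=> /semilinearB[_ _ _ LZ] Lw /(congr1 L); rewrite !LZ Lw.
by rewrite -[LHS]/(b * 1) -[RHS]/(c * 1) !mulr1.
Qed.

Lemma tpure_form_eq (R : comNzRingType) (M N : lmodType R) (L : tens M N -> R^o)
    (x : M) (y : N) b c b' c' d' : semilin idfun L -> L (tpure x y) = 1 ->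
  b *: (c *: tpure x y) = b' *: tpure (c' *: x) (d' *: y) -> b * c = b' * c' * d'.
Proof.
move=> Ll Lw; rewrite tpure_scale_mul; move: (tpure x y) Lw => w Lw.
by rewrite (scalerA _ _ w); apply: form_inj Lw.
Qed.

Lemma tpure_scale_l (R : comNzRingType) (M N : lmodType R) b c (x : M) (y : N) :
  b *: (c *: tpure x y) = b *: tpure (c *: x) y.
Proof. by rewrite tpureZl. Qed.

(** * Reduction modulo I of cohomology classes and forms *)

Section Reduction.
Variables (O : idomainType) (K : fieldType) (io : {rmorphism O -> K}).
Hypothesis io_inj : injective io.
Variables (P : cpx (series O)) (n : int -> nat) (lo : int) (len : nat).
Hypothesis P_perfect : perfect_cpx P n lo len.
Local Notation phi := (@to_locI O).
Local Notation ev := (@ev0 O).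
Local Notation T := (@tX O).
Local Notation evR := (evR io_inj).
Local Notation redH := (@redH O K io P).
Variables (m : int -> nat) (h1 h2 : nat) (u : forall i, nat -> P i) (a : nat -> nat).
Hypothesis mo : model phi n h1 h2 m u (fun k => T ^+ a k).
Hypothesis am : forall k l, (k <= l)%N -> (l < m 1)%N -> (a k <= a l)%N.
Variable u' : forall i, nat -> mdual (bcC phi P i).
Hypothesis uu' : forall i, dual_families (n i) (fun k => bc1 phi (u i k) : bcC phi P i) (u' i).
Local Notation off := (off m a).
Let sp := model_split mo.
Let P_free := perfect_free P_perfect.
Let phi_inj := @to_locI_inj O.
Let frac_inj := @locI_frac_inj O.

Let redC i := coh_map (V := P) (W := C0 P) (fun x : P i => bc1 ev x).

Lemma redC_semilin i : semilin ev (@redC i).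
Proof.
apply: coh_map_semilin; first exact: bc1_semilinear.
  by move=> x; apply: bcC_cocycle.
by move=> w; exists (bc1 ev w); rewrite [RHS]bcC_d1.
Qed.

Lemma redC_cls i x : cd P i (i + 1) x = 0 -> redC (coh_cls x) = coh_cls (V := C0 P) (bc1 ev x).
Proof.
apply: coh_map_cls; first exact: bc1_semilinear.
  by move=> y; apply: bcC_cocycle.
by move=> w; exists (bc1 ev w); rewrite [RHS]bcC_d1.
Qed.

Lemma redH_semilin i : semilin evR (@redH i).
Proof. exact: (@bc_map_semilin _ _ _ _ phi io _ _ ev (evR : {rmorphism locI O -> K}) _
  (fun b => evR_to io_inj b) (@redC_semilin i)). Qed.

Lemma redHE i c : redH (bc1 phi c) = bc1 io (redC (i := i) c).
Proof. exact: (@bc_mapE _ _ _ _ phi io _ _ ev (evR : {rmorphism locI O -> K}) _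
  (fun b => evR_to io_inj b) (@redC_semilin i)). Qed.

Lemma redH_cls i x : cd P i (i + 1) x = 0 ->
  redH (bc1 phi (coh_cls x)) = bc1 io (coh_cls (V := C0 P) (bc1 ev x)).
Proof. by move=> dx; rewrite redHE redC_cls. Qed.

Definition cls2 k : coh P 2 := coh_cls (u 2 (m 2 + k)%N).
Definition form2 k : mdual (HI P 2) := coh_form (u' 2 (m 1 + m 2 + k)%N).

Lemma redH_cls2 k : (k < m 1 + h2)%N -> redH (bc1 phi (cls2 k)) = bc1 io (e2 m u k).
Proof. by move=> kn; apply: redH_cls; apply: (u2_cocycle mo). Qed.

Lemma form2_cls k l : (k < h2)%N -> (l < m 1 + h2)%N ->
  dpair (form2 k) (bc1 phi (cls2 l)) = (m 1 + k == l)%N%:R.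
Proof.
move=> kh ln; case: (ltnP l (m 1)) => lm.
  rewrite [LHS](form_torsion frac_inj mo) // gtn_eqF //.
  exact: leq_trans lm (leq_addr _ _).
have lh : (l - m 1 < h2)%N by rewrite ltn_subLR.
have -> : (m 1 + k == l)%N = (k == l - m 1)%N by rewrite -(eqn_add2l (m 1) k) subnKC.
have e : (m 2 + l = m 1 + m 2 + (l - m 1))%N by lia.
by rewrite /cls2 e; apply: (y0_zeta mo uu' kh lh).
Qed.

Lemma coh2_gen c : exists b (d : nat -> series O), ~ Ipow 1 b /\
  b *: c = \sum_(k < m 1 + h2) d k *: cls2 k.
Proof.
have [b [b' [d [bb' bc]]]] := model_coh2 frac_inj phi_inj mo uu' c.
pose d' k := if (k < m 1)%N then d (cobound_start m 2 + k)%N else d (m 1 + m 2 + (k - m 1))%N.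
exists b, d'; split; first exact: to_locI_unit bb'.
have E1 : \sum_(k < m 1) d' k *: cls2 k =
    \sum_(k < m 1) d (cobound_start m 2 + k)%N *: coh_cls (u 2 (cobound_start m 2 + k)%N).
  by apply: eq_bigr => k _; rewrite /d' ltn_ord.
have E2 : \sum_(k < h2) d' (m 1 + k)%N *: cls2 (m 1 + k)%N =
    \sum_(k < h2) d (m 1 + m 2 + k)%N *: coh_cls (u 2 (m 1 + m 2 + k)%N).
  apply: eq_bigr => k _; rewrite /d' ltnNge leq_addr addKn /cls2.
  by have -> : (m 2 + (m 1 + k) = m 1 + m 2 + k)%N by lia.
exact: etrans bc (esym (etrans (sum_cat (m 1) h2 (fun k => d' k *: cls2 k)) (f_equal2 +%R E1 E2))).
Qed.

Variable Y : nat -> mdual (Qt io (coker_beta P (k0 P))).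
Hypothesis dY : dual_families (tau P) (coker_gen io m u a (k0 P)) Y.

(** The forms on H^2(C_0) produced by R^(k0); they turn out to be the reductions of the forms
    [form2] used for the localized complex. *)
Definition red_form k : mdual (Qt io (coh (C0 P) 2)) := dual_map
  (@Qt_map O K io _ _ (fun h : twist (k0 P) (coh (C0 P) 2) => cokB_pr (bstage P (k0 P)) h)) (Y k).

Let pr_lin : semilin idfun (@Qt_map O K io _ _
    (fun h : twist (k0 P) (coh (C0 P) 2) => cokB_pr (bstage P (k0 P)) h)) :=
  bc_map_semilin (th := idfun : {rmorphism O -> O}) (psi := idfun : {rmorphism K -> K})
    (phi := io) (phi' := io) (fun=> erefl) (si_pr_lin (bstage_inv P_free (k0 P))).

Lemma red_form_e2 k l : (k < h2)%N -> (l < m 1 + h2)%N ->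
  dpair (red_form k) (bc1 io (e2 m u l)) = (m 1 + k == l)%N%:R.
Proof.
move=> kh ln; rewrite /red_form (dual_mapE _ _ pr_lin).
have -> : @Qt_map O K io _ _ (fun h : twist (k0 P) (coh (C0 P) 2) => cokB_pr (bstage P (k0 P)) h)
    (bc1 io (e2 m u l)) = bc1 io (cok m u (k0 P) l).
  exact: (bc_mapE (th := idfun : {rmorphism O -> O}) (psi := idfun : {rmorphism K -> K})
    (phi := io) (phi' := io) (fun=> erefl) (si_pr_lin (bstage_inv P_free (k0 P)))).
have ok := off_k0 io_inj P_perfect mo am; have tE := tauE io_inj P_perfect mo am.
case: (ltnP l (m 1)) => lm.
  rewrite (cok_eq0 P_perfect mo am) ?ok // bc1_0 dpair0r gtn_eqF //.
  exact: leq_trans lm (leq_addr _ _).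
have lh : (l - m 1 < h2)%N by rewrite ltn_subLR.
have -> : (m 1 + k == l)%N = (k == l - m 1)%N by rewrite -(eqn_add2l (m 1) k) subnKC.
have := @dY k (l - m 1)%N; rewrite tE => /(_ kh lh) <-.
by rewrite /coker_gen ok subnKC.
Qed.

(** Both sides are semilinear along [evR] and agree on the classes [cls2]: torsion classes are
    killed on the left because they vanish in the last cokernel, on the right because forms ignore
    torsion. The classes generate H^2 up to denominators that are nonzero modulo I. *)
Lemma red_form_form2 k g : (k < h2)%N -> dpair (red_form k) (redH g) = evR (dpair (form2 k) g).
Proof.
move=> kh.
pose F (g : HI P 2) : K^o := dpair (red_form k) (redH g).
pose G (g : HI P 2) : K^o := evR (dpair (form2 k) g).
have Fl : semilin evR F.
  by move=> b x y; rewrite /F redH_semilin dpairDr dpairZr.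
have Gl : semilin evR G.
  by move=> b x y; rewrite /G dpairDr dpairZr rmorphD rmorphM.
rewrite -/(F g) -/(G g).
suff e c : F (bc1 phi c) = G (bc1 phi c) by exact: (semilin_bc_ext Fl Gl e).
have [b [d [Ib bc]]] := coh2_gen c.
have ex (H : HI P 2 -> K^o) : semilin evR H -> io (b 0%N) * H (bc1 phi c) =
    \sum_(l < m 1 + h2) io (d l 0%N) * H (bc1 phi (cls2 l)).
  move=> Hl; have [_ _ _ HZ] := semilinearB Hl.
  transitivity (H (bc1 phi (b *: c))).
    rewrite bc1Z; apply: esym; apply: etrans (HZ _ _) _.
    by congr (_ * _); apply: evR_to.
  rewrite bc (bc1_sum phi (m 1 + h2) d cls2).
  rewrite (semilin_sum Hl (m 1 + h2) (fun l => phi (d l)) (fun l => bc1 phi (cls2 l))).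
  apply: eq_bigr => l _; congr (_ * _); exact: evR_to.
have := ex F Fl; rewrite (eq_bigr (fun l : 'I_(m 1 + h2) => io (d l 0%N) * G (bc1 phi (cls2 l)))).
  rewrite -(ex G Gl); apply: mulfI; exact: io_neq0.
move=> l _; congr (_ * _); rewrite /F /G redH_cls2 // red_form_e2 // form2_cls //.
by rewrite rmorph_nat.
Qed.

(** The image of [redH] contains the classes [e2] from index off 0 on, which form a K-basis of H^2
    of C_0 after tensoring with K. *)
Lemma red_dual_unique (y y' : mdual (Qt io (coh (C0 P) 2))) :
  (forall g, dpair y (redH g) = dpair y' (redH g)) -> y = y'.
Proof.
move=> e; apply: dpair_ext => x.
have [d ->] := (coker_gen_basis io_inj P_perfect mo am 0).2 x.
have N0 : dim_coker P 0 = (m 1 + h2 - off 0)%N := dim_cokerE io_inj P_perfect mo am 0.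
rewrite (dpair_sum y _ d (coker_gen io m u a 0)) (dpair_sum y' _ d (coker_gen io m u a 0)).
apply: eq_bigr => k _; congr (_ * _).
have kn : (off 0 + k < m 1 + h2)%N by rewrite -ltn_subRL -N0.
by have := e (bc1 phi (cls2 (off 0 + k))); rewrite (redH_cls2 kn).
Qed.

(** A reduction of an arbitrary form exists: expand the form in the [form2], reduce the coefficients
    and replace each [form2 k] by [red_form k]. So the choice in [red_dual] is not the default. *)
Lemma red_dualP y g : dpair (red_dual io y) (redH g) = evR (dpair y g).
Proof.
rewrite /red_dual; case: xgetP => [y' _ //|none]; exfalso.
pose c k := dpair y (bc1 phi (coh_cls (u 2 (m 1 + m 2 + k)%N))).
apply: (none (\sum_(k < h2) evR (c k) *: red_form k)) => {}g.
rewrite (dpair_suml h2 (fun k => evR (c k)) red_form (redH g)).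
transitivity (\sum_(k < h2) evR (c k * dpair (form2 k) g)).
  by apply: eq_bigr => k _; rewrite red_form_form2 // rmorphM.
rewrite -rmorph_sum -(dpair_suml h2 c form2 g) /c /form2.
by rewrite -(form_expand frac_inj phi_inj mo uu' y).
Qed.

Lemma red_dual_semilin : semilin evR (@red_dual O K io P).
Proof.
move=> b y y'; apply: red_dual_unique => g.
by rewrite dpairDl dpairZl !red_dualP dpairDl dpairZl rmorphD rmorphM.
Qed.

Lemma red_dual_form2 k : (k < h2)%N -> red_dual io (form2 k) = red_form k.
Proof. by move=> kh; apply: red_dual_unique => g; rewrite red_dualP red_form_form2. Qed.

Definition gen1 k : HI P 1 := bc1 phi (coh_cls (u 1 (m 0 + m 1 + k)%N)).

Lemma redH_gen1 k : (k < h1)%N -> redH (gen1 k) = bc1 io (e1 m u (m 1 + k)).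
Proof.
move=> kh; rewrite /gen1 redH_cls; last exact: (split_coh_cocycle (i := 1) sp).
by rewrite /e1 addnA.
Qed.

Lemma gen1_basis : is_basis h1 gen1.
Proof.
apply: bc_basis; last by move=> c; apply: (model_coh1 frac_inj phi_inj mo uu').
exact: (model_coh_indep phi_inj mo (i := 1)).
Qed.

Lemma form2_gen : generates h2 form2.
Proof.
move=> y; exists (fun k => dpair y (bc1 phi (coh_cls (u 2 (m 1 + m 2 + k)%N)))).
exact: (form_expand frac_inj phi_inj mo uu' y).
Qed.

Lemma pi_form : exists L : tens (extp h1 (HI P 1)) (extp h2 (mdual (HI P 2))) -> (locI O)^o,
  semilin idfun L /\ L (tpure (wedge h1 gen1) (wedge h2 form2)) = 1.
Proof.
have [y dy] := dual_exists gen1_basis.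
have [L1 [L1l L1E]] := extp_form h1 y.
have [L2 [L2l L2E]] := extp_dual_form h2 (fun k => bc1 phi (coh_cls (u 2 (m 1 + m 2 + k)%N))).
have [L [Ll LE]] := tens_form L1l L2l; exists L; split=> //.
rewrite LE L1E L2E -[RHS]mulr1; congr (_ * _).
  by rewrite -[RHS](ndet_delta _ h1); apply: eq_ndet => k l kn ln; rewrite dy // eq_sym.
by rewrite -[RHS](ndet_delta _ h2); apply: eq_ndet => k l kn ln; apply: (y0_zeta mo uu' kn ln).
Qed.

End Reduction.

(** * Evaluation of D on multiples of the adapted generator *)

Section Specialization.
Variables (O : idomainType) (K : fieldType) (io : {rmorphism O -> K}).
Hypothesis io_inj : injective io.
Variables (P : cpx (series O)) (n : int -> nat) (lo : int) (len : nat).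
Hypothesis P_perfect : perfect_cpx P n lo len.
Local Notation phi := (@to_locI O).
Local Notation T := (@tX O).
Local Notation evR := (evR io_inj).
Variables (m : int -> nat) (u : forall i, nat -> P i) (a : nat -> nat).
Hypothesis mo : model phi n (sigma P) (tau P) m u (fun k => T ^+ a k).
Hypothesis am : forall k l, (k <= l)%N -> (l < m 1)%N -> (a k <= a l)%N.
Variable u' : forall i, nat -> mdual (bcC phi P i).
Hypothesis uu' : forall i, dual_families (n i) (fun k => bc1 phi (u i k) : bcC phi P i) (u' i).
Variable Y : nat -> mdual (Qt io (coker_beta P (k0 P))).
Hypothesis dY : dual_families (tau P) (coker_gen io m u a (k0 P)) Y.
Local Notation G := (tpure (wedge (sigma P) (gen1 m u)) (wedge (tau P) (form2 m u'))).
Local Notation G0 := (tpure (wedge (sigma P) (fun i => bc1 io (e1 m u (m 1 + i))))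
  (wedge (tau P) (red_form Y))).

Lemma extp_redH : extp_map (evI io) (@redH O K io P 1) (wedge (sigma P) (gen1 m u)) =
  wedge (sigma P) (fun i => bc1 io (e1 m u (m 1 + i))).
Proof.
transitivity (wedge (sigma P) (@redH O K io P 1 \o gen1 m u)).
  exact: (@extp_mapE _ _ (sigma P) _ _ (evR : {rmorphism locI O -> K}) _ (gen1 m u)
    (redH_semilin io_inj (P := P) (i := 1))).
by apply: eq_wedge => k kh; apply: (redH_gen1 io_inj mo).
Qed.

Lemma extp_red_dual : extp_map (evI io) (@red_dual O K io P) (wedge (tau P) (form2 m u')) =
  wedge (tau P) (red_form Y).
Proof.
have rl := red_dual_semilin io_inj P_perfect mo am uu' dY.
transitivity (wedge (tau P) (@red_dual O K io P \o form2 m u')).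
  exact: (@extp_mapE _ _ (tau P) _ _ (evR : {rmorphism locI O -> K}) _ (form2 m u') rl).
by apply: eq_wedge => k kh; apply: (red_dual_form2 io_inj P_perfect mo am uu' dY).
Qed.

(** [Dmap] uses some decomposition of its argument as a multiple of a pure tensor. Any such tensor
    is a multiple of the generator, and comparing coefficients there shows that the resulting value
    does not depend on the decomposition. *)
Lemma DmapE kappa : Dmap io (to_locI (T ^+ varrho P) *: (kappa *: G)) = evR kappa *: G0.
Proof.
have Rl : semilin evR (extp_map (n := sigma P) (evI io) (@redH O K io P 1)).
  exact: (@extp_map_semilin _ _ (evR : {rmorphism locI O -> K}) (sigma P) _ _ _ (redH_semilin io_inj (P := P) (i := 1))).
have Dl : semilin evR (extp_map (n := tau P) (evI io) (@red_dual O K io P)).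
  exact: (@extp_map_semilin _ _ (evR : {rmorphism locI O -> K}) (tau P) _ _ _
    (red_dual_semilin io_inj P_perfect mo am uu' dY)).
have [_ _ _ RZ] := semilinearB Rl; have [_ _ _ DZ] := semilinearB Dl.
have RE xi : extp_map (evI io) (@redH O K io P 1) (xi *: wedge (sigma P) (gen1 m u)) =
    evR xi *: wedge (sigma P) (fun i => bc1 io (e1 m u (m 1 + i))).
  exact: etrans (RZ xi _) (congr1 (fun w => evR xi *: w) extp_redH).
have DE eta : extp_map (evI io) (@red_dual O K io P) (eta *: wedge (tau P) (form2 m u')) =
    evR eta *: wedge (tau P) (red_form Y).
  exact: etrans (DZ eta _) (congr1 (fun w => evR eta *: w) extp_red_dual).
have [L [Ll L1]] := pi_form mo uu'.
rewrite /Dmap; case: xgetP => [v _ [b [x [y [Ib wE ->]]]]|none]; last first.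
  case: (none (evR kappa *: G0)).
  exists (T ^+ varrho P), (kappa *: wedge (sigma P) (gen1 m u)), (wedge (tau P) (form2 m u')).
  split; first by rewrite -[T ^+ _]mulr1; apply: Ipow_tXnM.
    exact: tpure_scale_l.
  have -> : Qclass (varrho P) (T ^+ varrho P) = 1.
    by rewrite /Qclass -[T ^+ _]mulr1 series_tXn ltnn subnn.
  rewrite RE extp_red_dual rmorph1 (scale1r (tpure _ _)); exact: esym (tpureZl _ _ _).
have [xi xE] := extp_cyclic (n := sigma P) x (gen1_basis mo uu').2.
have [eta yE] := extp_cyclic (n := tau P) y (form2_gen mo uu').
have [b' bE] := Ipow_tXn Ib.
(* The coefficients on the generator are compared by a form with value 1 on it, and T^varrho is then
   cancelled in Lambda_I. *)
rewrite xE yE in wE *; have k1 : kappa = to_locI b' * xi * eta.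
  have e := tpure_form_eq Ll L1 wE; apply: (@phiT_lreg O (varrho P)).
  by rewrite -rmorphXn; apply: etrans e _; rewrite bE rmorphM !mulrA.
rewrite RE DE; suff -> : evR kappa = io (Qclass (varrho P) b) * evR xi * evR eta.
  exact: tpure_scale_mul.
by rewrite k1 !rmorphM /= evR_to bE /Qclass series_tXn ltnn subnn.
Qed.

End Specialization.

Lemma linear_scale2 (R : comNzRingType) (M N : lmodType R) (f : M -> N) x y t (g : M) (w : N) :
  semilin idfun f -> f g = t *: w -> f (x *: (y *: g)) = t *: ((x * y) *: w).
Proof.
move=> /semilinearB[_ _ _ fZ] e; rewrite !fZ e /= !scalerA; congr (_ *: _).
by rewrite mulrC mulrA.
Qed.

(** * Comparison of both composites on all of det^{-1}(P) *)

Section Comparison.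
Variables (O : idomainType) (K : fieldType) (io : {rmorphism O -> K}).
Hypothesis io_inj : injective io.
Variables (P : cpx (series O)) (n : int -> nat) (lo : int) (len : nat).
Hypothesis P_perfect : perfect_cpx P n lo len.
Local Notation phi := (@to_locI O).
Local Notation ev := (@ev0 O).
Local Notation T := (@tX O).
Local Notation evR := (evR io_inj).
Variables (m : int -> nat) (u : forall i, nat -> P i) (a : nat -> nat).
Hypothesis mo : model phi n (sigma P) (tau P) m u (fun k => T ^+ a k).
Hypothesis am : forall k l, (k <= l)%N -> (l < m 1)%N -> (a k <= a l)%N.
Hypothesis tau_sigma : (tau P <= sigma P)%N.
Local Notation r := (sigma P - tau P)%N.
Local Notation s := (degrees lo len).
Local Notation off := (off m a).
Let mo0 := model0 io_inj P_perfect mo am.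
Let n0 := perfect_n0 P_perfect.

Lemma e_numE0 : e_num P = (m 1 - off 0 + tau P)%N.
Proof.
by have := dim_cokerE io_inj P_perfect mo am 0; rewrite /= => ->; rewrite addnBAC // off_le.
Qed.

Section Generator.
Variables (w : forall i, nat -> P i) (w' : forall i, nat -> mdual (P i)).
Hypothesis wb : forall i, is_basis (n i) (w i).
Hypothesis ww' : forall i, dual_families (n i) (w i) (w' i).
Variable u' : forall i, nat -> mdual (bcC phi P i).
Hypothesis uu' : forall i, dual_families (n i) (fun k => bc1 phi (u i k) : bcC phi P i) (u' i).
Variable v' : forall i, nat -> mdual (bcC io (C0 P) i).
Hypothesis vv' : forall i, dual_families (n i) (fun k => bc1 io (bc1 ev (u i k)) : bcC io (C0 P) i) (v' i).
Local Notation G := (tpure (wedge (sigma P) (gen1 m u)) (wedge (tau P) (form2 m u'))).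

(** The ratio between the generators attached to w and to u is a product of transition determinants
    and their inverses in Lambda_I; reducing each factor modulo I gives the ratio over C_0. This
    replaces the missing property that u is a Lambda-basis. *)
Lemma generator_ratio : exists x : locI O,
  detinv_bc phi (detinv_gen n s w w') =
    x *: detinv_gen n s (fun i k => bc1 phi (u i k) : bcC phi P i) u' /\
  detinv_bc io (detinv_bc ev (detinv_gen n s w w')) =
    evR x *: detinv_gen n s (fun i k => bc1 io (bc1 ev (u i k)) : bcC io (C0 P) i) v'.
Proof.
have [g [gD gE]] := detinv_change s wb ww' (model_basis mo) uu'.
have w0b i : is_basis (n i) (fun k => bc1 ev (w i k) : C0 P i).
  exact: (perfect_bc_basis ev (wb i)).
have ww0 i : dual_families (n i) (fun k => bc1 ev (w i k) : C0 P i) (fun k => dual_bc ev (w' i k)).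
  by move=> k l kn ln; rewrite dual_bcE ww' // rmorph_nat.
have [g0 [g0D g0E]] := detinv_change s w0b ww0 (model_basis mo0) vv'.
eexists; split; first exact: gE.
rewrite detinv_bc_gen; apply: etrans g0E _; congr (_ *: _).
rewrite rmorph_prod; apply: eq_bigr => i _.
have DE : evR (phi (ndet (n i) (fun k l => dpair (w' i k) (u i l)))) =
    io (ndet (n i) (fun k l => dpair (dual_bc ev (w' i k)) (bc1 ev (u i l)))).
  rewrite evR_to; congr (io _); apply: etrans (rmorph_ndet ev _ _) _.
  by apply: eq_ndet => k l _ _; rewrite dual_bcE.
case: odd; last exact: esym DE.
(* In odd degrees the factor is the inverse of the determinant; both candidates invert the same
   nonzero element of K. *)
have e : io (ndet (n i) (fun k l => dpair (dual_bc ev (w' i k)) (bc1 ev (u i l)))) * evR (g i) = 1.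
  by rewrite -DE -rmorphM -[RHS](rmorph1 evR); apply: congr1 (gD i).
have D0 : io (ndet (n i) (fun k l => dpair (dual_bc ev (w' i k)) (bc1 ev (u i l)))) != 0.
  by apply: contra_eqN e => /eqP ->; rewrite mul0r eq_sym oner_eq0.
by apply: (mulfI D0); apply: etrans (g0D i) (esym e).
Qed.

Lemma pi_mapE c x : detinv_bc phi (detinv_gen n s w w') =
    x *: detinv_gen n s (fun i k => bc1 phi (u i k) : bcC phi P i) u' ->
  pi_map (c *: detinv_gen n s w w') = to_locI (T ^+ varrho P) *: ((to_locI c * x) *: G).
Proof.
move=> xE; rewrite /pi_map.
have [_ _ _ dZ] := semilinearB (@detinv_bc_semilin _ _ phi P n s).
have -> : detinv_bc phi (c *: detinv_gen n s w w') = to_locI c *: (x *: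
    detinv_gen n s (fun i k => bc1 phi (u i k) : bcC phi P i) u').
  exact: etrans (dZ c _) (congr1 (fun z => to_locI c *: z) xE).
apply: linear_scale2.
  exact: semilin_id (model_is_det_coh (@locI_frac_inj O) (@to_locI_inj O) mo n0 uu').1.
apply: etrans (det_coh_model (@locI_frac_inj O) (@to_locI_inj O) mo n0 uu') _.
(* The coefficient of the normalization is the product of the T^(a k), which is T^varrho because the
   exponents add up to varrho. *)
rewrite (varrhoE io_inj P_perfect mo am) -rmorph_prod.
by rewrite (big_morph (fun k => T ^+ k) (exprD T) (expr0 T)).
Qed.

Lemma pi0_mapE c x : detinv_bc io (detinv_bc ev (detinv_gen n s w w')) =
    x *: detinv_gen n s (fun i k => bc1 io (bc1 ev (u i k)) : bcC io (C0 P) i) v' ->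
  pi0_map io r (detinv_bc ev (c *: detinv_gen n s w w')) = (io (c 0%N) * x) *:
    tpure (wedge (r + e_num P) (ker_gen io m u a 0))
      (wedge (e_num P) (fun k => coh_form (v' 2 (off 0 + m 2 + k)%N))).
Proof.
move=> xE; rewrite /pi0_map.
have [_ _ _ dZ] := semilinearB (@detinv_bc_semilin _ _ ev P n s).
have [_ _ _ iZ] := semilinearB (@detinv_bc_semilin _ _ io (C0 P) n s).
have -> : detinv_bc io (detinv_bc ev (c *: detinv_gen n s w w')) = io (c 0%N) *: (x *:
    detinv_gen n s (fun i k => bc1 io (bc1 ev (u i k)) : bcC io (C0 P) i) v').
  apply: etrans (congr1 (@detinv_bc _ _ io (C0 P) n s) (dZ c _)) _.
  exact: etrans (iZ (c 0%N) _) (congr1 (fun z => io (c 0%N) *: z) xE).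
(* The dimensions r + e and e appear in the type of [det_coh]; they are generalised so that the
   values coming from the reduced model can be substituted. *)
have key d1 d2 : d1 = (m 1 - off 0 + sigma P)%N -> d2 = (m 1 - off 0 + tau P)%N ->
    @det_coh O K io (C0 P) n s d1 d2 (io (c 0%N) *: (x *:
      detinv_gen n s (fun i k => bc1 io (bc1 ev (u i k)) : bcC io (C0 P) i) v')) =
    1 *: ((io (c 0%N) * x) *: tpure (wedge d1 (ker_gen io m u a 0))
      (wedge d2 (fun k => coh_form (v' 2 (off 0 + m 2 + k)%N)))).
  move=> -> ->; apply: linear_scale2.
    exact: semilin_id (model_is_det_coh (psi := idfun : {rmorphism K -> K}) (@inj_id K)
      io_inj mo0 n0 vv').1.
  apply: etrans (det_coh_model (psi := idfun : {rmorphism K -> K}) (@inj_id K)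
    io_inj mo0 n0 vv') _.
  have p1 : \prod_(k < m0 m a 1) io 1 = 1 by rewrite big1 // => k _; rewrite rmorph1.
  have kE : wedge (m 1 - off 0 + sigma P)
      (fun k => bc1 io (coh_cls (V := C0 P) (bc1 ev (u 1 (m0 m a 0 + m0 m a 1 + k)%N)))) =
    wedge (m 1 - off 0 + sigma P) (ker_gen io m u a 0).
    apply: eq_wedge => k kn; rewrite /ker_gen.
    have kr : (off 0 <= off 0 + k < m 1 + sigma P)%N.
      rewrite leq_addr -(subnKC (leq_trans (off_le m a 0) (leq_addr (sigma P) (m 1)))).
      by rewrite ltn_add2l -addnBAC // off_le.
    have e := kapE P_perfect mo am (l := 0) kr.
    have -> : (m0 m a 0 + m0 m a 1 + k = m 0 + (off 0 + k))%N by rewrite addnA.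
    exact: (congr1 (fun h : coh (C0 P) 1 => bc1 io h) (esym e)).
  exact: (f_equal2 (fun p q => p *: tpure q (wedge (m 1 - off 0 + tau P)
    (fun k => coh_form (v' 2 (off 0 + m 2 + k)%N)))) p1 kE).
have o0 := off_le m a 0.
have reE : (r + e_num P = m 1 - off 0 + sigma P)%N by rewrite e_numE0; lia.
by apply: etrans (key _ _ reE e_numE0) _; apply: scale1r.
Qed.

End Generator.

Lemma pi_Rmap (z : detinv P n s) : pi_lattice (pi_map z) /\
  Dmap io (pi_map z) = Rmap (pi0_map io r (detinv_bc ev z)).
Proof.
pose w i := sval (cid (P_perfect.1 i)).
have wb i : is_basis (n i) (w i) := svalP (cid (P_perfect.1 i)).
pose w' i := sval (cid (dual_exists (wb i))).
have ww' i : dual_families (n i) (w i) (w' i) := svalP (cid (dual_exists (wb i))).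
have [u' uu'] := model_dual mo; have [v' vv'] := model_dual mo0.
have [Y dY] := dual_exists (coker_gen_basis io_inj P_perfect mo am (k0 P)).
(* The coefficient c lies in Lambda because w consists of genuine bases; the adapted vectors enter
   only through the ratio x. *)
have [c ->] := detinv_cyclic wb ww' z.
have [x [xE x0E]] := generator_ratio wb ww' uu' vv'.
rewrite (pi_mapE uu' c xE) (pi0_mapE vv' c x0E); split.
  by exists (T ^+ varrho P); eexists; split=> //; rewrite -[T ^+ _]mulr1; apply: Ipow_tXnM.
rewrite (DmapE io_inj P_perfect mo am uu' dY).
(* The forms attached to the reduced adapted bases are dual to the generators of stage 0, so the
   value of [pi0_map] has the shape to which [RmapE] applies. *)
have dY0 : dual_families (e_num P) (coker_gen io m u a 0)
    (fun k => coh_form (v' 2 (off 0 + m 2 + k)%N)).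
  move=> k l; rewrite e_numE0 => kn ln; apply: etrans (y0_zeta mo0 vv' kn ln).
  have -> : (m0 m a 1 + m0 m a 2 + l = m 2 + (off 0 + l))%N.
    by rewrite -[m0 m a 1]/(off 0) -[m0 m a 2]/(m 2) addnCA addnA.
  by [].
apply: etrans (esym (RmapE io_inj P_perfect mo am tau_sigma (io (c 0%N) * evR x) dY0 dY)).
suff -> : evR (to_locI c * x) = io (c 0%N) * evR x by [].
by rewrite rmorphM /= evR_to.
Qed.

End Comparison.

Theorem theorem2p13 (p : nat) (p_pr : prime p) (K : fieldExtType (Qp p_pr))
    (C P : cpx (series (Oring K))) (f : forall i : int, {linear P i -> C i})
    (n : int -> nat) (lo : int) (len : nat)
    (C_bounded : bounded C) (C_fg : forall i : int, fin_gen (C i))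
    (P_perfect : perfect_cpx P n lo len) (f_qis : quasi_iso f)
    (CI_acyclic : forall i : int, i != 1 -> i != 2 ->
       acyclic_at (bcC (@to_locI (Oring K)) P) i)
    (H1_free : exists (m : nat) (u : nat -> coh (bcC (@to_locI (Oring K)) P) 1),
       is_basis m u)
    (rk_ge : (rk (coh C 2) <= rk (coh C 1))%N) :
  let r := (rk (coh C 1) - rk (coh C 2))%N in
  let s := degrees lo len in
  forall z : detinv P n s,
    pi_lattice (pi_map z) /\
    Dmap (@OtoK p p_pr K) (pi_map z) =
    Rmap (pi0_map (@OtoK p p_pr K) r (detinv_bc (@ev0 (Oring K)) z)).
Proof.
move=> r s z.
have io_inj : injective (@OtoK p p_pr K) := val_inj.
have [m [h1 [h2 [u [a [mo am]]]]]] := integral_model P_perfect CI_acyclic H1_free.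
have rkC i : rk (coh C i) = rk (coh P i).
  have [cf bf] := f_qis; apply: esym; apply: rk_bij (bf i).
  apply: coh_map_semilin; first exact: (semilin_id (linearP (f i))).
    by move=> x dx; rewrite -cf dx linear0.
  by move=> w; exists (f (i - 1) w); rewrite -cf.
have e1 := sigmaE io_inj P_perfect mo am; have e2 := tauE io_inj P_perfect mo am.
have rk1 := rk_coh1 mo; have rk2 := rk_coh2 mo.
(* The cohomology ranks of the model become [sigma P] and [tau P] themselves, the exterior degrees
   in the type of [pi_map]. *)
subst h1 h2.
have ts : (tau P <= sigma P)%N by rewrite -rk1 -rk2 -!rkC.
have rE : r = (sigma P - tau P)%N by rewrite /r !rkC rk1 rk2.
rewrite rE; exact: (pi_Rmap io_inj P_perfect mo am ts z).
Qed.
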